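(* Let $c\in\{-1,0,1\}$, let $B$ be the closed unit ball of the space form $\mathbb{M}_c^{n+1}$ described in the context, and let $\Sigma^n$ be a free boundary hypersurface in $B$. If $\Sigma$ has constant mean curvature and $\Delta_\Sigma|\phi|^2\geq 0$, where $\phi$ is the umbilicity tensor of $\Sigma$, then each connected component of $\partial\Sigma$ is a totally umbilical hypersurface of $\partial B$ with constant mean curvature.
   Context: Space form model: for $c\in\{-1,0,1\}$ let $R=\infty$ if $c\in\{0,1\}$ and $R=2$ if $c=-1$, and let $B_R\subset\mathbb{R}^{n+1}$ be the open Euclidean ball of radius $R$ centered at the origin. Then $\mathbb{M}_c^{n+1}=(B_R,\widehat g)$ with $\widehat g=\left(1+\frac{c}{4}|x|^2\right)^{-2}g$, $g$ the Euclidean metric. The number $0<r<R$ is chosen such that the closed ball $B=(\overline{B}_r,\widehat g)$, where $\overline{B}_r$ is the closed Euclidean ball of radius $r$ centered at the origin, has radius $1$ in $\mathbb{M}_c^{n+1}$. Free boundary: a compact oriented smooth hypersurface $\Sigma$ with non-empty boundary $\partial\Sigma$ is a free boundary hypersurface in $B$ if $\mathrm{int}(\Sigma)\subset\mathrm{int}(B)$, $\partial\Sigma\subset\partial B$, and $\Sigma$ meets $\partial B$ orthogonally. Notation: $A$ is the Weingarten operator of $\Sigma$, the mean curvature is $H=\mathrm{tr}\,A$, the umbilicity tensor is $\phi=A-\frac{H}{n}I$, and $\Delta_\Sigma$ is the Laplacian of $\Sigma$ (sign convention: trace of the Hessian). *)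

(* Defs.v *)
From HB Require Import structures.
From mathcomp Require Export all_boot all_order all_algebra.
From mathcomp Require Export all_classical all_reals all_analysis.

Set Implicit Arguments.
Unset Strict Implicit.
Unset Printing Implicit Defensive.

Export Order.TTheory GRing.Theory Num.Theory numFieldNormedType.Exports.

Global Open Scope classical_set_scope.
Global Open Scope ring_scope.

Section Calculus.
Context {R : realType}.

(* The norm [`|x|] of the library on row vectors is the sup norm. *)
Definition enorm m (x : 'rV[R]_m) : R := Num.sqrt (\sum_i x 0 i ^+ 2).

Definition partial m (V : normedModType R) (i : 'I_m) (f : 'rV[R]_m -> V)
  (x : 'rV[R]_m) : V := 'D_(delta_mx 0 i) f x.

(* [U] is meant to be open. *)
Fixpoint differentiable_upto (k : nat) m (V : normedModType R)
    (U : set 'rV[R]_m) (f : 'rV[R]_m -> V) : Prop :=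
  (forall x, U x -> {for x, continuous f}) /\
  if k is k'.+1 then
    forall i : 'I_m, (forall x, U x -> derivable f x (delta_mx 0 i)) /\
                     differentiable_upto k' U (partial i f)
  else True.

Definition smooth m (V : normedModType R) (U : set 'rV[R]_m)
  (f : 'rV[R]_m -> V) : Prop := forall k, differentiable_upto k U f.

End Calculus.

Section Riemannian.
Context {R : realType}.

Definition inner m (g : 'rV[R]_m -> 'M[R]_m) (x u v : 'rV[R]_m) : R :=
  (u *m g x *m v^T) 0 0.

(* The coefficient of [e_k] in the Levi-Civita derivative of [e_j] along
   [e_i]. *)
Definition christoffel m (g : 'rV[R]_m -> 'M[R]_m) (i j k : 'I_m)
    (x : 'rV[R]_m) : R :=
  2^-1 * \sum_l invmx (g x) k l *
    (partial i (fun y => g y j l) x + partial j (fun y => g y i l) x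
     - partial l (fun y => g y i j) x).

Definition hessian m (g : 'rV[R]_m -> 'M[R]_m) (f : 'rV[R]_m -> R)
    (x : 'rV[R]_m) : 'M[R]_m :=
  \matrix_(i, j) (partial i (partial j f) x
                  - \sum_k christoffel g i j k x * partial k f x).

Definition laplacian m (g : 'rV[R]_m -> 'M[R]_m) (f : 'rV[R]_m -> R)
  (x : 'rV[R]_m) : R := \tr (invmx (g x) *m hessian g f x).

(* Infimum of the lengths of the C^1 curves in [W] joining [x] to [y]. *)
Definition curve_length m (g : 'rV[R]_m -> 'M[R]_m) (a : R -> 'rV[R]_m) : R :=
  \int[lebesgue_measure]_(t in `[0, 1])
     Num.sqrt (inner g (a t) (derive1 a t) (derive1 a t)).

Definition riem_dist m (g : 'rV[R]_m -> 'M[R]_m) (W : set 'rV[R]_m)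
    (x y : 'rV[R]_m) : R :=
  inf [set l | exists a : R -> 'rV[R]_m,
    [/\ (forall t, derivable a t 1) /\ continuous (derive1 a),
        a 0 = x, a 1 = y, a @` `[0, 1] `<=` W & l = curve_length g a]].

(* In what follows [X : 'rV_p -> 'rV_m] is a parametrized submanifold. *)

Definition induced_metric m p (g : 'rV[R]_m -> 'M[R]_m)
    (X : 'rV[R]_p -> 'rV[R]_m) (u : 'rV[R]_p) : 'M[R]_p :=
  \matrix_(i, j) inner g (X u) (partial i X u) (partial j X u).

(* Levi-Civita derivative, along the i-th coordinate vector of [X], of a
   vector field [Y] along [X]. *)
Definition cov_deriv m p (g : 'rV[R]_m -> 'M[R]_m)
    (X Y : 'rV[R]_p -> 'rV[R]_m) (i : 'I_p) (u : 'rV[R]_p) : 'rV[R]_m :=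
  partial i Y u + \row_k \sum_a \sum_b
    christoffel g a b k (X u) * partial i X u 0 a * Y u 0 b.

(* The same for [X] and [Y] tangent to a sphere centered at the origin, and the
   Levi-Civita connection of that sphere: the component normal to the sphere is
   removed.  [g] must be conformal to the Euclidean metric, so that the normal
   direction at [x] is [x] itself. *)
Definition sphere_cov_deriv m p (g : 'rV[R]_m -> 'M[R]_m)
    (X Y : 'rV[R]_p -> 'rV[R]_m) (i : 'I_p) (u : 'rV[R]_p) : 'rV[R]_m :=
  let D := cov_deriv g X Y i u in
  D - (inner g (X u) D (X u) / inner g (X u) (X u) (X u)) *: X u.

(* The matrix, in the basis of coordinate vectors (acting on columns), of the
   Weingarten operator [A v = - D_v N], where [DN i u] is the covariant
   derivative of the unit normal [N] along the i-th coordinate vector. *)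
Definition weingarten m p (g : 'rV[R]_m -> 'M[R]_m)
    (X : 'rV[R]_p -> 'rV[R]_m) (DN : 'I_p -> 'rV[R]_p -> 'rV[R]_m)
    (u : 'rV[R]_p) : 'M[R]_p :=
  invmx (induced_metric g X u) *m
    \matrix_(k, j) - inner g (X u) (DN j u) (partial k X u).

Definition umbilicity n (A : 'M[R]_n) : 'M[R]_n := A - (\tr A / n%:R)%:M.

(* Squared norm, tr (T T* ), of the endomorphism [T] for the inner product with
   Gram matrix [G]. *)
Definition endo_norm2 n (G T : 'M[R]_n) : R :=
  \tr (T *m (invmx G *m T^T *m G)).

End Riemannian.

Section SpaceForm.
Context {R : realType}.

Unset Implicit Arguments.

Definition space_dom (c : R) m : set 'rV[R]_m :=
  [set x | c = -1 -> enorm x < 2].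

Definition space_metric (c : R) m : 'rV[R]_m -> 'M[R]_m :=
  fun x => ((1 + c / 4 * enorm x ^+ 2) ^- 2)%:M.

Definition unit_ball_radius (c : R) m (r : R) : Prop :=
  [/\ 0 < r, (c = -1 -> r < 2) &
      [set x : 'rV[R]_m | enorm x <= r] =
      [set x | space_dom c m x /\
               riem_dist (space_metric c m) (space_dom c m) 0 x <= 1]].

End SpaceForm.

Section Hypersurface.
Context {R : realType} (c : R) {m : nat}.

(* A hypersurface is an immersion [F : S -> 'rV_m.+2] of a topological space
   [S] of dimension m.+1, with a unit normal field [N] giving the orientation.
   The half-space is [{u | 0 <= u_0}]. *)
Context {S : topologicalType} (F N : S -> 'rV[R]_m.+2).

Local Notation g := (space_metric c m.+2).

Definition half_space : set 'rV[R]_m.+1 := [set u | 0 <= u 0 ord0].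

(* [par] is defined on [dom `&` half_space]; there [ext] and [nor] coincide
   with [F] and [N] read in the chart, which are thus smooth up to the
   boundary.  Compatibility of two charts need not be required: a transition
   map is continuous and factors through a smooth local left inverse of the
   immersion [ext], hence it is smooth. *)
Record chart := Chart {
  dom : set 'rV[R]_m.+1;
  par : 'rV[R]_m.+1 -> S;
  ext : 'rV[R]_m.+1 -> 'rV[R]_m.+2;
  nor : 'rV[R]_m.+1 -> 'rV[R]_m.+2;
  dom_open : open dom;
  par_continuous : {within dom `&` half_space, continuous par};
  par_inj : {in dom `&` half_space &, injective par};
  par_open : forall V, open V -> V `<=` dom -> open (par @` (V `&` half_space));
  ext_smooth : smooth dom ext;
  ext_dom : ext @` dom `<=` space_dom c m.+2;
  ext_immersion : forall u, dom u -> row_free ('J ext u);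
  nor_smooth : smooth dom nor;
  nor_unit : forall u, dom u -> inner g (ext u) (nor u) (nor u) = 1;
  nor_normal : forall u i, dom u ->
    inner g (ext u) (nor u) (partial i ext u) = 0;
  ext_par : forall u, dom u -> half_space u -> F (par u) = ext u;
  nor_par : forall u, dom u -> half_space u -> N (par u) = nor u
}.

Definition compact_hypersurface : Prop :=
  [/\ hausdorff_space S, compact [set: S] &
      forall p : S, exists k : chart, exists u,
        [/\ dom k u, half_space u & par k u = p]].

Definition boundary : set S :=
  [set p | exists k : chart, exists u,
             [/\ dom k u, u 0 ord0 = 0 & par k u = p]].

Definition free_boundary (r : R) : Prop :=
  [/\ compact_hypersurface,
      boundary !=set0,
      (forall p, ~ boundary p -> enorm (F p) < r),
      (forall p, boundary p -> enorm (F p) = r) &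
      (* the normals of the hypersurface and of the sphere are orthogonal *)
      forall p, boundary p -> inner g (F p) (N p) (F p) = 0].

Definition chart_metric (k : chart) (u : 'rV[R]_m.+1) : 'M[R]_m.+1 :=
  induced_metric g (ext k) u.

Definition chart_weingarten (k : chart) (u : 'rV[R]_m.+1) : 'M[R]_m.+1 :=
  weingarten g (ext k) (cov_deriv g (ext k) (nor k)) u.

Definition chart_phi2 (k : chart) (u : 'rV[R]_m.+1) : R :=
  endo_norm2 (chart_metric k u) (umbilicity (chart_weingarten k u)).

Definition constant_mean_curvature : Prop :=
  exists h : R, forall (k : chart) u, dom k u -> half_space u ->
    \tr (chart_weingarten k u) = h.

Definition phi2_subharmonic : Prop :=
  forall (k : chart) u, dom k u -> half_space u ->
    0 <= laplacian (chart_metric k) (chart_phi2 k) u.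

(* The boundary is parametrized by the restriction of charts to [u_0 = 0]. *)
Definition bdry (w : 'rV[R]_m) : 'rV[R]_m.+1 := row_mx (0 : 'rV[R]_1) w.

Definition bdry_dom (C : set S) (k : chart) : set 'rV[R]_m :=
  [set w | dom k (bdry w) /\ C (par k (bdry w))].

(* Along [C], an open subset of the boundary, [eta] is a smooth unit normal
   field of the boundary in the sphere containing it. *)
Definition unit_normal_in_sphere (C : set S) (eta : S -> 'rV[R]_m.+2) : Prop :=
  [/\ (forall k : chart, smooth (bdry_dom C k) (eta \o par k \o bdry)),
      (forall p, C p -> inner g (F p) (eta p) (eta p) = 1),
      (forall p, C p -> inner g (F p) (eta p) (F p) = 0) &
      forall (k : chart) w i, bdry_dom C k w ->
        inner g (ext k (bdry w)) (eta (par k (bdry w)))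
                (partial i (ext k \o bdry) w) = 0].

Definition bdry_weingarten (eta : S -> 'rV[R]_m.+2) (k : chart)
    (w : 'rV[R]_m) : 'M[R]_m :=
  weingarten g (ext k \o bdry)
    (sphere_cov_deriv g (ext k \o bdry) (eta \o par k \o bdry)) w.

Definition umbilical_cmc_in_sphere (C : set S) : Prop :=
  exists eta : S -> 'rV[R]_m.+2,
    [/\ unit_normal_in_sphere C eta,
        (forall (k : chart) w, bdry_dom C k w ->
           exists l : R, bdry_weingarten eta k w = l%:M) &
        exists h : R, forall (k : chart) w, bdry_dom C k w ->
           \tr (bdry_weingarten eta k w) = h].

End Hypersurface.

(* Main.v *)
Require Import Defs.
From HB Require Import structures.
From mathcomp Require Import ring lra.

(** Let [f] be the squared norm of the umbilicity tensor, as a function on the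
    hypersurface. The theorem follows from the vanishing of [f] on the boundary
    ([phi2_boundary_eq0]). Indeed the Weingarten operator is then [h / n] times
    the identity at boundary points, where [h] is the constant mean curvature
    and [n] the dimension. The hypersurface being orthogonal to the sphere, its
    normal [N] is tangent to the sphere and can serve as the normal of the
    boundary within the sphere; the second fundamental form of the boundary is
    then the restriction of that of the hypersurface, hence [h / n] times the
    metric ([bdry_weingarten_umbilical]).

    Suppose that [f] is positive at a boundary point, and let [M > 0] be its
    maximum on the component [K] of that point in the hypersurface.

    Near a maximum point in the interior, [f] is constant by the strong maximum
    principle ([strong_maximum], [subharmonic_strong_maximum]), because [f] is
    subharmonic.

    No maximum point lies on the boundary ([boundary_max_phi2]). There the
    position vector is tangent to the hypersurface, and it is a principal
    direction because the normals are orthogonal to it along the whole boundary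
    ([radial_eigen]). Let [lambda] be its principal curvature, [A] the Weingarten
    operator and [T = A - lambda]. The Codazzi equation, derived from the symmetry
    of the second derivatives of the immersion and of the normal, gives for the
    radial derivative [A'] of [A] that [tr (T A') = (kappa - 1) tr (T ^ 2)], with
    [kappa = (c / 2) r ^ 2 / (1 + (c / 4) r ^ 2)] ([trace_boundary]). The trace of
    [A] is constant, so that the outward radial derivative of [f] is
    [2 tr (A A') = 2 tr (T A') = 2 (kappa - 1) tr (T ^ 2)]. Here [kappa < 1],
    since the ball is smaller than a hemisphere when [c = 1]
    ([unit_ball_radius_lt2]), and [tr (T ^ 2) >= f]. So this derivative would be
    negative, although it is nonnegative at a maximum.

    The maximum points thus form an open and closed subset of [K] that contains
    no boundary point, which contradicts the choice of [K].

    All computations take place in charts and express the metric by its conformal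
    factor; [chart_phi2_indep] shows that [f] does not depend on the chart. *)

Set Implicit Arguments.
Unset Strict Implicit.
Unset Printing Implicit Defensive.

(** * First-order expansions of functions of several variables *)

Section Calc.
Context {R : realType}.

Lemma normr_mxE_le m (x : 'rV[R]_m) i : `|x 0 i| <= `|x|.
Proof.
rewrite [leRHS]/Num.Def.normr /= mx_normrE.
exact: (le_bigmax _ (fun ij : 'I_1 * 'I_m => `|x ij.1 ij.2|) (0, i)).
Qed.

Lemma normr_rV_le m (x : 'rV[R]_m) (e : R) :
  0 <= e -> (forall i, `|x 0 i| <= e) -> `|x| <= e.
Proof.
move=> e0 H; rewrite [leLHS]/Num.Def.normr /= mx_normrE bigmax_le // => -[i j] _ /=.
by rewrite (ord1 i).
Qed.

Lemma normr_rV_lt m (x : 'rV[R]_m) (e : R) :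
  0 < e -> (forall i, `|x 0 i| < e) -> `|x| < e.
Proof.
move=> e0 H; rewrite [ltLHS]/Num.Def.normr /= mx_normrE bigmax_lt // => -[i j] _ /=.
by rewrite (ord1 i).
Qed.

Lemma nearE_ball m (U : set 'rV[R]_m) (x : 'rV[R]_m) : nbhs x U ->
  exists2 e : R, 0 < e & forall h, `|h| < e -> U (x + h).
Proof.
move=> /nbhs_ballP[e /= e0 H]; exists e => // h he; apply: H.
by rewrite -ball_normE /= opprD addrA subrr sub0r normrN.
Qed.

Lemma ball_near m (U : set 'rV[R]_m) (x : 'rV[R]_m) (e : R) : 0 < e ->
  (forall h, `|h| < e -> U (x + h)) -> nbhs x U.
Proof.
move=> e0 H; apply/nbhs_ballP; exists e => // y; rewrite -ball_normE /= => xy.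
by rewrite -(subrK x y) addrC; apply: H; rewrite distrC.
Qed.

Lemma derive_line (V : normedModType R) (W : normedModType R)
    (f : V -> W) x v (t : R) :
  derivable f (x + t *: v) v ->
  is_derive t 1 (fun s : R => f (x + s *: v)) ('D_v f (x + t *: v)).
Proof.
move=> df.
have E : (fun h : R => h^-1 *: (((fun s : R => f (x + s *: v)) \o shift t) (h *: 1)
     - f (x + t *: v))) =
   (fun h => h^-1 *: ((f \o shift (x + t *: v)) (h *: v) - f (x + t *: v))).
  apply/funext => h /=; congr (_ *: (f _ - _)).
  by rewrite [h *: 1]mulr1 scalerDl addrCA.
by apply: DeriveDef; rewrite /derivable /derive E.
Qed.

Lemma MVT_line_pos (V : normedModType R) (f : V -> R) x v (t : R) : 0 < t ->
  (forall s : R, 0 <= s <= t -> derivable f (x + s *: v) v) ->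
  exists2 s : R, 0 < s < t & f (x + t *: v) - f x = t * 'D_v f (x + s *: v).
Proof.
move=> t0 df; pose phi (s : R) := f (x + s *: v).
have dphi (s : R) : s \in `[0, t] -> is_derive s 1 phi ('D_v f (x + s *: v)).
  by rewrite in_itv /= => hs; apply: derive_line; exact: df.
have -> : f x = phi 0 by rewrite /phi scale0r addr0.
rewrite -/(phi t).
have H1 s : s \in `]0, t[ -> is_derive s 1 phi ('D_v f (x + s *: v)).
  by move=> si; apply: dphi; apply: subset_itv_oo_cc si.
have H2 : {within `[0, t], continuous phi}.
  apply/continuous_in_subspaceT => s; rewrite inE => si.
  apply: differentiable_continuous; apply/derivable1_diffP.
  by have [] := dphi s si.
have [s si E] := MVT t0 H1 H2.
exists s; first by move: si; rewrite in_itv.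
by rewrite E subr0 mulrC.
Qed.

Lemma MVT_line (V : normedModType R) (f : V -> R) x v (t : R) :
  (forall s : R, `|s| <= `|t| -> derivable f (x + s *: v) v) ->
  exists2 s : R, `|s| <= `|t| & f (x + t *: v) - f x = t * 'D_v f (x + s *: v).
Proof.
move=> df; have [t0|t0|<-] := ltgtP 0 t; last first.
- by exists 0; rewrite ?normr0 // scale0r addr0 subrr mul0r.
- have [||s /andP[s0 st] E] := @MVT_line_pos _ f (x + t *: v) v (- t).
  + by rewrite oppr_gt0.
  + move=> s /andP[s0 st]; rewrite -addrA -scalerDl; apply: df.
    by rewrite !ler0_norm; lra.
  + exists (t + s); first by rewrite !ler0_norm; lra.
    move: E; rewrite scaleNr addrK -addrA -scalerDl => E.
    by rewrite -[LHS]opprB E mulNr opprK.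
- have [||s /andP[s0 st] E] := @MVT_line_pos _ f x v t; first by [].
  + by move=> s /andP[s0 st]; apply: df; rewrite !ger0_norm // ltW.
  + by exists s => //; rewrite !ger0_norm ltW.
Qed.

(** These rows lead from [0] to [h] by moving one coordinate at a time, so that
    an increment along [h] is a sum of increments along coordinate
    directions. *)
Definition trunc_row m (h : 'rV[R]_m) (j : nat) : 'rV[R]_m :=
  \row_i (if (i < j)%N then h 0 i else 0).

Lemma trunc_row0 m (h : 'rV[R]_m) : trunc_row h 0 = 0.
Proof. by apply/rowP => i; rewrite !mxE. Qed.

Lemma trunc_row_full m (h : 'rV[R]_m) : trunc_row h m = h.
Proof. by apply/rowP => i; rewrite !mxE ltn_ord. Qed.

Lemma trunc_rowS m (h : 'rV[R]_m) (j : 'I_m) :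
  trunc_row h j.+1 = trunc_row h j + h 0 j *: delta_mx 0 j.
Proof.
apply/rowP => i; rewrite !mxE eqxx /= ltnS leq_eqVlt.
case: (eqVneq i j) => [->|ij]; first by rewrite eqxx ltnn add0r mulr1.
by rewrite -val_eqE in ij; rewrite (negbTE ij) mulr0 addr0.
Qed.

Lemma trunc_row_norm m (h : 'rV[R]_m) (j : 'I_m) (s : R) : `|s| <= `|h 0 j| ->
  `|trunc_row h j + s *: delta_mx 0 j| <= `|h|.
Proof.
move=> sh; apply: normr_rV_le => // i; rewrite !mxE eqxx /=.
case: (eqVneq i j) => [->|ij].
  by rewrite ltnn add0r mulr1 (le_trans sh) // normr_mxE_le.
rewrite mulr0 addr0; case: ifP => _; first exact: normr_mxE_le.
by rewrite normr0.
Qed.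

Lemma continuous_sumR (T : topologicalType) I (r : seq I) (P : pred I)
    (f : I -> T -> R) x : (forall i, P i -> {for x, continuous (f i)}) ->
  {for x, continuous (fun y => \sum_(i <- r | P i) f i y)}.
Proof.
move=> cf; elim: r => [|i r IH].
  rewrite (_ : (fun y => _) = cst 0); first exact: cst_continuous.
  by apply/funext => y; rewrite big_nil.
have [Pi|Pi] := boolP (P i); last first.
  rewrite (_ : (fun y => _) = (fun y => \sum_(j <- r | P j) f j y)) //.
  by apply/funext => y; rewrite big_cons (negbTE Pi).
rewrite (_ : (fun y => _) = (fun y => f i y + \sum_(j <- r | P j) f j y)).
  by apply: continuousD => //; exact: cf.
by apply/funext => y; rewrite big_cons Pi.
Qed.

(** By the mean value theorem, each coordinate step contributes a partial
    derivative at a point near [x], which continuity compares with the one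
    at [x]. *)
Lemma C1_expand m (U : set 'rV[R]_m) (f : 'rV[R]_m -> R) x :
  open U -> U x -> differentiable_upto 1 U f ->
  forall e : R, 0 < e -> \forall h \near (0 : 'rV[R]_m),
   `|f (x + h) - f x - \sum_i h 0 i * partial i f x| <= e * `|h|.
Proof.
move=> oU Ux [cf df] e e0.
pose e' : R := e / m.+1%:R.
have e'0 : 0 < e' by rewrite divr_gt0.
have : \forall y \near x, U y /\ forall i, `|partial i f y - partial i f x| <= e'.
  have Unbhs : nbhs x U by exact: open_nbhs_nbhs.
  have Hn : \forall y \near x, forall i, `|partial i f y - partial i f x| <= e'.
    apply: (@filter_forall _ _ _ (nbhs x) _) => i.
    have [_ [cp _]] := df i.
    have /cvgrPdist_le/(_ _ e'0) := cp x Ux.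
    by apply: filterS => y; rewrite distrC.
  by near=> y; split; near: y.
move=> /nearE_ball[d d0 H].
apply: (@ball_near _ _ _ d) => // h hd; rewrite add0r.
have -> : f (x + h) - f x =
    \sum_(i < m) (f (x + trunc_row h i.+1) - f (x + trunc_row h i)).
  rewrite -(big_mkord xpredT (fun i => f (x + trunc_row h i.+1) - f (x + trunc_row h i))).
  by rewrite telescope_sumr // trunc_row_full trunc_row0 addr0.
rewrite -sumrB.
have step (i : 'I_m) : `|f (x + trunc_row h i.+1) - f (x + trunc_row h i)
      - h 0 i * partial i f x| <= e' * `|h|.
  have Hs (s : R) : `|s| <= `|h 0 i| ->
      `|trunc_row h i + s *: delta_mx 0 i| < d.
    by move=> hs; apply: le_lt_trans hd; apply: trunc_row_norm.
  have [|s hs E] := @MVT_line _ f (x + trunc_row h i) (delta_mx 0 i) (h 0 i).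
    by move=> s hs; apply: (df i).1; rewrite -addrA; apply: (H _ _).1; exact: Hs.
  rewrite trunc_rowS addrA E -mulrBr normrM mulrC.
  rewrite ler_pM //; last exact: normr_mxE_le.
  by rewrite -addrA; apply: (H _ _).2; exact: Hs.
apply: le_trans (ler_norm_sum _ _ _) _.
apply: le_trans (ler_sum _ (fun i _ => step i)) _.
rewrite sumr_const card_ord -mulr_natr mulrAC ler_wpM2r //.
rewrite /e' -mulrA ger_pMr // mulrC ler_pdivrMr // mul1r ler_nat.
exact: leqnSn.
Unshelve. all: by end_near. Qed.

Lemma C1_differentiable m (U : set 'rV[R]_m) (f : 'rV[R]_m -> R) x :
  open U -> U x -> differentiable_upto 1 U f -> differentiable f x.
Proof.
move=> oU Ux df.
pose l (h : 'rV[R]_m) : R := \sum_i h 0 i * partial i f x.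
have lin_l : linear l.
  move=> a h k; rewrite /l scaler_sumr -big_split; apply: eq_bigr => i _.
  by rewrite /= !mxE mulrDl -mulrA.
pose lM := GRing.isLinear.Build _ _ _ _ l lin_l.
pose L : {linear 'rV[R]_m -> R} := HB.pack l lM.
have cL : continuous L.
  move=> y; apply: continuous_sumR => i _; apply: continuousM.
    exact: coord_continuous.
  exact: cst_continuous.
have exp_f : forall e : {posnum R}, \forall h \near (0 : 'rV[R]_m),
    `|f (h + x) - (f x + L h)| <= e%:num * `|h|.
  move=> e; have := C1_expand oU Ux df [elaborate gt0 e]; apply: filterS => h /=.
  by rewrite [h + x]addrC opprD addrA.
have dL : 'd f x = L :> ('rV[R]_m -> R).
  apply: (@diff_unique _ _ _ f L x cL).
  by apply: eqaddoE; apply/eqaddoP => _/posnumP[e]; exact: exp_f.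
apply/diff_locallyP; rewrite dL; split=> //.
by apply: eqaddoE; apply/eqaddoP => _/posnumP[e]; exact: exp_f.
Qed.

End Calc.

(** * Algebra of smooth functions and symmetry of second derivatives *)

Section Smooth.
Context {R : realType}.

Lemma partial_ext m (V : normedModType R) (U : set 'rV[R]_m)
    (f g : 'rV[R]_m -> V) i x :
  open U -> U x -> (forall y, U y -> f y = g y) -> partial i f x = partial i g x.
Proof.
move=> oU Ux fg; apply: near_eq_derive.
by apply: filterS (open_nbhs_nbhs (conj oU Ux)) => y; exact: fg.
Qed.

Lemma continuous_near_ext (T U : topologicalType) (f g : T -> U) x :
  {near x, f =1 g} -> {for x, continuous f} -> {for x, continuous g}.
Proof.
move=> fg; rewrite /prop_for /continuous_at (nbhs_singleton fg) => cf.
by apply: cvg_trans cf; apply: near_eq_cvg.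
Qed.

Section dupto.
Context m (U : set 'rV[R]_m).
Hypothesis oU : open U.

Lemma dupto_continuous k (V : normedModType R) (f : 'rV[R]_m -> V) x :
  differentiable_upto k U f -> U x -> {for x, continuous f}.
Proof. by case: k => [|k] [cf _] Ux; exact: cf. Qed.

Lemma dupto_lower k (V : normedModType R) (f : 'rV[R]_m -> V) :
  differentiable_upto k.+1 U f -> differentiable_upto k U f.
Proof.
elim: k f => [|k IH] f [cf df] //.
by split=> // i; have [dfi dpf] := df i; split=> //; exact: IH.
Qed.

Lemma dupto_ext k (V : normedModType R) (f g : 'rV[R]_m -> V) :
  (forall y, U y -> f y = g y) ->
  differentiable_upto k U f -> differentiable_upto k U g.
Proof.
have nearU x : U x -> nbhs x U by move=> Ux; exact: open_nbhs_nbhs.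
elim: k f g => [|k IH] f g fg /= [cf df].
  split=> // x Ux; apply: continuous_near_ext (cf x Ux).
  exact: filterS fg (nearU x Ux).
split.
  move=> x Ux; apply: continuous_near_ext (cf x Ux).
  exact: filterS fg (nearU x Ux).
move=> i; have [dfi dpf] := df i; split.
  move=> x Ux; apply: near_eq_derivable (dfi x Ux).
  by apply: filterS (nearU x Ux) => y Uy; exact: fg.
apply: IH dpf => y Uy; exact: (partial_ext i oU Uy fg).
Qed.

Lemma dupto_sub k (V : normedModType R) (f : 'rV[R]_m -> V) (W : set 'rV[R]_m) :
  W `<=` U -> differentiable_upto k U f -> differentiable_upto k W f.
Proof.
move=> WU; elim: k f => [|k IH] f /= [cf df].
  by split=> // x /WU; exact: cf.
split=> [x /WU|i]; first exact: cf.
by have [dfi dpf] := df i; split=> [x /WU|]; [exact: dfi | exact: IH].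
Qed.

Lemma partial_cst (V : normedModType R) (a : V) (i : 'I_m) :
  partial i (cst a) = cst 0 :> ('rV[R]_m -> V).
Proof. by apply/funext => x; rewrite /partial derive_cst. Qed.

Lemma dupto_cst k (V : normedModType R) (a : V) : differentiable_upto k U (cst a).
Proof.
elim: k a => [|k IH] a /=; first by split=> // x _; exact: cst_continuous.
split=> [x _|i]; first exact: cst_continuous.
by split=> [x _|]; [exact: derivable_cst | rewrite partial_cst; exact: IH].
Qed.

Lemma duptoD k (V : normedModType R) (f g : 'rV[R]_m -> V) :
  differentiable_upto k U f -> differentiable_upto k U g ->
  differentiable_upto k U (fun x => f x + g x).
Proof.
elim: k f g => [|k IH] f g /= [cf df] [cg dg].
  by split=> // x Ux; apply: continuousD; [exact: cf | exact: cg].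
split=> [x Ux|i]; first by apply: continuousD; [exact: cf | exact: cg].
have [dfi dpf] := df i; have [dgi dpg] := dg i.
split=> [x Ux|]; first by apply: derivableD; [exact: dfi | exact: dgi].
apply: dupto_ext (IH _ _ dpf dpg) => x Ux.
by rewrite /partial -deriveD //; [exact: dfi | exact: dgi].
Qed.

Lemma duptoM k (f g : 'rV[R]_m -> R) :
  differentiable_upto k U f -> differentiable_upto k U g ->
  differentiable_upto k U (fun x => f x * g x).
Proof.
elim: k f g => [|k IH] f g /=.
  move=> [cf _] [cg _].
  by split=> // x Ux; apply: continuousM; [exact: cf | exact: cg].
move=> dkf dkg.
have [cf df] := dkf; have [cg dg] := dkg.
split=> [x Ux|i]; first by apply: continuousM; [exact: cf | exact: cg].
have [dfi dpf] := df i; have [dgi dpg] := dg i.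
split=> [x Ux|]; first by apply: derivableM; [exact: dfi | exact: dgi].
have lf := dupto_lower dkf; have lg := dupto_lower dkg.
apply: dupto_ext (duptoD (IH _ _ lf dpg) (IH _ _ lg dpf)) => x Ux.
by rewrite /partial [RHS]deriveM //; [exact: dfi | exact: dgi].
Qed.

Lemma duptoN k (f : 'rV[R]_m -> R) :
  differentiable_upto k U f -> differentiable_upto k U (fun x => - f x).
Proof.
move=> df; apply: dupto_ext (duptoM (dupto_cst k (-1 : R)) df) => x _.
by rewrite mulN1r.
Qed.

Lemma duptoV k (f : 'rV[R]_m -> R) : (forall x, U x -> f x != 0) ->
  differentiable_upto k U f -> differentiable_upto k U (fun x => (f x)^-1).
Proof.
move=> f0; elim: k => [|k IH] /= dkf; have [cf df] := dkf.
  by split=> // x Ux; exact: (cvgV (f0 _ Ux) (cf _ Ux)).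
split=> [x Ux|i]; first by exact: (cvgV (f0 _ Ux) (cf _ Ux)).
have [dfi dpf] := df i.
split=> [x Ux|]; first by apply: derivableV; [exact: f0 | exact: dfi].
have fV := IH (dupto_lower dkf).
apply: dupto_ext (duptoN (duptoM (duptoM fV fV) dpf)) => x Ux.
by rewrite /partial [RHS]deriveV ?f0 // ?exprVn /= ?invfM ?scaleNr //; exact: dfi.
Qed.

Lemma dupto_sum k I (r : seq I) (P : pred I) (f : I -> 'rV[R]_m -> R) :
  (forall i, P i -> differentiable_upto k U (f i)) ->
  differentiable_upto k U (fun x => \sum_(i <- r | P i) f i x).
Proof.
move=> df; elim: r => [|i r IH].
  by apply: dupto_ext (dupto_cst k (0 : R)) => x _; rewrite big_nil.
have [Pi|Pi] := boolP (P i).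
  by apply: dupto_ext (duptoD (df _ Pi) IH) => x _; rewrite big_cons Pi.
by apply: dupto_ext IH => x _; rewrite big_cons (negbTE Pi).
Qed.

Lemma dupto_prod k I (r : seq I) (P : pred I) (f : I -> 'rV[R]_m -> R) :
  (forall i, P i -> differentiable_upto k U (f i)) ->
  differentiable_upto k U (fun x => \prod_(i <- r | P i) f i x).
Proof.
move=> df; elim: r => [|i r IH].
  by apply: dupto_ext (dupto_cst k (1 : R)) => x _; rewrite big_nil.
have [Pi|Pi] := boolP (P i).
  by apply: dupto_ext (duptoM (df _ Pi) IH) => x _; rewrite big_cons Pi.
by apply: dupto_ext IH => x _; rewrite big_cons (negbTE Pi).
Qed.

Lemma dupto_coord k p q (M : 'rV[R]_m -> 'M[R]_(p, q)) i j :
  differentiable_upto k U M -> differentiable_upto k U (fun x => M x i j).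
Proof.
have cc (X : 'rV[R]_m -> 'M[R]_(p, q)) x : {for x, continuous X} ->
    {for x, continuous (fun y => X y i j)}.
  move=> cX.
  exact: (@continuous_comp _ _ _ X (fun N : 'M[R]_(p, q) => N i j) x cX
            (@coord_continuous _ _ _ i j (X x))).
elim: k M => [|k IH] M /= [cM dM]; first by split=> // x Ux; exact/cc/cM.
split=> [x Ux|l]; first exact/cc/cM.
have [dMl dpM] := dM l; split=> [x Ux|]; first exact: ((derivable_mxP M x _).1 (dMl x Ux) i j).
apply: dupto_ext (IH _ dpM) => x Ux.
by rewrite /partial derive_mx ?mxE //; exact: dMl.
Qed.

Lemma dupto_linear k (l : 'I_m -> R) :
  differentiable_upto k U (fun x => \sum_i x 0 i * l i).
Proof.
apply: dupto_sum => i _; apply: duptoM; last exact: dupto_cst.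
have dc x : differentiable (fun y : 'rV[R]_m => y 0 i) x.
  exact: differentiable_coord.
case: k => [|k] /=; first by split=> // x _; exact: differentiable_continuous.
split=> [x _|j]; first exact: differentiable_continuous.
split=> [x _|]; first exact: diff_derivable.
apply: dupto_ext (dupto_cst k ((j == i)%:R : R)) => x _.
have := @derive_mx _ _ _ _ id x (delta_mx 0 j) (@derivable_id _ _ _ _).
by rewrite derive_id => /matrixP/(_ 0 i); rewrite !mxE eqxx /= eq_sym.
Qed.

Lemma dupto1_differentiable k (f : 'rV[R]_m -> R) x :
  differentiable_upto k.+1 U f -> U x -> differentiable f x.
Proof.
move=> df Ux; apply: (C1_differentiable oU Ux).
elim: k df => [//|k IH] /dupto_lower; exact: IH.
Qed.

Lemma derive_sum_partial (f : 'rV[R]_m -> R) x v : differentiable f x ->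
  'D_v f x = \sum_i v 0 i * partial i f x.
Proof.
move=> df; rewrite deriveE // {1}(matrix_sum_delta v) big_ord_recl big_ord0 addr0.
rewrite linear_sum; apply: eq_bigr => i _.
by rewrite linearZ /= -deriveE // ord1.
Qed.

End dupto.

Section lambda_derive.
Context (V : normedModType R).
Implicit Types (f g : V -> R) (x v : V).

(** The rules for sums and products, in the pointwise form in which the
    functions differentiated below are written. *)
Lemma derivable_add f g x v : derivable f x v -> derivable g x v ->
  derivable (fun y => f y + g y) x v.
Proof. exact: derivableD. Qed.

Lemma derive_add f g x v : derivable f x v -> derivable g x v ->
  'D_v (fun y => f y + g y) x = 'D_v f x + 'D_v g x.
Proof. exact: deriveD. Qed.

Lemma derivable_mul f g x v : derivable f x v -> derivable g x v ->
  derivable (fun y => f y * g y) x v.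
Proof. exact: derivableM. Qed.

Lemma derive_mul f g x v : derivable f x v -> derivable g x v ->
  'D_v (fun y => f y * g y) x = 'D_v f x * g x + f x * 'D_v g x.
Proof.
move=> df dg; have -> : 'D_v (fun y => f y * g y) x = f x *: 'D_v g x + g x *: 'D_v f x.
  exact: (deriveM df dg).
by rewrite addrC [_ *: 'D_v f x]mulrC.
Qed.

Lemma derivable_scale (a : R) f x v : derivable f x v ->
  derivable (fun y => a * f y) x v.
Proof. by move=> df; exact: (derivable_mul (derivable_cst a x v) df). Qed.

Lemma derive_scale (a : R) f x v : derivable f x v ->
  'D_v (fun y => a * f y) x = a * 'D_v f x.
Proof.
move=> df; rewrite (derive_mul (derivable_cst a x v) df).
by rewrite derive_cst mul0r add0r.
Qed.

Lemma derive_sumf I (r : seq I) (f : I -> V -> R) x v :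
  (forall i, derivable (f i) x v) ->
  derivable (fun y => \sum_(i <- r) f i y) x v /\
  'D_v (fun y => \sum_(i <- r) f i y) x = \sum_(i <- r) 'D_v (f i) x.
Proof.
move=> df; elim: r => [|i r [IH1 IH2]].
  rewrite (_ : (fun y => _) = cst 0); last by apply/funext => y; rewrite big_nil.
  by split; [exact: derivable_cst | rewrite derive_cst big_nil].
rewrite (_ : (fun y => _) = (fun y => f i y + \sum_(i <- r) f i y)); last first.
  by apply/funext => y; rewrite big_cons.
split; first exact: (derivable_add (df i) IH1).
by rewrite (derive_add (df i) IH1) IH2 big_cons.
Qed.

End lambda_derive.

Lemma smooth_partial m (U : set 'rV[R]_m) (V : normedModType R)
  (f : 'rV[R]_m -> V) i : smooth U f -> smooth U (partial i f).
Proof. by move=> sf k; have [_ /(_ i)[]] := sf k.+1. Qed.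

(** The second difference of [f] over a square of side [s] is symmetric in the
    two directions; by the mean value theorem, applied twice, it is [s ^+ 2]
    times a mixed derivative at a point near [x]. *)
Lemma Schwarz m (U : set 'rV[R]_m) (f : 'rV[R]_m -> R) x i j :
  open U -> U x -> differentiable_upto 2 U f ->
  partial i (partial j f) x = partial j (partial i f) x.
Proof.
move=> oU Ux df2.
have key (a b : 'I_m) : forall e : R, 0 < e -> \forall s \near (0 : R), 
   `|f (x + s *: delta_mx 0 a + s *: delta_mx 0 b) - f (x + s *: delta_mx 0 a)
       - (f (x + s *: delta_mx 0 b) - f x)
     - s ^+ 2 * partial b (partial a f) x| <= e * s ^+ 2.
  move=> e e0.
  have [_ dfa] := df2; have [dfa1 [cpa dpa]] := dfa a.
  have [dpab [cpab _]] := dpa b.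
  have /cvgrPdist_le/(_ _ e0) := cpab x Ux.
  have Unbhs : nbhs x U by exact: open_nbhs_nbhs.
  move=> /(filterI Unbhs)/nearE_ball[d d0 Hd].
  apply/nbhs_ballP; exists (d / 2); first by rewrite /= divr_gt0.
  move=> s; rewrite -ball_normE /= sub0r normrN => sd.
  set ea : 'rV[R]_m := delta_mx 0 a; set eb : 'rV[R]_m := delta_mx 0 b.
  have sm (s1 s2 : R) : `|s1| <= `|s| -> `|s2| <= `|s| ->
      `|s1 *: (ea : 'rV[R]_m) + s2 *: (eb : 'rV[R]_m)| < d.
    move=> h1 h2; apply: normr_rV_lt => // l; rewrite !mxE eqxx /=.
    apply: le_lt_trans (ler_normD _ _) _.
    have B (t : R) (w : bool) : `|t| <= `|s| -> `|t * w%:R| <= `|s|.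
      by case: w => ts; rewrite ?mulr1 // mulr0 normr0.
    by apply: le_lt_trans (lerD (B _ _ h1) (B _ _ h2)) _; lra.
  pose phi y := f (y + s *: eb) - f y.
  have in1 (s1 : R) : `|s1| <= `|s| -> U (x + s1 *: ea).
    move=> h1; have := sm s1 0 h1; rewrite normr0 scale0r addr0 => /(_ (normr_ge0 _)).
    by move/Hd => [].
  have in2 (s1 s2 : R) : `|s1| <= `|s| -> `|s2| <= `|s| -> U (x + s1 *: ea + s2 *: eb).
    by move=> h1 h2; have /Hd[] := sm _ _ h1 h2; rewrite addrA.
  have dshift (y : 'rV[R]_m) : U (y + s *: eb) ->
     is_derive y ea (fun y => f (y + s *: eb)) (partial a f (y + s *: eb)).
    move=> Uy; have E : (fun h : R => h^-1 *: (((fun y => f (y + s *: eb)) \o shift y) (h *: ea)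
         - f (y + s *: eb))) =
       (fun h => h^-1 *: ((f \o shift (y + s *: eb)) (h *: ea) - f (y + s *: eb))).
      by apply/funext => h /=; rewrite addrA.
    have := dfa1 _ Uy; rewrite /derivable -/ea => D.
    by apply: DeriveDef; rewrite /derivable /partial /derive ?E.
  have [s1 hs1|s1 hs1 E1] := @MVT_line R _ phi x ea s.
    apply: derivableB; last by apply: dfa1; exact: in1.
    by have [] := dshift _ (in2 _ _ hs1 (lexx _)).
  have [s2 hs2|s2 hs2 E2] := @MVT_line R _ (partial a f) (x + s1 *: ea) eb s.
    by apply: dpab; exact: in2.
  have -> : f (x + s *: ea + s *: eb) - f (x + s *: ea) - (f (x + s *: eb) - f x)
     = s ^+ 2 * partial b (partial a f) (x + s1 *: ea + s2 *: eb).
    rewrite -[LHS]/(phi (x + s *: ea) - phi x) E1 expr2 -mulrA -E2; congr (_ * _).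
    have [D1 D1E] := dshift _ (in2 _ _ hs1 (lexx _)).
    by rewrite /phi (deriveB D1 (dfa1 _ (in1 _ hs1))) D1E.
  rewrite -mulrBr normrM ger0_norm ?sqr_ge0 // mulrC ler_wpM2r ?sqr_ge0 //.
  by rewrite distrC -addrA; have /Hd[_] := sm _ _ hs1 hs2.
apply/eqP; rewrite -subr_eq0 -normr_le0; apply/ler_addgt0Pl => e e0.
rewrite addr0; have e20 : 0 < e / 2 by rewrite divr_gt0.
have /nbhs_ballP[d1 /= d10 Hd1] := key i j _ e20.
have /nbhs_ballP[d2 /= d20 Hd2] := key j i _ e20.
pose d := Num.min d1 d2; have d0 : 0 < d by rewrite /d lt_min d10.
have [/Hd1 h1 /Hd2 h2] : ball (0 : R) d1 (d / 2) /\ ball (0 : R) d2 (d / 2).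
  have dd : d / 2 < d by lra.
  rewrite -ball_normE /= sub0r normrN gtr0_norm ?divr_gt0 //.
  by split; apply: lt_le_trans dd _; rewrite /d ge_min lexx ?orbT.
move: h1 h2.
set s := d / 2; have s0 : 0 < s ^+ 2 by rewrite exprn_gt0 ?divr_gt0.
rewrite /= [x + s *: delta_mx 0 j + _]addrAC.
set A := f _; set B := f _; set C := f _; set D := f _.
set P := partial j _ x; set Q := partial i _ x => h1 h2.
rewrite -(ler_pM2l s0) -{1}[s ^+ 2]gtr0_norm // -normrM.
rewrite (_ : s ^+ 2 * (Q - P) = (A - B - (C - D) - s ^+ 2 * P) - (A - C - (B - D) - s ^+ 2 * Q)); last ring.
apply: le_trans (ler_normB _ _) _; apply: le_trans (lerD h1 h2) _.
by rewrite -mulrDl -splitr mulrC.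
Qed.

End Smooth.

(** * Derivatives at a maximum *)

Section Tests.
Context {R : realType}.

Lemma derive_gt0_right (V : normedModType R) (f : V -> R) z v : derivable f z v ->
  0 < 'D_v f z -> exists2 d : R, 0 < d & forall t, 0 < t < d -> f z < f (z + t *: v).
Proof.
move=> df Dpos.
have /cvgrPdist_lt/(_ _ Dpos) := df.
case=> e /= e0 He.
exists e => // t /andP[t0 te].
have := He t; rewrite /ball_ /= sub0r normrN gtr0_norm // => /(_ te).
rewrite gt_eqF // => /(_ isT).
rewrite [t *: v + z]addrC -[lim _]/('D_v f z).
set a := f _; set b := f z; set D := 'D_v f z => ab.
have : 0 < t^-1 * (a - b).
  by move: ab; rewrite ltr_norml => /andP[_]; rewrite ltrBlDr ltrDl.
by rewrite pmulr_rgt0 ?invr_gt0 // subr_gt0.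
Qed.

Lemma derive_le0_right (V : normedModType R) (f : V -> R) z v : derivable f z v ->
  (exists2 d : R, 0 < d & forall t, 0 < t < d -> f (z + t *: v) <= f z) ->
  'D_v f z <= 0.
Proof.
move=> df [d d0 H]; rewrite leNgt; apply/negP => Dpos.
have [e e0 He] := derive_gt0_right df Dpos.
pose t := Num.min d e / 2.
have m0 : 0 < Num.min d e by rewrite lt_min d0.
have t0 : 0 < t by rewrite divr_gt0.
have tm : t < Num.min d e by rewrite /t; lra.
have /andP[td te] : (t < d) && (t < e) by rewrite -lt_min.
have := H t; rewrite t0 td => /(_ isT).
by rewrite leNgt He // t0 te.
Qed.

Lemma derive_eq0_max m (U : set 'rV[R]_m) (f : 'rV[R]_m -> R) z v :
  open U -> U z -> (forall x, U x -> f x <= f z) -> differentiable f z ->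
  'D_v f z = 0.
Proof.
move=> oU Uz H df.
have le w : 'D_w f z <= 0.
  apply: derive_le0_right; first exact: diff_derivable.
  have /nearE_ball[e e0 He] := open_nbhs_nbhs (conj oU Uz).
  exists (e / (`|w| + 1)); first by rewrite divr_gt0 // ltr_wpDl.
  move=> t /andP[t0 te]; apply/H/He; rewrite normrZ gtr0_norm //.
  apply: (@le_lt_trans _ _ (t * (`|w| + 1))).
    by rewrite ler_pM2l // lerDl.
  by rewrite -ltr_pdivlMr // ltr_wpDl.
apply/eqP; rewrite eq_le le /=; have := le (- v).
by rewrite !deriveE // linearN oppr_le0.
Qed.

(** The first derivative of [f] along [v] vanishes at [z]; if the second one
    were positive, the first would be positive shortly after [z], and [f]
    would exceed its maximum there. *)
Lemma max_hessian m (U : set 'rV[R]_m) (f : 'rV[R]_m -> R) z (v : 'rV[R]_m) :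
  open U -> U z -> (forall x, U x -> f x <= f z) ->
  differentiable_upto 2 U f ->
  \sum_i \sum_j v 0 i * v 0 j * partial i (partial j f) z <= 0.
Proof.
move=> oU Uz H df2.
have dif x : U x -> differentiable f x by move=> Ux; exact: (dupto1_differentiable oU df2).
pose g x := \sum_j v 0 j * partial j f x.
have dg1 : differentiable_upto 1 U g.
  apply: (dupto_sum oU) => j _; apply: duptoM => //; first exact: dupto_cst.
  by have [_ /(_ j)[]] := df2.
have gE x : U x -> 'D_v f x = g x.
  by move=> Ux; apply: derive_sum_partial; exact: dif.
have -> : \sum_i \sum_j v 0 i * v 0 j * partial i (partial j f) z = 'D_v g z.
  rewrite (derive_sum_partial _ (dupto1_differentiable oU dg1 Uz)).
  apply: eq_bigr => i _; rewrite {1}/partial.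
  have dj (j : 'I_m) : derivable (v 0 j \*o partial j f) z (delta_mx 0 i).
    have [_ /(_ j)[_ [_ /(_ i)[D _]]]] := df2.
    by apply: derivableM; [exact: derivable_cst | exact: D].
  have gs : g = \sum_j (v 0 j \*o partial j f).
    by apply/funext => x; rewrite fct_sumE.
  rewrite [in RHS]gs /partial derive_sum // mulr_sumr; apply: eq_bigr => j _.
  have [_ /(_ j)[_ [_ /(_ i)[D _]]]] := df2.
  by rewrite deriveMl ?mulrA //; exact: D.
rewrite leNgt; apply/negP => gpos.
have dgz : derivable g z v.
  by apply: diff_derivable; exact: (dupto1_differentiable oU dg1).
have [d d0 Hd] := derive_gt0_right dgz gpos.
have g0 : g z = 0.
  by rewrite -gE //; apply: (derive_eq0_max _ oU) => //; exact: dif.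
have /nearE_ball[e e0 He] := open_nbhs_nbhs (conj oU Uz).
pose t := Num.min d (e / (`|v| + 1)) / 2.
have n0 : 0 < `|v| + 1 by rewrite ltr_wpDl.
have m0 : 0 < Num.min d (e / (`|v| + 1)) by rewrite lt_min d0 divr_gt0.
have t0 : 0 < t by rewrite divr_gt0.
have tm : t < Num.min d (e / (`|v| + 1)) by rewrite /t; lra.
have /andP[td te] : (t < d) && (t < e / (`|v| + 1)) by rewrite -lt_min.
have inU s : 0 <= s <= t -> U (z + s *: v).
  move=> /andP[s0 st]; apply: He; rewrite normrZ ger0_norm //.
  apply: (@le_lt_trans _ _ (t * (`|v| + 1))).
    by rewrite ler_pM // lerDl.
  by rewrite -ltr_pdivlMr.
have [s hs|s /andP[s0 st] E] := @MVT_line_pos _ _ f z v t t0.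
  by apply: diff_derivable; apply: dif; exact: inU.
have : f z < f (z + t *: v).
  rewrite -subr_gt0 E gE; last by apply: inU; rewrite !ltW.
  by rewrite pmulr_rgt0 // -g0; apply: Hd; rewrite s0 (lt_trans st).
by rewrite ltNge H //; apply: inU; rewrite lexx ltW.
Qed.

End Tests.

(** * Smooth functions with matrix values *)

Section MatrixSmooth.
Context {R : realType} (m : nat) (U : set 'rV[R]_m).
Hypothesis oU : open U.

Definition msmooth p q (M : 'rV[R]_m -> 'M[R]_(p, q)) : Prop :=
  forall i j, smooth U (fun u => M u i j).

Lemma smooth_ext (f g : 'rV[R]_m -> R) : (forall u, U u -> f u = g u) ->
  smooth U f -> smooth U g.
Proof. by move=> fg sf k; exact: (dupto_ext oU fg). Qed.

Lemma smooth_add (f g : 'rV[R]_m -> R) : smooth U f -> smooth U g ->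
  smooth U (fun u => f u + g u).
Proof. by move=> sf sg k; exact: duptoD. Qed.

Lemma smooth_mul (f g : 'rV[R]_m -> R) : smooth U f -> smooth U g ->
  smooth U (fun u => f u * g u).
Proof. by move=> sf sg k; exact: duptoM. Qed.

Lemma smooth_cst (a : R) : smooth U (fun _ => a).
Proof. by move=> k; exact: dupto_cst. Qed.

Lemma smooth_opp (f : 'rV[R]_m -> R) : smooth U f -> smooth U (fun u => - f u).
Proof. by move=> sf k; exact: duptoN. Qed.

Lemma smooth_inv (f : 'rV[R]_m -> R) : (forall u, U u -> f u != 0) ->
  smooth U f -> smooth U (fun u => (f u)^-1).
Proof. by move=> f0 sf k; exact: duptoV. Qed.

Lemma smooth_sum I (r : seq I) (P : pred I) (f : I -> 'rV[R]_m -> R) :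
  (forall i, P i -> smooth U (f i)) -> smooth U (fun u => \sum_(i <- r | P i) f i u).
Proof. by move=> sf k; apply: dupto_sum => // i Pi; exact: sf. Qed.

Lemma smooth_derivable (f : 'rV[R]_m -> R) u v : smooth U f -> U u -> derivable f u v.
Proof.
by move=> sf Uu; apply: diff_derivable; exact: (dupto1_differentiable oU (sf 1)).
Qed.

Lemma smooth_differentiable (f : 'rV[R]_m -> R) u : smooth U f -> U u -> differentiable f u.
Proof. by move=> sf Uu; exact: (dupto1_differentiable oU (sf 1)). Qed.

Lemma smooth_continuous (f : 'rV[R]_m -> R) u : smooth U f -> U u -> {for u, continuous f}.
Proof. by move=> sf Uu; exact: (dupto_continuous (sf 0)). Qed.

Lemma msmooth_mulmx p q r (A : 'rV[R]_m -> 'M[R]_(p, q)) (B : 'rV[R]_m -> 'M[R]_(q, r)) :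
  msmooth A -> msmooth B -> msmooth (fun u => A u *m B u).
Proof.
move=> sA sB i j.
apply: (@smooth_ext (fun u => \sum_k A u i k * B u k j)); first by move=> u _; rewrite mxE.
by apply: smooth_sum => k _; exact: smooth_mul.
Qed.

Lemma msmooth_tr p q (A : 'rV[R]_m -> 'M[R]_(p, q)) : msmooth A -> msmooth (fun u => (A u)^T).
Proof.
by move=> sA i j; apply: smooth_ext (sA j i) => u _; rewrite mxE.
Qed.

Lemma msmooth_add p q (A B : 'rV[R]_m -> 'M[R]_(p, q)) : msmooth A -> msmooth B ->
  msmooth (fun u => A u + B u).
Proof.
by move=> sA sB i j; apply: smooth_ext (smooth_add (sA i j) (sB i j)) => u _; rewrite mxE.
Qed.

Lemma msmooth_opp p q (A : 'rV[R]_m -> 'M[R]_(p, q)) : msmooth A -> msmooth (fun u => - A u).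
Proof.
by move=> sA i j; apply: smooth_ext (smooth_opp (sA i j)) => u _; rewrite mxE.
Qed.

Lemma msmooth_scale p q (f : 'rV[R]_m -> R) (A : 'rV[R]_m -> 'M[R]_(p, q)) :
  smooth U f -> msmooth A -> msmooth (fun u => f u *: A u).
Proof.
by move=> sf sA i j; apply: smooth_ext (smooth_mul sf (sA i j)) => u _; rewrite mxE.
Qed.

Lemma msmooth_scalar p (f : 'rV[R]_m -> R) : smooth U f -> msmooth (fun u => (f u)%:M : 'M[R]_p).
Proof.
move=> sf i j; have [ij|ij] := eqVneq i j.
  by apply: smooth_ext sf => u _; rewrite mxE ij eqxx.
by apply: smooth_ext (smooth_cst 0) => u _; rewrite mxE (negbTE ij).
Qed.

Lemma smooth_mxtrace p (A : 'rV[R]_m -> 'M[R]_p) : msmooth A -> smooth U (fun u => \tr (A u)).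
Proof. by move=> sA; apply: smooth_sum => i _; exact: sA. Qed.

Lemma smooth_det p (A : 'rV[R]_m -> 'M[R]_p) : msmooth A -> smooth U (fun u => \det (A u)).
Proof.
move=> sA; apply: smooth_sum => s _; apply: smooth_mul; first exact: smooth_cst.
by move=> k; apply: dupto_prod => // i _; exact: sA.
Qed.

Lemma msmooth_adj p (A : 'rV[R]_m -> 'M[R]_p) : msmooth A -> msmooth (fun u => \adj (A u)).
Proof.
move=> sA i j; apply: (@smooth_ext (fun u => cofactor (A u) j i)).
  by move=> u _; rewrite mxE.
apply: smooth_mul; first exact: smooth_cst.
apply: smooth_det => a b.
by apply: smooth_ext (sA (lift j a) (lift i b)) => u _; rewrite !mxE.
Qed.

Lemma msmooth_inv p (A : 'rV[R]_m -> 'M[R]_p) : (forall u, U u -> A u \in unitmx) ->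
  msmooth A -> msmooth (fun u => invmx (A u)).
Proof.
move=> uA sA i j.
apply: (@smooth_ext (fun u => (\det (A u))^-1 * (\adj (A u)) i j)).
  by move=> u /uA Au; rewrite /invmx Au [RHS]mxE.
apply: smooth_mul; last exact: msmooth_adj.
apply: smooth_inv; last exact: smooth_det.
by move=> u /uA; rewrite unitmxE unitfE.
Qed.

Lemma msmooth_derivable p q (A : 'rV[R]_m -> 'M[R]_(p, q)) u v : msmooth A -> U u ->
  derivable A u v.
Proof. by move=> sA Uu; apply/derivable_mxP => i j; exact: smooth_derivable. Qed.

End MatrixSmooth.

Section MatrixDerive.
Context {R : realType} (V : normedModType R).

Lemma derive_mxE p q (A : V -> 'M[R]_(p, q)) x v i j : derivable A x v ->
  ('D_v A x) i j = 'D_v (fun y => A y i j) x.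
Proof. by move=> dA; rewrite derive_mx // mxE. Qed.

Lemma derivable_mulmx p q r (A : V -> 'M[R]_(p, q)) (B : V -> 'M[R]_(q, r)) x v :
  derivable A x v -> derivable B x v ->
  derivable (fun y => A y *m B y) x v /\
  'D_v (fun y => A y *m B y) x = 'D_v A x *m B x + A x *m 'D_v B x.
Proof.
move=> dA dB.
have dA' i j := (derivable_mxP A x v).1 dA i j.
have dB' i j := (derivable_mxP B x v).1 dB i j.
have E i j : (fun y => (A y *m B y) i j) = (fun y => \sum_k A y i k * B y k j).
  by apply/funext => y; rewrite mxE.
have key i j := @derive_sumf _ V _ (index_enum 'I_q) (fun k y => A y i k * B y k j) x v
   (fun k => derivable_mul (dA' i k) (dB' k j)).
have dAB : derivable (fun y => A y *m B y) x v.
  by apply/derivable_mxP => i j; rewrite E; exact: (key i j).1.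
split=> //; apply/matrixP => i j; rewrite derive_mxE // E (key i j).2 !mxE -big_split.
apply: eq_bigr => k _ /=; rewrite derive_mul //.
by rewrite !derive_mxE.
Qed.

Lemma derive_trmx p q (A : V -> 'M[R]_(p, q)) x v : derivable A x v ->
  derivable (fun y => (A y)^T) x v /\ 'D_v (fun y => (A y)^T) x = ('D_v A x)^T.
Proof.
move=> dA; have dA' i j := (derivable_mxP A x v).1 dA i j.
have E i j : (fun y => (A y)^T i j) = (fun y => A y j i).
  by apply/funext => y; rewrite mxE.
have dT : derivable (fun y => (A y)^T) x v.
  by apply/derivable_mxP => i j; rewrite E.
by split=> //; apply/matrixP => i j; rewrite derive_mxE // E mxE derive_mxE.
Qed.

Lemma derive_scalemx p q (f : V -> R) (A : V -> 'M[R]_(p, q)) x v :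
  derivable f x v -> derivable A x v ->
  derivable (fun y => f y *: A y) x v /\
  'D_v (fun y => f y *: A y) x = 'D_v f x *: A x + f x *: 'D_v A x.
Proof.
move=> df dA; have dA' i j := (derivable_mxP A x v).1 dA i j.
have E i j : (fun y => (f y *: A y) i j) = (fun y => f y * A y i j).
  by apply/funext => y; rewrite mxE.
have dT : derivable (fun y => f y *: A y) x v.
  by apply/derivable_mxP => i j; rewrite E; exact: (derivable_mul df (dA' i j)).
split=> //; apply/matrixP => i j; rewrite (derive_mxE _ _ dT) E !mxE.
by rewrite (derive_mul df (dA' i j)) (derive_mxE _ _ dA).
Qed.

Lemma derive_mxtrace p (A : V -> 'M[R]_p) x v : derivable A x v ->
  derivable (fun y => \tr (A y)) x v /\ 'D_v (fun y => \tr (A y)) x = \tr ('D_v A x).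
Proof.
move=> dA; have dA' i j := (derivable_mxP A x v).1 dA i j.
have [d E] := derive_sumf (index_enum 'I_p) (fun i => dA' i i).
split; first exact: d.
by rewrite /mxtrace E; apply: eq_bigr => i _; rewrite derive_mxE.
Qed.

Lemma derive_subf (W : normedModType R) (f g : V -> W) x v :
  derivable f x v -> derivable g x v ->
  derivable (fun y => f y - g y) x v /\
  'D_v (fun y => f y - g y) x = 'D_v f x - 'D_v g x.
Proof. by move=> df dg; split; [exact: derivableB | exact: deriveB]. Qed.

Lemma differentiable_rV p (X : V -> 'rV[R]_p) x :
  (forall j, differentiable (fun y => X y 0 j) x) -> differentiable X x.
Proof.
move=> dX; have -> : X = \sum_j (fun y => X y 0 j *: delta_mx 0 j).
  apply/funext => y; rewrite fct_sumE {1}[X y]matrix_sum_delta big_ord_recl big_ord0 addr0.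
  by [].
apply: differentiable_sum => j; exact: differentiableZl.
Qed.

End MatrixDerive.

Lemma partial_coord (R : realType) p (x : 'rV[R]_p) (i j : 'I_p) :
  derivable (fun z : 'rV[R]_p => z 0 j) x (delta_mx 0 i) /\
  partial i (fun z : 'rV[R]_p => z 0 j) x = (j == i)%:R.
Proof.
have d : derivable (fun z : 'rV[R]_p => z 0 j) x (delta_mx 0 i).
  by apply: diff_derivable; exact: differentiable_coord.
split=> //; rewrite /partial.
have := @derive_mxE R _ _ _ id x (delta_mx 0 i) 0 j (@derivable_id _ _ _ _).
by rewrite derive_id mxE eqxx /= => <-.
Qed.

(** * The strong maximum principle *)

Section StrongMax.
Context {R : realType} (m : nat).

Definition elliptic_op (P : 'rV[R]_m -> 'M[R]_m) (b : 'rV[R]_m -> 'rV[R]_m)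
    (f : 'rV[R]_m -> R) (x : 'rV[R]_m) : R :=
  \sum_i \sum_j P x i j * partial i (partial j f) x
  + \sum_k b x 0 k * partial k f x.

(** The squared Euclidean distance. Its balls have smooth boundaries, unlike
    those of the norm of row vectors, which is the sup norm. *)
Definition sqdist (x y : 'rV[R]_m) : R := \sum_i (x 0 i - y 0 i) * (x 0 i - y 0 i).

Lemma sqdist_ge0 x y : 0 <= sqdist x y.
Proof. by apply: sumr_ge0 => i _; rewrite -expr2 sqr_ge0. Qed.

Lemma sqdist_eq0 x y : sqdist x y = 0 -> x = y.
Proof.
move/eqP; rewrite psumr_eq0; last by move=> i _; rewrite -expr2 sqr_ge0.
move/allP => H; apply/rowP => i; have := H i (mem_index_enum i).
by rewrite mulf_eq0 orbb subr_eq0 => /eqP.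
Qed.

Lemma sqdist_triangle y x z : sqdist x z <= 2 * sqdist x y + 2 * sqdist y z.
Proof.
rewrite /sqdist !mulr_sumr -big_split; apply: ler_sum => i _ /=.
set a := x 0 i; set b := y 0 i; set c := z 0 i.
have := sqr_ge0 (a - b - (b - c)); rewrite expr2; nra.
Qed.

Lemma sqdist_small x y (e : R) : 0 < e -> sqdist x y < e ^+ 2 -> `|x - y| < e.
Proof.
move=> e0 H; apply: normr_rV_lt => // i; rewrite !mxE.
rewrite -(@ltr_pXn2r _ 2) ?nnegrE ?normr_ge0 // ?(ltW e0) //.
apply: le_lt_trans H; rewrite real_normK ?num_real // /sqdist (bigD1 i) //= -expr2 lerDl.
by apply: sumr_ge0 => j _; rewrite -expr2 sqr_ge0.
Qed.

Lemma smooth_coord_sub (a : R) (j : 'I_m) (U : set 'rV[R]_m) : open U ->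
  smooth U (fun x : 'rV[R]_m => x 0 j - a).
Proof.
move=> oU k; have := dupto_linear oU k (fun i => (i == j)%:R : R).
move/(duptoD oU)/(_ (dupto_cst U k (- a))); apply: (dupto_ext oU) => x _ /=.
rewrite (bigD1 j) //= eqxx mulr1 big1 ?addr0 // => i /negbTE ->.
by rewrite mulr0.
Qed.

Lemma smooth_sqdist y (U : set 'rV[R]_m) : open U -> smooth U (fun x => sqdist x y).
Proof.
move=> oU k; apply: (dupto_sum oU) => i _.
by apply: duptoM => //; exact: smooth_coord_sub.
Qed.

Lemma partial_sqdist y x i : partial i (fun x => sqdist x y) x = 2 * (x 0 i - y 0 i).
Proof.
have D (j : 'I_m) : is_derive x (delta_mx 0 i) (fun z : 'rV[R]_m => z 0 j - y 0 j) ((i == j)%:R : R).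
  have [d1 E1] := partial_coord x i j.
  have d2 : is_derive x (delta_mx 0 i) (fun z : 'rV[R]_m => z 0 j) ((i == j)%:R : R).
    by apply: DeriveDef => //; rewrite eq_sym.
  have d3 := @is_derive_cst R 'rV[R]_m R (- y 0 j) x (delta_mx 0 i).
  by have := is_deriveD d2 d3; rewrite addr0.
have dD (j : 'I_m) : derivable (fun z : 'rV[R]_m => z 0 j - y 0 j) x (delta_mx 0 i).
  by have [] := D j.
have -> : (fun x => sqdist x y) =
    \sum_j ((fun z : 'rV[R]_m => z 0 j - y 0 j) * (fun z : 'rV[R]_m => z 0 j - y 0 j)).
  by apply/funext => z; rewrite fct_sumE.
rewrite /partial derive_sum; last by move=> j; apply: derivableM.
rewrite (bigD1 i) //= big1 ?addr0.
  rewrite deriveM ?(@derive_val _ _ _ _ _ _ _ (D i)) //.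
  by rewrite eqxx /GRing.scale /= mulr1 -mulr2n mulr_natl.
move=> j /negbTE ji; rewrite deriveM //.
by rewrite (@derive_val _ _ _ _ _ _ _ (D j)) eq_sym ji scaler0 addr0.
Qed.

Lemma within_continuousP (A : set 'rV[R]_m) (f : 'rV[R]_m -> R) :
  (forall x, A x -> {for x, continuous f}) -> {within A, continuous f}.
Proof. by move=> cf; apply/continuous_in_subspaceT => x; rewrite inE; exact: cf. Qed.

Lemma norm_sub_continuous (z : 'rV[R]_m) : continuous (fun x : 'rV[R]_m => `|x - z|).
Proof.
move=> x; apply/(@cvgrPdist_lt _ _ _ _ (nbhs_filter (x : 'rV[R]_m))) => e e0.
apply: (ball_near e0) => h he.
rewrite distrC; apply: le_lt_trans he.
have := ler_dist_dist (x + h - z) (x - z).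
by rewrite opprB addrA subrK [x + h]addrC addrK.
Qed.

Lemma near_gt0 (T : topologicalType) (f : T -> R) x :
  {for x, continuous f} -> 0 < f x -> nbhs x [set y | 0 < f y].
Proof.
by move=> cf fx; exact: (cf _ (open_nbhs_nbhs (conj (@open_gt R 0) fx))).
Qed.

Lemma closed_le_fun (g : 'rV[R]_m -> R) (e : R) : continuous g ->
  closed [set x | g x <= e].
Proof.
move=> cg; rewrite (_ : mkset _ = g @^-1` [set t | t <= e]) //.
by apply: closed_comp; [move=> x _; exact: cg | exact: closed_le].
Qed.

Lemma closed_ge_fun (g : 'rV[R]_m -> R) (e : R) : continuous g ->
  closed [set x | e <= g x].
Proof.
move=> cg; rewrite (_ : mkset _ = g @^-1` [set t | e <= t]) //.
by apply: closed_comp; [move=> x _; exact: cg | exact: closed_ge].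
Qed.

Lemma compact_normball (z : 'rV[R]_m) (e : R) (K : set 'rV[R]_m) :
  closed K -> K `<=` [set x | `|x - z| <= e] -> compact K.
Proof.
move=> cK Ke; apply: bounded_closed_compact cK.
exists (`|z| + e); split; first exact: num_real.
move=> M HM x Kx /=; apply: ltW; apply: le_lt_trans HM.
rewrite -[x](subrK z) addrC; apply: le_trans (ler_normD _ _) _.
by rewrite lerD2l; exact: Ke.
Qed.

(** The gradient vanishes at a maximum, and the factorization of [P z] turns
    the second-order part into a sum of second derivatives of [f] along the
    columns of [Q]. *)
Lemma elliptic_op_le0 (U : set 'rV[R]_m) P b (f : 'rV[R]_m -> R) z p (Q : 'M[R]_(m, p)) :
  open U -> U z -> (forall x, U x -> f x <= f z) -> differentiable_upto 2 U f ->
  P z = Q *m Q^T -> elliptic_op P b f z <= 0.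
Proof.
move=> oU Uz H df2 PQ.
have dz : differentiable f z := dupto1_differentiable oU df2 Uz.
rewrite /elliptic_op [X in _ + X]big1 ?addr0; last first.
  by move=> k _; rewrite /partial (derive_eq0_max _ oU Uz H dz) mulr0.
have -> : \sum_i \sum_j P z i j * partial i (partial j f) z =
   \sum_k \sum_i \sum_j (col k Q)^T 0 i * (col k Q)^T 0 j * partial i (partial j f) z.
  rewrite [RHS]exchange_big; apply: eq_bigr => i _.
  rewrite [RHS]exchange_big; apply: eq_bigr => j _.
  rewrite PQ mxE mulr_suml; apply: eq_bigr => k _.
  by rewrite !mxE.
apply: sumr_le0 => k _; exact: max_hessian oU Uz H df2.
Qed.

Lemma elliptic_op_gt0 (P : 'rV[R]_m -> 'M[R]_m) z p (Q : 'M[R]_(m, p)) (v : 'rV[R]_m) :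
  P z = Q *m Q^T -> row_free Q -> v != 0 ->
  0 < \sum_i \sum_j P z i j * (v 0 i * v 0 j).
Proof.
move=> PQ rQ v0.
have -> : \sum_i \sum_j P z i j * (v 0 i * v 0 j) = \sum_k ((v *m Q) 0 k) ^+ 2.
  transitivity ((v *m P z *m v^T) 0 0).
    rewrite !mxE exchange_big; apply: eq_bigr => i _ /=.
    rewrite !mxE mulr_suml; apply: eq_bigr => j _.
    by rewrite mulrA [P z j i * _]mulrC.
  rewrite PQ mulmxA -mulmxA -trmx_mul mxE; apply: eq_bigr => k _.
  by rewrite [in X in _ * X]mxE expr2.
have : v *m Q != 0 by rewrite mulmx_free_eq0.
apply: contraNT; rewrite -leNgt => H; apply/eqP/rowP => k.
have : \sum_k ((v *m Q) 0 k) ^+ 2 == 0.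
  by rewrite eq_le H sumr_ge0 // => j _; rewrite sqr_ge0.
rewrite psumr_eq0; last by move=> j _; rewrite sqr_ge0.
by move=> /allP/(_ k (mem_index_enum k)); rewrite sqrf_eq0 => /eqP ->; rewrite !mxE.
Qed.

(** The boundary point argument of Hopf. Let [v = h + al * h ^ 2]. For small
    [h] it has the sign of [h], and since the gradient of [h] at [z] is not
    zero, a large [al] makes [elliptic_op P b v] positive near [z]. If the
    region [0 <= h] met [f = M] at [z] only, then for small [ep > 0] the
    function [f + ep * v], which is [M] at [z], would be less than [M] on a
    small sphere about [z]: by compactness where [0 <= h], and because [v < 0]
    elsewhere. It would have a maximum inside this sphere, although
    [elliptic_op P b (f + ep * v)] is positive there. *)
Lemma barrier (U : set 'rV[R]_m) (P : 'rV[R]_m -> 'M[R]_m) (b : 'rV[R]_m -> 'rV[R]_m)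
    (f h : 'rV[R]_m -> R) (M : R) z :
  open U -> U z -> differentiable_upto 2 U f ->
  (forall x, U x -> exists p, exists2 Q : 'M[R]_(m, p), P x = Q *m Q^T & row_free Q) ->
  (forall x i j, U x -> {for x, continuous (fun x => P x i j)}) ->
  (forall x i, U x -> {for x, continuous (fun x => b x 0 i)}) ->
  (forall x, U x -> 0 <= elliptic_op P b f x) ->
  (forall x, U x -> f x <= M) -> f z = M ->
  smooth setT h -> h z = 0 -> (exists i, partial i h z != 0) ->
  ~ (forall x, U x -> x != z -> 0 <= h x -> f x < M).
Proof.
move=> oU Uz df2 PQ cP cb Lf fM fz sh hz [i0 gradh] contact.
have oT : open (@setT 'rV[R]_m) := openT.
have dh k : differentiable_upto k setT h by exact: sh.
have difh x v : derivable h x v.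
  by apply: diff_derivable; exact: (dupto1_differentiable oT (dh 1)).
pose q := \sum_i \sum_j P z i j * (partial i h z * partial j h z).
have q0 : 0 < q.
  have [p [Q PQz rQ]] := PQ z Uz.
  have := elliptic_op_gt0 (v := \row_i partial i h z) PQz rQ.
  rewrite /q; under eq_bigr do under eq_bigr do rewrite !mxE.
  by apply; apply: contraNneq gradh => /rowP/(_ i0); rewrite !mxE => /eqP.
(* Chosen so that [2 * al * q] exceeds the absolute value of the operator at [h]. *)
pose al := (`|elliptic_op P b h z| + 1) / (2 * q).
have al0 : 0 < al by rewrite divr_gt0 // ?mulr_gt0 // ltr_wpDl.
have [v vE] : exists v, v = (fun x => h x + al * (h x * h x)) by eexists.
have sv : smooth setT v.
  move=> k; rewrite vE; apply: duptoD => //; apply: duptoM => //; first exact: dupto_cst.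
  exact: duptoM.
have pv i x : partial i v x = partial i h x + al * (2 * (h x * partial i h x)).
  have dhh : derivable (fun y => h y * h y) x (delta_mx 0 i).
    exact: derivable_mul (difh _ _) (difh _ _).
  rewrite /partial vE (derive_add (difh _ _) (derivable_scale (a := al) dhh)).
  by rewrite (derive_scale al dhh) (derive_mul (difh _ _) (difh _ _)); ring.
have dph i x w : derivable (partial i h) x w.
  apply: diff_derivable; apply: (dupto1_differentiable oT (k := 0)) => //.
  exact: smooth_partial.
have ppv i j : partial i (partial j v) z = partial i (partial j h) z
    + 2 * al * (partial i h z * partial j h z).
  have -> : partial j v = (fun x => partial j h x + 2 * al * (h x * partial j h x)).
    by apply/funext => x; rewrite pv; ring.
  have d1 : derivable (fun x => h x * partial j h x) z (delta_mx 0 i).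
    exact: derivable_mul (difh _ _) (dph j z _).
  rewrite {1}/partial (derive_add (dph j z _) (derivable_scale (a := 2 * al) d1)).
  by rewrite (derive_scale (2 * al) d1) (derive_mul (difh _ _) (dph j z _)) hz mul0r addr0.
have Lvz : elliptic_op P b v z = elliptic_op P b h z + 2 * al * q.
  rewrite /elliptic_op /q addrAC; congr (_ + _); last first.
    by apply: eq_bigr => k _; rewrite pv hz mul0r !mulr0 addr0.
  rewrite mulr_sumr -big_split; apply: eq_bigr => i _ /=.
  rewrite mulr_sumr -big_split; apply: eq_bigr => j _ /=.
  by rewrite ppv mulrDr; congr (_ + _); rewrite mulrCA.
have Lvz0 : 0 < elliptic_op P b v z.
  rewrite Lvz /al -mulrA [_ / _ * q]mulrAC -mulf_div.
  have -> : 2 * ((`|elliptic_op P b h z| + 1) / 2 * (q / q))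
     = `|elliptic_op P b h z| + 1.
    by rewrite divff ?gt_eqF // mulr1 mulrC divfK.
  have := ler_norm (- elliptic_op P b h z); rewrite normrN; lra.
have cLv : {for z, continuous (elliptic_op P b v)}.
  apply: continuousD.
    apply: continuous_sumR => i _; apply: continuous_sumR => j _.
    apply: continuousM; first exact: cP.
    by apply: (dupto_continuous (smooth_partial i (smooth_partial j sv) 0)).
  apply: continuous_sumR => i _; apply: continuousM; first exact: cb.
  by apply: (dupto_continuous (smooth_partial i sv 0)).
have ch : continuous h by move=> x; exact: (dupto_continuous (dh 0)).
have cv : continuous v by move=> x; exact: (dupto_continuous (sv 0)).
have [e e0 He] : exists2 e : R, 0 < e & forall x, `|x - z| <= e ->
    [/\ U x, 0 < elliptic_op P b v x & 0 < 1 + al * h x].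
  have n1 : nbhs z U by exact: open_nbhs_nbhs.
  have n2 := near_gt0 cLv Lvz0.
  have n3 : nbhs z [set x | 0 < 1 + al * h x].
    have c3 : {for z, continuous (fun x => 1 + al * h x)}.
      apply: continuousD; first exact: cst_continuous.
      by apply: continuousM; [exact: cst_continuous | exact: ch].
    by apply: (near_gt0 c3); rewrite hz mulr0 addr0.
  have [e e0 He] := nearE_ball (filterI n1 (filterI n2 n3)).
  exists (e / 2); first by rewrite divr_gt0.
  move=> x xz; have [] := He (x - z); first by lra.
  by rewrite addrC subrK => ? [].
pose K := [set x | `|x - z| <= e].
have cK : compact K by apply: compact_normball (z) (e) _ _ _ => //; apply/closed_le_fun/norm_sub_continuous.
pose S := [set x | [/\ `|x - z| <= e, e <= `|x - z| & 0 <= h x]].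
have SK : S `<=` K by move=> x [].
have cS : compact S.
  apply: (@compact_normball z e) => //.
  rewrite (_ : S = K `&` ([set x | e <= `|x - z|] `&` [set x | 0 <= h x])).
    apply: closedI; first exact/closed_le_fun/norm_sub_continuous.
    by apply: closedI; apply: closed_ge_fun => //; exact: norm_sub_continuous.
  apply/seteqP; split=> x; rewrite /S /K /=; first by move=> [].
  by move=> [? []].
have SfM x : S x -> f x < M.
  move=> [x1 x2 x3]; have [Ux _ _] := He x x1; apply: contact => //.
  by apply: contraTneq x2 => ->; rewrite subrr normr0 -ltNge.
have [ep ep0 Hep] : exists2 ep : R, 0 < ep & forall x, S x -> f x + ep * v x < M.
  have [S0|/set0P/negP/negbNE/eqP S0] := pselect (S !=set0); last first.
    by exists 1 => // x; rewrite S0.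
  have cfS : {within S, continuous f}.
    apply: within_continuousP => x [x1 _ _]; have [Ux _ _] := He x x1.
    exact: (dupto_continuous df2).
  have [c /set_mem Sc fc] := compact_EVT_max S0 cS cfS.
  have cvS : {within S, continuous v} by apply: within_continuousP => x _; exact: cv.
  have [d /set_mem Sd vd] := compact_EVT_max S0 cS cvS.
  have Mfc : 0 < M - f c by rewrite subr_gt0; exact: SfM.
  have vd0 : 0 < `|v d| + 1 by rewrite ltr_wpDl.
  exists ((M - f c) / (2 * (`|v d| + 1))).
    by rewrite divr_gt0 // mulr_gt0.
  move=> x Sx; have := fc x (mem_set Sx); have := vd x (mem_set Sx).
  move=> vx fx.
  have : (M - f c) / (2 * (`|v d| + 1)) * v x <= (M - f c) / (2 * (`|v d| + 1)) * (`|v d| + 1).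
    rewrite ler_pM2l; last by rewrite divr_gt0 // mulr_gt0.
    by apply: le_trans vx _; apply: le_trans (ler_norm _) _; rewrite lerDl.
  have -> : (M - f c) / (2 * (`|v d| + 1)) * (`|v d| + 1) = (M - f c) / 2.
    by field; rewrite gt_eqF.
  lra.
have [G GE] : exists G, G = (fun x => f x + ep * v x) by eexists.
have Gz : G z = M by rewrite GE fz vE hz mul0r mulr0 addr0 mulr0 addr0.
have K0 : K !=set0 by exists z; rewrite /K /= subrr normr0 ltW.
have cG : {within K, continuous G}.
  apply: within_continuousP => x Kx; have [Ux _ _] := He x Kx.
  rewrite GE; apply: continuousD; first exact: (dupto_continuous df2).
  by apply: continuousM; [exact: cst_continuous | exact: cv].
have [x /set_mem Kx Gx] := compact_EVT_max K0 cK cG.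
have Mx : M <= G x by rewrite -Gz; apply: Gx; rewrite inE /K /= subrr normr0 ltW.
have [Ux Lvx h1] := He x Kx.
have xe : `|x - z| < e.
  rewrite lt_neqAle Kx andbT; apply/eqP => xe.
  have [hx|hx] := leP 0 (h x).
    have Sx : S x by split=> //; rewrite xe.
    by move: Mx; rewrite GE leNgt Hep.
  have : v x < 0 by rewrite vE (_ : _ + _ = h x * (1 + al * h x)) ?nmulr_rlt0 //; ring.
  move=> vx; move: Mx; rewrite leNgt => /negP; apply.
  have : ep * v x < 0 by rewrite pmulr_rlt0.
  by have := fM x Ux; rewrite GE; lra.
pose W := [set x | `|x - z| < e].
have oW : open W.
  rewrite (_ : W = (fun x : 'rV[R]_m => `|x - z|) @^-1` [set t | t < e]) //.
  by apply: open_comp; [move=> ? _; exact: norm_sub_continuous | exact: open_lt].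
have WU : W `<=` U by move=> t /ltW /He[].
have dG : differentiable_upto 2 W G.
  rewrite GE; apply: duptoD => //; first exact: dupto_sub WU df2.
  apply: duptoM => //; first exact: dupto_cst.
  by apply: dupto_sub (sv 2).
have [p [Q PQx _]] := PQ x Ux.
have := elliptic_op_le0 b oW xe (fun t (Wt : W t) => Gx t (mem_set (ltW Wt))) dG PQx.
have dfW k : (k <= 2)%N -> differentiable_upto k W f.
  have d2 : differentiable_upto 2 W f by exact: dupto_sub WU df2.
  case: k => [|[|[|//]]] _ //; first by do 2 apply: dupto_lower.
  exact: dupto_lower.
have -> : elliptic_op P b G x = elliptic_op P b f x + ep * elliptic_op P b v x.
  have pG i t : W t -> partial i G t = partial i f t + ep * partial i v t.
    move=> Wt; have df1 : derivable f t (delta_mx 0 i).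
      by apply: diff_derivable; exact: (dupto1_differentiable oW (dfW 1 isT)).
    have dv1 : derivable v t (delta_mx 0 i).
      by apply: diff_derivable; exact: (dupto1_differentiable oT (sv 1)).
    by rewrite /partial GE (derive_add df1 (derivable_scale (a := ep) dv1)) (derive_scale ep dv1).
  have ppG i j : partial i (partial j G) x = partial i (partial j f) x + ep * partial i (partial j v) x.
    rewrite (partial_ext i oW xe (g := fun t => partial j f t + ep * partial j v t)); last first.
      by move=> t Wt; rewrite pG.
    have df1 : derivable (partial j f) x (delta_mx 0 i).
      by have [_ /(_ j)[_ [_ /(_ i)[D _]]]] := dfW 2 isT; exact: D.
    have dv1 : derivable (partial j v) x (delta_mx 0 i).
      by have [_ /(_ j)[_ [_ /(_ i)[D _]]]] := sv 2; exact: D.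
    by rewrite {1}/partial (derive_add df1 (derivable_scale (a := ep) dv1)) (derive_scale ep dv1).
  rewrite /elliptic_op mulrDr addrACA; congr (_ + _).
    rewrite mulr_sumr -big_split; apply: eq_bigr => i _ /=.
    rewrite mulr_sumr -big_split; apply: eq_bigr => j _ /=.
    by rewrite ppG mulrDr; congr (_ + _); rewrite mulrCA.
  rewrite mulr_sumr -big_split; apply: eq_bigr => k _ /=.
  by rewrite pG // mulrDr; congr (_ + _); rewrite mulrCA.
have := Lf x Ux; have : 0 < ep * elliptic_op P b v x by rewrite mulr_gt0.
lra.
Qed.

(** The ball with diameter from [y] to [z] touches the sphere about [y]
    through [z] at [z] only, so it gives the strict contact which [barrier]
    excludes; the function [h] of the proof is nonnegative exactly in it. *)
Lemma tangent_ball (U : set 'rV[R]_m) (P : 'rV[R]_m -> 'M[R]_m) (b : 'rV[R]_m -> 'rV[R]_m)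
    (f : 'rV[R]_m -> R) (M : R) z y :
  open U -> U z -> differentiable_upto 2 U f ->
  (forall x, U x -> exists p, exists2 Q : 'M[R]_(m, p), P x = Q *m Q^T & row_free Q) ->
  (forall x i j, U x -> {for x, continuous (fun x => P x i j)}) ->
  (forall x i, U x -> {for x, continuous (fun x => b x 0 i)}) ->
  (forall x, U x -> 0 <= elliptic_op P b f x) ->
  (forall x, U x -> f x <= M) -> f z = M -> z != y ->
  ~ (forall x, U x -> sqdist x y < sqdist z y -> f x < M).
Proof.
move=> oU Uz df2 PQ cP cb Lf fM fz zy inball.
pose h x := sqdist z y + (- 1) * (sqdist x y + sqdist x z).
have zz : sqdist z z = 0 by rewrite /sqdist big1 // => i _; rewrite subrr mul0r.
have oT : open (@setT 'rV[R]_m) := openT.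
apply: (@barrier U P b f h M z) => //.
- move=> k; rewrite /h; apply: duptoD => //; first exact: dupto_cst.
  apply: duptoM => //; first exact: dupto_cst.
  by apply: duptoD => //; exact: smooth_sqdist.
- by rewrite /h zz addr0 mulN1r subrr.
- have [i zyi] : exists i, z 0 i - y 0 i != 0.
    apply/existsP; apply: contraNT zy; rewrite negb_exists => /forallP H.
    by apply/eqP/rowP => i; apply/eqP; have := H i; rewrite negbK subr_eq0.
  exists i.
  have ds w : derivable (fun x => sqdist x w) z (delta_mx 0 i).
    apply: diff_derivable.
    exact: (dupto1_differentiable oT (smooth_sqdist w oT 1)).
  rewrite /partial /h derive_add; [|exact: derivable_cst|exact: derivable_scale (derivable_add (ds y) (ds z))].
  rewrite derive_cst (derive_scale _ (derivable_add (ds y) (ds z))).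
  rewrite (derive_add (ds y) (ds z)) add0r.
  rewrite -[X in X + _]/(partial i _ z) -[X in _ + X]/(partial i _ z).
  by rewrite !partial_sqdist subrr mulr0 addr0 !mulf_neq0 // oppr_eq0 oner_eq0.
- move=> x Ux xz; rewrite /h mulN1r subr_ge0 => hx; apply: inball => //.
  have : 0 < sqdist x z.
    rewrite lt_neqAle sqdist_ge0 andbT; apply/eqP => /esym /sqdist_eq0 E.
    by rewrite E eqxx in xz.
  by move: hx; lra.
Qed.

Lemma sqdistC x y : sqdist x y = sqdist y x.
Proof. by apply: eq_bigr => i _; ring. Qed.

(** If [f y < M] with [y] close to [u], let [z] be the point of the set
    [f = M] closest to [y]. The ball about [y] through [z] then has no point of
    this set in its interior, contrary to [tangent_ball]. *)
Lemma strong_maximum (U : set 'rV[R]_m) (P : 'rV[R]_m -> 'M[R]_m) (b : 'rV[R]_m -> 'rV[R]_m)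
    (f : 'rV[R]_m -> R) (M : R) u :
  open U -> U u -> differentiable_upto 2 U f ->
  (forall x, U x -> exists p, exists2 Q : 'M[R]_(m, p), P x = Q *m Q^T & row_free Q) ->
  (forall x i j, U x -> {for x, continuous (fun x => P x i j)}) ->
  (forall x i, U x -> {for x, continuous (fun x => b x 0 i)}) ->
  (forall x, U x -> 0 <= elliptic_op P b f x) ->
  (forall x, U x -> f x <= M) -> f u = M ->
  nbhs u [set x | f x = M].
Proof.
move=> oU Uu df2 PQ cP cb Lf fM fu.
have [e0 e00 He0] := nearE_ball (open_nbhs_nbhs (conj oU Uu)).
pose e := e0 / 2; have ep : 0 < e by rewrite divr_gt0.
have He x : `|x - u| <= e -> U x.
  move=> xu; have := He0 (x - u); rewrite [u + _]addrC subrK; apply.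
  by move: xu; rewrite /e; lra.
have e2 : 0 < (e / 2) ^+ 2 by rewrite exprn_gt0 // divr_gt0.
have uu : sqdist u u = 0 by rewrite /sqdist big1 // => i _; rewrite subrr mul0r.
have ns : nbhs u [set x | 0 < (e / 2) ^+ 2 - sqdist x u].
  apply: near_gt0; last by rewrite uu subr0.
  apply: continuousB; first exact: cst_continuous.
  exact: (dupto_continuous (smooth_sqdist u openT 0)).
apply: (filterS _ ns) => y /=; rewrite subr_gt0 => yu; apply: contrapT => fy.
pose Z := [set x | `|x - u| <= e /\ f x = M].
have cZ : compact Z.
  apply: (@compact_normball u e); last by move=> x [].
  move=> x clx.
  have xe : `|x - u| <= e.
    have := closed_le_fun (e := e) (@norm_sub_continuous u); apply.
    by move=> B /clx [t [[t1 _] Bt]]; exists t.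
  split=> //; apply: contrapT => fx.
  have Ux := He x xe.
  have nx : nbhs x [set t | 0 < M - f t].
    apply: near_gt0; last by rewrite subr_gt0 lt_neqAle fM // andbT; apply/eqP.
    by apply: continuousB; [exact: cst_continuous | exact: (dupto_continuous df2)].
  by have [t [[_ ft] /=]] := clx _ nx; rewrite ft subrr ltxx.
have Z0 : Z !=set0 by exists u; split=> //; rewrite subrr normr0 ltW.
have csq : {within Z, continuous (fun x => sqdist x y)}.
  apply: within_continuousP => x _.
  exact: (dupto_continuous (smooth_sqdist y openT 0)).
have [z /set_mem [ze fz] zmin] := compact_EVT_min Z0 cZ csq.
have zy : z != y by apply/eqP => zy; apply: fy; rewrite -zy.
apply: (@tangent_ball U P b f M z y) => //; first exact: He.
move=> x Ux xy; rewrite lt_neqAle fM // andbT; apply/eqP => fx.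
have uZ : Z u by split=> //; rewrite subrr normr0 ltW.
have zu : sqdist z y <= sqdist u y by apply: zmin; rewrite inE.
have xZ : Z x.
  split=> //; apply: ltW; apply: sqdist_small => //.
  have := sqdist_triangle y x u; rewrite [sqdist y u]sqdistC => h.
  move: yu; rewrite sqdistC expr_div_n; lra.
by have := zmin x (mem_set xZ); rewrite leNgt xy.
Qed.

End StrongMax.

(** * The conformal metric of a space form *)

Section SpaceFormFormulas.
Context {R : realType} (c : R).
Hypothesis hc : c \in [:: -1; 0; 1].

Definition dotr p (u v : 'rV[R]_p) : R := \sum_i u 0 i * v 0 i.

Lemma dotrE p (u v : 'rV[R]_p) : (u *m v^T) 0 0 = dotr u v.
Proof. by rewrite mxE; apply: eq_bigr => i _; rewrite mxE. Qed.

Lemma dotrC p (u v : 'rV[R]_p) : dotr u v = dotr v u.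
Proof. by apply: eq_bigr => i _; rewrite mulrC. Qed.

Lemma dotrDl p (u v w : 'rV[R]_p) : dotr (u + v) w = dotr u w + dotr v w.
Proof. by rewrite /dotr -big_split; apply: eq_bigr => i _; rewrite mxE mulrDl. Qed.

Lemma dotrZl p (a : R) (u w : 'rV[R]_p) : dotr (a *: u) w = a * dotr u w.
Proof. by rewrite /dotr mulr_sumr; apply: eq_bigr => i _; rewrite mxE mulrA. Qed.

Lemma dotrDr p (u v w : 'rV[R]_p) : dotr w (u + v) = dotr w u + dotr w v.
Proof. by rewrite dotrC dotrDl 2!(dotrC w). Qed.

Lemma dotrZr p (a : R) (u w : 'rV[R]_p) : dotr w (a *: u) = a * dotr w u.
Proof. by rewrite dotrC dotrZl dotrC. Qed.

Lemma dotrNl p (u w : 'rV[R]_p) : dotr (- u) w = - dotr u w.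
Proof. by rewrite -scaleN1r dotrZl mulN1r. Qed.

Lemma dotrNr p (u w : 'rV[R]_p) : dotr w (- u) = - dotr w u.
Proof. by rewrite dotrC dotrNl dotrC. Qed.

Lemma dotr_ge0 p (u : 'rV[R]_p) : 0 <= dotr u u.
Proof. by apply: sumr_ge0 => i _; rewrite -expr2 sqr_ge0. Qed.

Lemma dotr_eq0 p (u : 'rV[R]_p) : (dotr u u == 0) = (u == 0).
Proof.
apply/eqP/eqP => [/eqP|->]; last by rewrite /dotr big1 // => i _; rewrite mxE mul0r.
rewrite psumr_eq0; last by move=> i _; rewrite -expr2 sqr_ge0.
move/allP => H; apply/rowP => i; have := H i (mem_index_enum i).
by rewrite mulf_eq0 orbb => /eqP ->; rewrite mxE.
Qed.

Lemma enorm2 p (u : 'rV[R]_p) : enorm u ^+ 2 = dotr u u.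
Proof.
rewrite /enorm sqr_sqrtr; last by apply: sumr_ge0 => i _; rewrite sqr_ge0.
by apply: eq_bigr => i _; rewrite expr2.
Qed.

Lemma enorm_ge0 p (u : 'rV[R]_p) : 0 <= enorm u.
Proof. exact: sqrtr_ge0. Qed.

(** The metric is the Euclidean one divided by the square of this factor, see
    [innerE]. *)
Definition conf p (x : 'rV[R]_p) : R := 1 + c / 4 * dotr x x.

Lemma conf_gt0 p (x : 'rV[R]_p) : space_dom c p x -> 0 < conf x.
Proof.
rewrite /space_dom /conf -enorm2 /= => H.
have := sqr_ge0 (enorm x).
move: hc; rewrite !inE => /or3P[] /eqP E; rewrite E.
- move=> _; have := H E => h2.
  suff : enorm x ^+ 2 < 4 by lra.
  by rewrite (_ : 4 = 2 ^+ 2) ?ltr_pXn2r ?nnegrE ?enorm_ge0 //; lra.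
- lra.
- lra.
Qed.

Lemma space_metricE p (x : 'rV[R]_p) : space_metric c p x = ((conf x) ^- 2)%:M.
Proof. by rewrite /space_metric enorm2. Qed.

Lemma innerE p (x u v : 'rV[R]_p) :
  inner (space_metric c p) x u v = (conf x) ^- 2 * dotr u v.
Proof.
by rewrite /inner space_metricE mul_mx_scalar -scalemxAl mxE dotrE.
Qed.

Lemma partial_conf p (x : 'rV[R]_p) i :
  derivable (@conf p) x (delta_mx 0 i) /\ partial i (@conf p) x = c / 2 * x 0 i.
Proof.
have dc j := (partial_coord x i j).1.
have Ec j : 'D_(delta_mx 0 i) (fun z : 'rV[R]_p => z 0 j) x = (j == i)%:R.
  exact: (partial_coord x i j).2.
have [d E] := derive_sumf (index_enum 'I_p) (fun j => derivable_mul (dc j) (dc j)).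
have d4 := derivable_scale (a := c / 4) d.
have d1 : derivable (fun _ : 'rV[R]_p => 1 : R) x (delta_mx 0 i).
  exact: (derivable_cst (1 : R) x (delta_mx 0 i)).
split; first exact: (derivable_add d1 d4).
rewrite /partial /conf (derive_add d1 d4) derive_cst add0r.
rewrite (derive_scale _ d) E.
rewrite (bigD1 i) //= big1 ?addr0.
  by rewrite (derive_mul (dc i) (dc i)) Ec eqxx mul1r mulr1; field.
move=> j /negbTE ji; rewrite (derive_mul (dc j) (dc j)).
by rewrite Ec ji mul0r mulr0 addr0.
Qed.

Lemma partial_metric p (x : 'rV[R]_p) i j l : space_dom c p x ->
  partial i (fun y => space_metric c p y j l) x =
  (j == l)%:R * (- c * x 0 i * (conf x) ^- 3).
Proof.
move=> Dx; have r0 : conf x != 0 by rewrite gt_eqF // conf_gt0.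
have [d E] := partial_conf x i.
have dV : derivable (fun y : 'rV[R]_p => (conf y)^-1) x (delta_mx 0 i).
  exact: (derivableV r0 d).
have EV : 'D_(delta_mx 0 i) (fun y : 'rV[R]_p => (conf y)^-1) x =
    - (conf x) ^- 2 * (c / 2 * x 0 i).
  by rewrite (deriveV r0 d) -E.
have -> : (fun y => space_metric c p y j l) =
   (fun y => (j == l)%:R * ((conf y)^-1 * (conf y)^-1)).
  by apply/funext => y; rewrite space_metricE mxE expr2 invfM [RHS]mulr_natl.
have dV2 : derivable (fun y : 'rV[R]_p => (conf y)^-1 * (conf y)^-1) x (delta_mx 0 i).
  exact: (derivable_mul dV dV).
rewrite /partial (derive_scale _ dV2) (derive_mul dV dV) EV.
congr (_ * _); field.
by rewrite r0.
Qed.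

Lemma christoffelE p (x : 'rV[R]_p) i j k : space_dom c p x ->
  christoffel (space_metric c p) i j k x =
  - (c / 2) / conf x * ((j == k)%:R * x 0 i + (i == k)%:R * x 0 j - (i == j)%:R * x 0 k).
Proof.
move=> Dx; have r0 : conf x != 0 by rewrite gt_eqF // conf_gt0.
rewrite /christoffel.
have -> : invmx (space_metric c p x) = ((conf x) ^+ 2)%:M.
  by rewrite space_metricE invmx_scalar invrK.
rewrite (bigD1 k) //= big1 ?addr0; last first.
  by move=> l /negbTE lk; rewrite mxE eq_sym lk mul0r.
by rewrite mxE eqxx mulr1n !partial_metric //; field.
Qed.

(** A conformal factor changes the Euclidean connection by terms in its
    gradient, which here is a multiple of the position vector. *)
Lemma cov_derivE p q (X Y : 'rV[R]_q -> 'rV[R]_p) i u : space_dom c p (X u) ->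
  cov_deriv (space_metric c p) X Y i u = partial i Y u
   - (c / 2 / conf (X u)) *: (dotr (X u) (partial i X u) *: Y u
       + dotr (X u) (Y u) *: partial i X u - dotr (partial i X u) (Y u) *: X u).
Proof.
move=> Dx; rewrite /cov_deriv; congr (_ + _); apply/rowP => k; rewrite !mxE.
set W := partial i X u; set x := X u; set y := Y u.
transitivity (\sum_a \sum_b - (c / 2) / conf x * 
    ((b == k)%:R * (x 0 a * W 0 a * y 0 b) + (a == k)%:R * (W 0 a * (x 0 b * y 0 b))
    - (a == b)%:R * (W 0 a * y 0 b * x 0 k))).
  by apply: eq_bigr => a _; apply: eq_bigr => b _; rewrite christoffelE //; ring.
under eq_bigr => a _ do rewrite -mulr_sumr.
rewrite -mulr_sumr !mulNr; congr (- (_ * _)).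
under eq_bigr => a _ do rewrite !big_split /= sumrN.
rewrite !big_split /= sumrN; congr (_ + _ - _).
- rewrite /dotr mulr_suml; apply: eq_bigr => a _.
  rewrite (bigD1 k) //= big1 ?addr0 ?eqxx ?mul1r //.
  by move=> b /negbTE ->; rewrite mul0r.
- rewrite (bigD1 k) //= [X in _ + X]big1 ?addr0; last first.
    by move=> a /negbTE ->; rewrite big1 // => b _; rewrite mul0r.
  rewrite /dotr mulr_suml; apply: eq_bigr => b _.
  by rewrite eqxx mul1r; ring.
- rewrite /dotr mulr_suml; apply: eq_bigr => a _.
  rewrite (bigD1 a) //= big1 ?addr0 ?eqxx ?mul1r //.
  by move=> b /negbTE ba; rewrite eq_sym ba mul0r.
Qed.

End SpaceFormFormulas.

(** * Gram matrices and traces *)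

Section LinearAlgebra.
Context {R : realType}.

Lemma mulmx_trE p q r (A : 'M[R]_(p, r)) (B : 'M[R]_(q, r)) i j :
  (A *m B^T) i j = dotr (row i A) (row j B).
Proof. by rewrite mxE; apply: eq_bigr => k _; rewrite !mxE. Qed.

Lemma mxtrace_gram p q (A : 'M[R]_(p, q)) : \tr (A *m A^T) = \sum_i dotr (row i A) (row i A).
Proof. by apply: eq_bigr => i _; rewrite mulmx_trE. Qed.

Lemma mxtrace_gram_ge0 p q (A : 'M[R]_(p, q)) : 0 <= \tr (A *m A^T).
Proof. by rewrite mxtrace_gram sumr_ge0 // => i _; exact: dotr_ge0. Qed.

Lemma mxtrace_gram_eq0 p q (A : 'M[R]_(p, q)) : \tr (A *m A^T) = 0 -> A = 0.
Proof.
rewrite mxtrace_gram => /eqP; rewrite psumr_eq0; last by move=> i _; exact: dotr_ge0.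
move/allP => H; apply/row_matrixP => i; apply/eqP; rewrite row0 -dotr_eq0.
exact: H (mem_index_enum i).
Qed.

Lemma gram_unit p q (A : 'M[R]_(p, q)) : row_free A -> A *m A^T \in unitmx.
Proof.
move=> fA; rewrite -row_free_unit -kermx_eq0; apply/rowV0P => v /sub_kermxP vA.
have : dotr (v *m A) (v *m A) == 0.
  by rewrite -dotrE trmx_mul mulmxA -(mulmxA v) vA mul0mx mxE.
by rewrite dotr_eq0 mulmx_free_eq0 // => /eqP.
Qed.

(** The rows of [A] span a hyperplane, so [v] spans the line orthogonal to
    it. *)
Lemma hyperplane_complement n q (A : 'M[R]_(n, n.+1)) (v : 'rV[R]_n.+1) (w : 'M[R]_(q, n.+1)) :
  row_free A -> v != 0 -> v *m A^T = 0 -> w *m A^T = 0 -> w *m v^T = 0 -> w = 0.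
Proof.
move=> fA v0 vA wA wv.
have rk : \rank (kermx A^T) = 1%N.
  by rewrite mxrank_ker mxrank_tr (eqP fA) subSnn.
have vK : (v <= kermx A^T)%MS by apply/sub_kermxP.
have Kv : (kermx A^T <= v)%MS.
  by rewrite -(mxrank_leqif_sup vK).2 rk rank_rV v0.
have /submxP[D Dw] : (w <= v)%MS by apply: submx_trans Kv; apply/sub_kermxP.
move: wv; rewrite Dw -mulmxA.
have -> : v *m v^T = (dotr v v)%:M by apply/matrixP => i j; rewrite !ord1 dotrE mxE.
rewrite mul_mx_scalar => /eqP; rewrite scaler_eq0 dotr_eq0 (negbTE v0) /= => /eqP ->.
by rewrite mul0mx.
Qed.

Lemma mxtrace_sq_shift n (A : 'M[R]_n) (t : R) :
  \tr ((A + t%:M) *m (A + t%:M)) = \tr (A *m A) + 2 * t * \tr A + t ^+ 2 * n%:R.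
Proof.
rewrite mulmxDl !mulmxDr !mxtraceD mul_scalar_mx !mul_mx_scalar !mxtraceZ mxtrace_scalar.
by rewrite -mulr_natr; ring.
Qed.

(** Separates the second-order and the first-order parts of a Laplacian. *)
Lemma mxtrace_hessian n (A : 'M[R]_n) (H : 'I_n -> 'I_n -> R)
    (Gm : 'I_n -> 'I_n -> 'I_n -> R) (d : 'I_n -> R) :
  \tr (A *m \matrix_(i, j) (H i j - \sum_k Gm i j k * d k)) =
  \sum_i \sum_j A^T i j * H i j +
  \sum_k (- (\sum_i \sum_j A i j * Gm j i k)) * d k.
Proof.
have -> : \sum_i \sum_j A^T i j * H i j = \sum_i \sum_j A i j * H j i.
  rewrite exchange_big; apply: eq_bigr => i _; apply: eq_bigr => j _.
  by rewrite mxE.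
have -> : \sum_k (- (\sum_i \sum_j A i j * Gm j i k)) * d k =
    - \sum_i \sum_j \sum_k A i j * (Gm j i k * d k).
  rewrite -sumrN; under [RHS]eq_bigr => i _ do rewrite exchange_big -sumrN.
  rewrite [RHS]exchange_big; apply: eq_bigr => k _.
  rewrite mulNr mulr_suml -sumrN; apply: eq_bigr => i _; congr (- _).
  by rewrite mulr_suml; apply: eq_bigr => j _; rewrite mulrA.
rewrite -sumrB; apply: eq_bigr => i _; rewrite mxE -sumrB; apply: eq_bigr => j _.
by rewrite mxE mulrBr mulr_sumr.
Qed.

End LinearAlgebra.

(** * The matrix of coordinate vectors *)

Section Jac.
Context {R : realType} (n p : nat) (U : set 'rV[R]_n).
Hypothesis oU : open U.

(** The rows are the coordinate vectors of [X]. A tangent vector is given by the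
    row [Y] of its coefficients, and is [Y *m jac X u] in the ambient space. *)
Definition jac (X : 'rV[R]_n -> 'rV[R]_p) (u : 'rV[R]_n) : 'M[R]_(n, p) :=
  \matrix_(i, a) partial i (fun v => X v 0 a) u.

Lemma smooth_msmooth (X : 'rV[R]_n -> 'rV[R]_p) : smooth U X -> msmooth U X.
Proof. by move=> sX i j k; apply: dupto_coord. Qed.

Variable X : 'rV[R]_n -> 'rV[R]_p.
Hypothesis sX : msmooth U X.

Lemma msmooth_jac : msmooth U (jac X).
Proof.
move=> i a; apply: (smooth_ext oU (f := partial i (fun v => X v 0 a))).
  by move=> u _; rewrite mxE.
exact/smooth_partial/sX.
Qed.

Lemma derivable_smooth u v : U u -> derivable X u v.
Proof. by move=> Uu; exact: (msmooth_derivable oU sX Uu). Qed.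

Lemma differentiable_smooth u : U u -> differentiable X u.
Proof. by move=> Uu; apply: differentiable_rV => j; exact: (smooth_differentiable oU (sX 0 j) Uu). Qed.

Lemma row_jac u i : U u -> row i (jac X u) = partial i X u.
Proof.
move=> Uu; apply/rowP => a; rewrite !mxE /partial.
by rewrite derive_mxE //; exact: derivable_smooth.
Qed.

Lemma derive_jac u v : U u -> 'D_v X u = v *m jac X u.
Proof.
move=> Uu; apply/rowP => a; rewrite derive_mxE; last exact: derivable_smooth.
rewrite derive_sum_partial; last exact: (smooth_differentiable oU (sX 0 a) Uu).
by rewrite mxE; apply: eq_bigr => i _; rewrite mxE.
Qed.

Lemma jacobian_jac u : U u -> 'J X u = jac X u.
Proof.
move=> Uu; apply/row_matrixP => i; rewrite row_jac // rowE -deriveEjacobian //.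
exact: differentiable_smooth.
Qed.

(** Symmetry of second derivatives, contracted with two vectors: the form in
    which it gives the symmetry of the shape operator and the Codazzi
    equation. *)
Lemma hess_sym u (Y V : 'rV[R]_n) : U u -> Y *m 'D_V (jac X) u = V *m 'D_Y (jac X) u.
Proof.
move=> Uu; have dJ v : derivable (jac X) u v by exact: (msmooth_derivable oU msmooth_jac Uu).
have E (A B : 'rV[R]_n) a : (A *m 'D_B (jac X) u) 0 a =
    \sum_i \sum_j A 0 i * B 0 j * partial j (partial i (fun v => X v 0 a)) u.
  rewrite mxE; apply: eq_bigr => i _; rewrite derive_mxE //.
  have -> : (fun v => jac X v i a) = partial i (fun v => X v 0 a).
    by apply/funext => v; rewrite mxE.
  rewrite derive_sum_partial; last first.
    exact: (smooth_differentiable oU (smooth_partial i (sX 0 a)) Uu).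
  by rewrite mulr_sumr; apply: eq_bigr => j _; rewrite mulrA.
apply/rowP => a.
transitivity (\sum_i \sum_j V 0 i * Y 0 j * partial j (partial i (fun v => X v 0 a)) u); last exact/esym/E.
rewrite E.
rewrite exchange_big.
apply: eq_bigr => i _; apply: eq_bigr => j _.
by rewrite [Y 0 j * _]mulrC (Schwarz i j oU Uu (sX 0 a 2)).
Qed.

End Jac.

(** * The shape operator and the Laplacian in a chart *)

Section Chart.
Context {R : realType} (c : R) (m : nat).
Hypothesis hc : c \in [:: -1; 0; 1].
Variables (U : set 'rV[R]_m.+1) (X N : 'rV[R]_m.+1 -> 'rV[R]_m.+2).
Hypothesis oU : open U.
Hypothesis sX : smooth U X.
Hypothesis sN : smooth U N.
Hypothesis domX : X @` U `<=` space_dom c m.+2.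
Hypothesis immX : forall u, U u -> row_free ('J X u).
Local Notation g := (space_metric c m.+2).
Hypothesis unitN : forall u, U u -> inner g (X u) (N u) (N u) = 1.
Hypothesis normN : forall u i, U u -> inner g (X u) (N u) (partial i X u) = 0.

Let sX' : msmooth U X := smooth_msmooth oU sX.
Let sN' : msmooth U N := smooth_msmooth oU sN.

Definition conf_at (u : 'rV[R]_m.+1) : R := conf c (X u).
(** The conformal change of the metric adds this multiple of the identity to the
    Euclidean shape operator. *)
Definition conf_shift (u : 'rV[R]_m.+1) : R := c / 2 * dotr (X u) (N u) / conf_at u.
Definition gram_mx (u : 'rV[R]_m.+1) : 'M[R]_m.+1 := jac X u *m (jac X u)^T.
(** The transpose of the matrix of the Weingarten operator, by [weingartenE]: it
    acts on rows of coefficients by multiplication on the right. *)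
Definition shape_mx (u : 'rV[R]_m.+1) : 'M[R]_m.+1 :=
  (conf_shift u)%:M - jac N u *m (jac X u)^T *m invmx (gram_mx u).
Definition unit_normal (u : 'rV[R]_m.+1) : 'rV[R]_m.+2 := (conf_at u)^-1 *: N u.

Lemma conf_at_gt0 u : U u -> 0 < conf_at u.
Proof. by move=> Uu; apply: conf_gt0 => //; apply: domX; exists u. Qed.

Lemma conf_at_neq0 u : U u -> conf_at u != 0.
Proof. by move=> Uu; rewrite gt_eqF // conf_at_gt0. Qed.

Lemma jac_free u : U u -> row_free (jac X u).
Proof. by move=> Uu; rewrite -(jacobian_jac oU sX' Uu); exact: immX. Qed.

Lemma gram_mx_unit u : U u -> gram_mx u \in unitmx.
Proof. by move=> Uu; apply: gram_unit; exact: jac_free. Qed.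

Lemma gram_mx_tr u : (gram_mx u)^T = gram_mx u.
Proof. by rewrite /gram_mx trmx_mul trmxK. Qed.

Lemma dot_normal u i : U u -> dotr (N u) (partial i X u) = 0.
Proof.
move=> Uu; have := normN i Uu; rewrite innerE => /eqP.
rewrite mulf_eq0 invr_eq0 expf_eq0 /= -/(conf_at u) (negbTE (conf_at_neq0 Uu)) /=.
by move/eqP.
Qed.

Lemma normal_jac u : U u -> N u *m (jac X u)^T = 0.
Proof.
move=> Uu; apply/rowP => j; rewrite mulmx_trE row_id (row_jac oU sX' j Uu) mxE.
exact: dot_normal.
Qed.

Lemma dot_unit u : U u -> dotr (N u) (N u) = (conf_at u) ^+ 2.
Proof.
move=> Uu; have := unitN Uu; rewrite innerE -/(conf_at u) => E.
by rewrite -[LHS]mul1r -(@divff _ (conf_at u ^+ 2)) ?expf_neq0 ?conf_at_neq0 // -mulrA E mulr1.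
Qed.

Lemma smooth_dotr (A B : 'rV[R]_m.+1 -> 'rV[R]_m.+2) : msmooth U A -> msmooth U B ->
  smooth U (fun u => dotr (A u) (B u)).
Proof. by move=> sA sB; apply: smooth_sum => // i _; exact: smooth_mul. Qed.

Lemma smooth_conf_at : smooth U conf_at.
Proof.
apply: smooth_add => //; first exact: smooth_cst.
by apply: smooth_mul => //; [exact: smooth_cst | exact: smooth_dotr].
Qed.

Lemma smooth_conf_atV : smooth U (fun u => (conf_at u)^-1).
Proof. by apply: smooth_inv => //; [exact: conf_at_neq0 | exact: smooth_conf_at]. Qed.

Lemma smooth_conf_shift : smooth U conf_shift.
Proof.
apply: smooth_mul => //; last exact: smooth_conf_atV.
by apply: smooth_mul => //; [exact: smooth_cst | exact: smooth_dotr].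
Qed.

Lemma msmooth_gram_mx : msmooth U gram_mx.
Proof.
by apply: msmooth_mulmx => //; [|apply: msmooth_tr => //]; exact: msmooth_jac.
Qed.

Lemma msmooth_gram_mxV : msmooth U (fun u => invmx (gram_mx u)).
Proof. by apply: msmooth_inv => //; [exact: gram_mx_unit | exact: msmooth_gram_mx]. Qed.

Lemma msmooth_shape_mx : msmooth U shape_mx.
Proof.
apply: msmooth_add => //; first exact: msmooth_scalar smooth_conf_shift.
apply: msmooth_opp => //; apply: msmooth_mulmx => //; last exact: msmooth_gram_mxV.
by apply: msmooth_mulmx => //; [|apply: msmooth_tr => //]; exact: msmooth_jac.
Qed.

Lemma msmooth_unit_normal : msmooth U unit_normal.
Proof. by apply: msmooth_scale => //; exact: smooth_conf_atV. Qed.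

Lemma induced_metricE u : U u -> induced_metric g X u = (conf_at u) ^- 2 *: gram_mx u.
Proof.
move=> Uu; apply/matrixP => i j; rewrite !mxE innerE -/(conf_at u); congr (_ * _).
by rewrite -!(row_jac oU sX' _ Uu) -mulmx_trE mxE.
Qed.

Lemma invmx_induced u : U u -> invmx (induced_metric g X u) = (conf_at u) ^+ 2 *: invmx (gram_mx u).
Proof.
move=> Uu; rewrite induced_metricE // invmxZ ?invrK //.
by rewrite unitmxZ ?gram_mx_unit // unitfE invr_eq0 expf_neq0 // conf_at_neq0.
Qed.

Lemma inner_cov u j k : U u ->
  inner g (X u) (cov_deriv g X N j u) (partial k X u) =
  (conf_at u) ^- 2 * ((jac N u *m (jac X u)^T) j k - conf_shift u * gram_mx u j k).
Proof.
move=> Uu; have Dx : space_dom c m.+2 (X u) by apply: domX; exists u.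
rewrite innerE -/(conf_at u); congr (_ * _).
rewrite cov_derivE // -/(conf_at u) !(mulmx_trE, dotrDl, dotrNl, dotrZl).
rewrite !(row_jac oU sX' _ Uu, row_jac oU sN' _ Uu) dot_normal //.
rewrite [dotr (partial j X u) (N u)]dotrC dot_normal //.
rewrite mulr0 mul0r add0r subr0 mulrA; congr (_ - _ * _).
by rewrite /conf_shift mulrAC.
Qed.

Lemma weingartenE u : U u -> weingarten g X (cov_deriv g X N) u = (shape_mx u)^T.
Proof.
move=> Uu; rewrite /weingarten invmx_induced //.
set M := (\matrix_(k, j) _).
have -> : M = (conf_at u) ^- 2 *: (conf_shift u *: gram_mx u - jac X u *m (jac N u)^T).
  apply/matrixP => k j; rewrite !mxE inner_cov // !mxE.
  rewrite -mulrN opprB; congr (_ * (_ * _ - _)).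
    by apply: eq_bigr => a _; rewrite mulrC !mxE mulrC.
  by apply: eq_bigr => a _; rewrite mulrC !mxE.
rewrite -scalemxAl -scalemxAr scalerA divff ?expf_neq0 ?conf_at_neq0 // scale1r.
rewrite mulmxBr -scalemxAr mulVmx ?gram_mx_unit // /shape_mx linearB /= tr_scalar_mx.
by rewrite !trmx_mul trmxK trmx_inv gram_mx_tr scalemx1.
Qed.

(** Differentiating the orthogonality of [N] to the coordinate vectors shows
    that the entries are, up to sign, products of [N] with second derivatives
    of [X]. *)
Lemma second_form_sym u : U u -> jac N u *m (jac X u)^T = jac X u *m (jac N u)^T.
Proof.
move=> Uu.
have D (v : 'rV[R]_m.+1) : 'D_v N u *m (jac X u)^T + N u *m ('D_v (jac X) u)^T = 0.
  have dJ := msmooth_derivable oU (v := v) (msmooth_jac oU sX') Uu.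
  have [dT ET] := derive_trmx dJ.
  have [dM EM] := derivable_mulmx (msmooth_derivable oU (v := v) sN' Uu) dT.
  rewrite -ET -EM.
  rewrite (near_eq_derive (g := cst 0)) ?derive_cst //.
  by apply: filterS (open_nbhs_nbhs (conj oU Uu)) => y; exact: normal_jac.
have E i j : (jac N u *m (jac X u)^T) i j =
    - dotr (N u) (delta_mx 0 j *m 'D_(delta_mx 0 i) (jac X) u).
  have /matrixP/(_ 0 j) := D (delta_mx 0 i).
  have -> : 'D_(delta_mx 0 i) N u = row i (jac N u) by rewrite (row_jac oU sN' i Uu).
  rewrite mxE [RHS]mxE !mulmx_trE !row_id => /eqP.
  by rewrite addr_eq0 => /eqP ->; rewrite -rowE.
rewrite -[RHS]trmxK trmx_mul trmxK; apply/matrixP => i j.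
by rewrite E [RHS]mxE E (hess_sym oU sX' _ _ Uu).
Qed.

Lemma shape_mx_selfadj u : U u -> shape_mx u *m gram_mx u = gram_mx u *m (shape_mx u)^T.
Proof.
move=> Uu; rewrite -[RHS]trmxK trmx_mul trmxK gram_mx_tr.
rewrite /shape_mx mulmxBl mulmxKV ?gram_mx_unit // linearB /= mul_scalar_mx linearZ /= gram_mx_tr.
by rewrite trmx_mul trmxK second_form_sym.
Qed.

(** The Weingarten operator is its own adjoint, so the squared norm of its
    trace-free part is a polynomial in traces of powers. *)
Lemma phi2E u : U u ->
  endo_norm2 (induced_metric g X u) (umbilicity (weingarten g X (cov_deriv g X N) u))
  = \tr (shape_mx u *m shape_mx u) - (\tr (shape_mx u)) ^+ 2 / m.+1%:R.
Proof.
move=> Uu; rewrite weingartenE // /endo_norm2 /umbilicity mxtrace_tr.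
set tau := _ / _; rewrite invmx_induced // induced_metricE //.
rewrite -!scalemxAl -!scalemxAr !scalerA divff ?expf_neq0 ?conf_at_neq0 // scale1r.
have -> : invmx (gram_mx u) *m ((shape_mx u)^T - tau%:M)^T *m gram_mx u = (shape_mx u)^T - tau%:M.
  rewrite linearB /= trmxK tr_scalar_mx -mulmxA mulmxBl shape_mx_selfadj // mulmxBr.
  by rewrite mulKmx ?gram_mx_unit // mul_scalar_mx -scalemxAr mulVmx ?gram_mx_unit // scalemx1.
rewrite -raddfN mxtrace_sq_shift -trmx_mul !mxtrace_tr.
have n0 : m.+1%:R != 0 :> R by rewrite pnatr_eq0.
rewrite (_ : \tr (shape_mx u) = tau * m.+1%:R); last by rewrite /tau divfK.
by field.
Qed.

Lemma smooth_phi2 : smooth U (fun u =>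
  endo_norm2 (induced_metric g X u) (umbilicity (weingarten g X (cov_deriv g X N) u))).
Proof.
apply: (smooth_ext oU (f := fun u => \tr (shape_mx u *m shape_mx u) - (\tr (shape_mx u)) ^+ 2 / m.+1%:R)).
  by move=> u Uu; rewrite phi2E.
have st := smooth_mxtrace oU msmooth_shape_mx.
apply: smooth_add => //.
  apply: smooth_mxtrace => //.
  by apply: msmooth_mulmx => //; exact: msmooth_shape_mx.
apply: smooth_opp => //; apply: smooth_mul => //; last exact: smooth_cst.
exact: smooth_mul.
Qed.

(** The norm is the Frobenius norm of the operator of the ambient space that
    acts as [T] on tangent vectors and kills the normal; hence it is
    definite. *)
Lemma endo_norm2E u (T : 'M[R]_m.+1) : U u ->
  endo_norm2 (induced_metric g X u) T =
  \tr (((jac X u)^T *m T *m invmx (gram_mx u) *m jac X u) *m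
       ((jac X u)^T *m T *m invmx (gram_mx u) *m jac X u)^T).
Proof.
move=> Uu; rewrite /endo_norm2 invmx_induced // induced_metricE //.
rewrite -!scalemxAl -!scalemxAr !scalerA divff ?expf_neq0 ?conf_at_neq0 // scale1r.
rewrite 3!trmx_mul trmxK trmx_inv gram_mx_tr -!mulmxA (mulmxA (jac X u) (jac X u)^T) -/(gram_mx u).
rewrite mulKmx ?gram_mx_unit // [RHS]mxtrace_mulC !mulmxA; congr (\tr _).
Qed.

Lemma endo_norm2_ge0 u (T : 'M[R]_m.+1) : U u -> 0 <= endo_norm2 (induced_metric g X u) T.
Proof. by move=> Uu; rewrite endo_norm2E // mxtrace_gram_ge0. Qed.

Lemma endo_norm2_eq0 u (T : 'M[R]_m.+1) : U u ->
  endo_norm2 (induced_metric g X u) T = 0 -> T = 0.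
Proof.
move=> Uu; rewrite endo_norm2E // => /mxtrace_gram_eq0 E.
have : jac X u *m ((jac X u)^T *m T *m invmx (gram_mx u) *m jac X u) *m (jac X u)^T = 0.
  by rewrite E mulmx0 mul0mx.
rewrite -!mulmxA -/(gram_mx u) mulVmx ?gram_mx_unit // mulmx1 mulmxA -/(gram_mx u) => H.
by rewrite -(mulKmx (gram_mx_unit Uu) T) H mulmx0.
Qed.

Lemma phi2_eq0 u : U u ->
  endo_norm2 (induced_metric g X u) (umbilicity (weingarten g X (cov_deriv g X N) u)) = 0 ->
  shape_mx u = (\tr (shape_mx u) / m.+1%:R)%:M.
Proof.
move=> Uu /(endo_norm2_eq0 Uu); rewrite weingartenE // /umbilicity mxtrace_tr.
by move/subr0_eq => E; rewrite -[LHS]trmxK E tr_scalar_mx.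
Qed.

Lemma derive_unit_normal u v : U u -> exists a : R,
  'D_v unit_normal u = a *: N u + (conf_at u)^-1 *: 'D_v N u.
Proof.
move=> Uu; have d1 := smooth_derivable oU (v := v) smooth_conf_atV Uu.
have d2 := msmooth_derivable oU (v := v) sN' Uu.
by exists ('D_v (fun u => (conf_at u)^-1) u); rewrite (derive_scalemx d1 d2).2.
Qed.

Lemma jac_unit_normal_tangent u : U u ->
  conf_at u *: jac unit_normal u *m (jac X u)^T = jac N u *m (jac X u)^T.
Proof.
move=> Uu; apply/row_matrixP => i; rewrite !row_mul linearZ /=.
have -> : row i (jac unit_normal u) = 'D_(delta_mx 0 i) unit_normal u.
  by rewrite (row_jac oU msmooth_unit_normal i Uu).
have [a ->] := derive_unit_normal (delta_mx 0 i) Uu.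
rewrite -scalemxAl mulmxDl -scalemxAl normal_jac // scaler0 add0r -scalemxAl.
by rewrite scalerA divff ?conf_at_neq0 // scale1r (row_jac oU sN' i Uu).
Qed.

Lemma unit_normal_unit u : U u -> unit_normal u *m (unit_normal u)^T = 1%:M.
Proof.
move=> Uu; apply/matrixP => i j; rewrite !ord1 dotrE /unit_normal dotrZl dotrZr dot_unit // !mxE /=.
by field; rewrite conf_at_neq0.
Qed.

Lemma jac_unit_normal_normal u : U u -> jac unit_normal u *m (unit_normal u)^T = 0.
Proof.
move=> Uu; apply/row_matrixP => i; rewrite row_mul row0.
have -> : row i (jac unit_normal u) = 'D_(delta_mx 0 i) unit_normal u.
  by rewrite (row_jac oU msmooth_unit_normal i Uu).
set v := delta_mx 0 i; have d := msmooth_derivable oU (v := v) msmooth_unit_normal Uu.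
have [dT ET] := derive_trmx d.
have [_ EM] := derivable_mulmx d dT.
have E0 : 'D_v (fun y => unit_normal y *m (unit_normal y)^T) u = 0.
  rewrite (near_eq_derive (g := cst 1%:M)) ?derive_cst //.
  by apply: filterS (open_nbhs_nbhs (conj oU Uu)) => y; exact: unit_normal_unit.
move: EM; rewrite E0 ET => EM.
apply/matrixP => a b; rewrite !ord1 dotrE [RHS]mxE.
have /matrixP/(_ 0 0) := EM; rewrite mxE [in RHS]mxE !dotrE [dotr (unit_normal u) _]dotrC.
by move=> H; lra.
Qed.

(** Weingarten's formula for the normal of Euclidean length 1. Both sides have
    the same products with tangent vectors, by definition of [shape_mx], and
    with the normal, as the derivatives of a unit field are orthogonal to
    it. *)
Lemma weingarten_eq u : U u ->
  shape_mx u *m jac X u = conf_shift u *: jac X u - conf_at u *: jac unit_normal u.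
Proof.
move=> Uu; rewrite /shape_mx mulmxBl mul_scalar_mx; congr (_ - _).
apply: subr0_eq; apply: (hyperplane_complement (jac_free Uu) (v := unit_normal u)).
- by apply/eqP => E; have := unit_normal_unit Uu; rewrite E mul0mx => /matrixP/(_ 0 0)/eqP;
    rewrite !mxE /= eq_sym oner_eq0.
- by rewrite /unit_normal -scalemxAl normal_jac // scaler0.
- rewrite mulmxBl -!mulmxA -/(gram_mx u) mulVmx ?gram_mx_unit // mulmx1 jac_unit_normal_tangent //.
  by rewrite subrr.
- rewrite mulmxBl -scalemxAl jac_unit_normal_normal // scaler0 subr0 -!mulmxA.
  have -> : jac X u *m (unit_normal u)^T = 0.
    by rewrite -[LHS]trmxK trmx_mul trmxK /unit_normal -scalemxAl normal_jac // scaler0 trmx0.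
  by rewrite !mulmx0.
Qed.

Lemma msmooth_metric : msmooth U (induced_metric g X).
Proof.
have sr2 : smooth U (fun u => (conf_at u) ^- 2).
  apply: (smooth_ext oU (f := fun u => (conf_at u)^-1 * (conf_at u)^-1)).
    by move=> u _; rewrite -invfM expr2.
  by apply: smooth_mul => //; exact: smooth_conf_atV.
move=> i j; apply: (smooth_ext oU _ (msmooth_scale oU sr2 msmooth_gram_mx i j)) => u Uu.
by rewrite induced_metricE.
Qed.

Lemma metric_unit u : U u -> induced_metric g X u \in unitmx.
Proof.
move=> Uu; rewrite induced_metricE // unitmxZ ?gram_mx_unit //.
by rewrite unitfE invr_eq0 expf_neq0 // conf_at_neq0.
Qed.

Lemma smooth_christoffel i j k : smooth U (christoffel (induced_metric g X) i j k).
Proof.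
apply: smooth_mul => //; first exact: smooth_cst.
apply: smooth_sum => // l _; apply: smooth_mul => //.
  by apply: msmooth_inv => //; [exact: metric_unit | exact: msmooth_metric].
have sp a b d : smooth U (partial a (fun y => induced_metric g X y b d)).
  exact/smooth_partial/msmooth_metric.
by apply: smooth_add => //; [exact: smooth_add | exact: smooth_opp].
Qed.

Definition laplacian_drift (u : 'rV[R]_m.+1) : 'rV[R]_m.+1 :=
  \row_k - (\sum_i \sum_j invmx (induced_metric g X u) i j *
              christoffel (induced_metric g X) j i k u).

Lemma laplacian_elliptic (f : 'rV[R]_m.+1 -> R) u :
  laplacian (induced_metric g X) f u =
  elliptic_op (fun u => (invmx (induced_metric g X u))^T) laplacian_drift f u.
Proof.
rewrite /laplacian /elliptic_op /hessian mxtrace_hessian; congr (_ + _).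
by apply: eq_bigr => k _; rewrite [laplacian_drift u 0 k]mxE.
Qed.

(** This factorization expresses that the Laplacian is elliptic. *)
Lemma metric_inv_gram u : U u ->
  exists p, exists2 Q : 'M[R]_(m.+1, p),
    (invmx (induced_metric g X u))^T = Q *m Q^T & row_free Q.
Proof.
move=> Uu; exists m.+2; exists (conf_at u *: (invmx (gram_mx u) *m jac X u)).
  rewrite invmx_induced // linearZ /= trmx_inv gram_mx_tr linearZ /= -scalemxAl -scalemxAr scalerA.
  rewrite -expr2; congr (_ *: _).
  by rewrite trmx_mul trmx_inv gram_mx_tr mulmxA -(mulmxA (invmx _)) -/(gram_mx u) mulVmx ?gram_mx_unit // mul1mx.
rewrite /row_free mxrank_scale_nz ?conf_at_neq0 // mxrankMfree; last exact: jac_free.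
by rewrite mxrank_unit // unitmx_inv gram_mx_unit.
Qed.

Lemma subharmonic_strong_maximum (W : set 'rV[R]_m.+1) (f : 'rV[R]_m.+1 -> R) M u :
  open W -> W `<=` U -> W u -> smooth U f ->
  (forall v, W v -> 0 <= laplacian (induced_metric g X) f v) ->
  (forall v, W v -> f v <= M) -> f u = M -> nbhs u [set v | f v = M].
Proof.
move=> oW WU Wu sf Lf fM fu.
apply: (@strong_maximum R _ W (fun u => (invmx (induced_metric g X u))^T) laplacian_drift f M u) => //.
- exact: dupto_sub WU (sf 2).
- by move=> v /WU; exact: metric_inv_gram.
- move=> v i j /WU Uv; apply: (smooth_continuous _ Uv).
  apply: msmooth_tr => //; apply: msmooth_inv => //.
    exact: metric_unit.
  exact: msmooth_metric.
- move=> v k /WU Uv; apply: (smooth_continuous _ Uv).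
  apply: (smooth_ext oU (f := fun u => - (\sum_i \sum_j invmx (induced_metric g X u) i j *
              christoffel (induced_metric g X) j i k u))); first by move=> w _; rewrite mxE.
  apply: smooth_opp => //; apply: smooth_sum => // i _; apply: smooth_sum => // j _.
  apply: smooth_mul => //; last exact: smooth_christoffel.
  by apply: msmooth_inv => //; [exact: metric_unit | exact: msmooth_metric].
- by move=> v Wv; rewrite -laplacian_elliptic; exact: Lf.
Qed.

End Chart.

(** * Derivatives at boundary points of a half-space *)

Section TangentialDerivative.
Context {R : realType} (m : nat) (U : set 'rV[R]_m.+1).
Hypothesis oU : open U.

Lemma derive_boundary0 (W : normedModType R) (f : 'rV[R]_m.+1 -> W) u (Y : 'rV[R]_m.+1) :
  U u -> u 0 ord0 = 0 -> Y 0 ord0 = 0 -> derivable f u Y ->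
  (forall v, U v -> v 0 ord0 = 0 -> f v = 0) -> 'D_Y f u = 0.
Proof.
move=> Uu u0 Y0 df H.
have [e e0 He] := nearE_ball (open_nbhs_nbhs (conj oU Uu)).
have d0 : derivable f (u + 0 *: Y) Y by rewrite scale0r addr0.
have [_ E] := derive_line d0.
rewrite scale0r addr0 in E; rewrite -E.
rewrite (near_eq_derive (g := cst 0)) ?derive_cst //.
have e1 : 0 < e / (`|Y| + 1) by rewrite divr_gt0 // ltr_wpDl.
apply/nbhs_ballP; exists (e / (`|Y| + 1)) => // t; rewrite -ball_normE /= sub0r normrN => te.
apply: H; last by rewrite !mxE u0 Y0 mulr0 addr0.
apply: He; rewrite normrZ; apply: (@le_lt_trans _ _ (`|t| * (`|Y| + 1))).
  by rewrite ler_wpM2l // lerDl.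
by rewrite -ltr_pdivlMr // ltr_wpDl.
Qed.

Lemma half_space_line u (w : 'rV[R]_m.+1) : U u -> u 0 ord0 = 0 -> 0 <= w 0 ord0 ->
  exists2 d : R, 0 < d & forall t, 0 < t < d ->
    U (u + t *: w) /\ 0 <= (u + t *: w) 0 ord0.
Proof.
move=> Uu u0 w0.
have [e e0 He] := nearE_ball (open_nbhs_nbhs (conj oU Uu)).
exists (e / (`|w| + 1)); first by rewrite divr_gt0 // ltr_wpDl.
move=> t /andP[t0 te]; split; last by rewrite !mxE u0 add0r mulr_ge0 // ltW.
apply: He; rewrite normrZ gtr0_norm //; apply: (@le_lt_trans _ _ (t * (`|w| + 1))).
  by rewrite ler_pM2l // lerDl.
by rewrite -ltr_pdivlMr // ltr_wpDl.
Qed.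

Lemma derive_half_space_le (f : 'rV[R]_m.+1 -> R) u (w : 'rV[R]_m.+1) : U u -> u 0 ord0 = 0 ->
  0 <= w 0 ord0 -> derivable f u w ->
  (forall v, U v -> 0 <= v 0 ord0 -> f v <= f u) -> 'D_w f u <= 0.
Proof.
move=> Uu u0 w0 df H; apply: derive_le0_right => //.
have [d d0 Hd] := half_space_line Uu u0 w0.
by exists d => // t /Hd[Ut t0]; exact: H.
Qed.

(** Derivatives in directions that do not leave the half-space vanish by
    hypothesis, the others by linearity. *)
Lemma derive_half_space_cst (f : 'rV[R]_m.+1 -> R) u (w : 'rV[R]_m.+1) : U u -> u 0 ord0 = 0 ->
  differentiable f u ->
  (forall v, U v -> 0 <= v 0 ord0 -> f v = f u) -> 'D_w f u = 0.
Proof.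
move=> Uu u0 df H.
have key (v : 'rV[R]_m.+1) : 0 <= v 0 ord0 -> 'D_v f u = 0.
  move=> v0; apply/eqP; rewrite eq_le; apply/andP; split.
    apply: derive_half_space_le => //; first exact: diff_derivable.
    by move=> x Ux x0; rewrite H.
  rewrite -oppr_le0 -deriveN; last exact: diff_derivable.
  apply: derive_half_space_le => //; first exact/derivableN/diff_derivable.
  by move=> x Ux x0; rewrite /GRing.opp /= H.
have [w0|w0] := leP 0 (w 0 ord0); first exact: key.
have : 'D_(- w) f u = 0 by apply: key; rewrite mxE oppr_ge0 ltW.
by rewrite !deriveE // linearN => /eqP; rewrite oppr_eq0 => /eqP.
Qed.

End TangentialDerivative.

(** * The Codazzi equation along the boundary *)

(** The algebraic part of [codazzi_boundary]. The first two hypotheses are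
    derivatives of Weingarten's formula along [V] and along [Y]; the second
    derivatives [Q] of the normal are common to both by symmetry and cancel.
    The others differentiate identities that hold along the boundary. *)
Lemma codazzi_algebra (R : comNzRingType) n p (Y V : 'rV[R]_n) (J DJv DJy : 'M[R]_(n, p))
    (B L DBv DBy : 'M[R]_n) (Q : 'rV[R]_p) (la kp rho dl : R) :
  Y *m (DBv *m J + B *m DJv) =
    - (la * kp) *: (Y *m J) + kp *: (Y *m B *m J) - rho *: Q ->
  V *m (DBy *m J + B *m DJy) = - rho *: Q ->
  Y *m B *m DJv = Y *m B *m J - Y *m B *m L *m J ->
  V *m DJy = Y *m J - Y *m L *m J ->
  V *m DBy = dl *: V + la *: (Y *m L) - Y *m L *m B ->
  V *m B = la *: V ->
  Y *m DBv *m J =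
  ((kp - 1) *: (Y *m (B + (- la)%:M)) + Y *m (B + (- la)%:M) *m L
     - Y *m L *m (B + (- la)%:M) + dl *: V) *m J.
Proof.
move=> h1 h2 h3 h4 h5 h6.
have e1 : Y *m DBv *m J = - (la * kp) *: (Y *m J) + kp *: (Y *m B *m J) - rho *: Q
    - (Y *m B *m J - Y *m B *m L *m J).
  by rewrite -h1 -h3 mulmxDr !mulmxA addrK.
have e2 : rho *: Q = - (dl *: (V *m J) + la *: (Y *m L *m J) - Y *m L *m B *m J
    + la *: (Y *m J - Y *m L *m J)).
  apply: oppr_inj; rewrite opprK -scaleNr -h2 mulmxDr !mulmxA h5 h6 -scalemxAl h4.
  by rewrite mulmxBl mulmxDl -!scalemxAl.
rewrite e1 e2 !mulmxDr !mul_mx_scalar !mulmxDl mulNmx mulmxDl -!scalemxAl.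
rewrite ?mulmxDl -?scalemxAl.
move: (Y *m J) (Y *m B *m J) (Y *m B *m L *m J) (Y *m L *m B *m J) (Y *m L *m J) (V *m J).
move=> a1 a2 a3 a4 a5 a6; apply/rowP => i; rewrite !mxE; ring.
Qed.

(** The terms in [L] cancel under the trace. *)
Lemma codazzi_rows (R : comNzRingType) n (T L D : 'M[R]_n) (dl : 'cV[R]_n) (V : 'rV[R]_n) (a : R) :
  (forall i, row i T *m D = a *: (row i T *m T) + row i T *m T *m L
     - row i T *m L *m T + row i T *m dl *m V) ->
  \tr (T *m D) = a * \tr (T *m T) + \tr (V *m T *m dl).
Proof.
move=> H.
have -> : T *m D = a *: (T *m T) + T *m T *m L - T *m L *m T + T *m dl *m V.
  apply/row_matrixP => i; rewrite row_mul H !rowE !mulmxDr mulmxN -scalemxAr.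
  by rewrite !mulmxA.
have trN (A : 'M[R]_n) : \tr (- A) = - \tr A by rewrite raddfN.
rewrite !mxtraceD mxtraceZ trN (mxtrace_mulC (T *m L) T) mulmxA addrK.
by congr (_ + _); rewrite mxtrace_mulC mulmxA.
Qed.

Section BoundaryDerivative.
Context {R : realType} (c r : R) (m : nat) (U : set 'rV[R]_m.+1).
Hypothesis oU : open U.
Variables (X E0 : 'rV[R]_m.+1 -> 'rV[R]_m.+2) (B : 'rV[R]_m.+1 -> 'M[R]_m.+1).
Variables (rho s : 'rV[R]_m.+1 -> R).
Hypothesis sX : msmooth U X.
Hypothesis sE0 : msmooth U E0.
Hypothesis sB : msmooth U B.
Hypothesis srho : smooth U rho.
Hypothesis ss : smooth U s.
Hypothesis Jfree : forall u, U u -> row_free (jac X u).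
Hypothesis EJ : forall u, U u -> E0 u *m (jac X u)^T = 0.
Hypothesis E1 : forall u, U u -> E0 u != 0.
Hypothesis rhoE : forall u, U u -> rho u = conf c (X u).
Hypothesis rho0 : forall u, U u -> rho u != 0.
Hypothesis sE : forall u, U u -> s u = c / 2 * dotr (X u) (E0 u).
Hypothesis wein : forall u, U u ->
  B u *m jac X u = s u *: jac X u - rho u *: jac E0 u.
Hypothesis Bsym : forall u, U u -> B u *m gram_mx X u = gram_mx X u *m (B u)^T.
Hypothesis r0 : 0 < r.
Hypothesis bX : forall u, U u -> u 0 ord0 = 0 -> dotr (X u) (X u) = r ^+ 2.
Hypothesis bE : forall u, U u -> u 0 ord0 = 0 -> dotr (E0 u) (X u) = 0.

Let J := jac X.
Let G := gram_mx X.
(** The tangential part of the position vector; on the boundary it is all of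
    it, by [radial_jac]. *)
Definition radial (u : 'rV[R]_m.+1) : 'rV[R]_m.+1 := X u *m (jac X u)^T *m invmx (gram_mx X u).
(** A smooth extension of the principal curvature of the radial direction, which
    is an eigenvector on the boundary by [radial_eigen]. *)
Definition radial_eigenvalue (u : 'rV[R]_m.+1) : R :=
  dotr (radial u *m B u *m jac X u) (X u) / r ^+ 2.
Let V := radial.
Let lam := radial_eigenvalue.
Let L := jac V.

Let Gu u : U u -> G u \in unitmx.
Proof. by move=> Uu; apply: gram_unit; exact: Jfree. Qed.

Let sJ : msmooth U J := msmooth_jac oU sX.

Let sV : msmooth U V.
Proof.
apply: msmooth_mulmx => //; first by apply: msmooth_mulmx => //; exact: msmooth_tr.
apply: msmooth_inv => //; apply: msmooth_mulmx => //; exact: msmooth_tr.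
Qed.

Let slam : smooth U lam.
Proof.
apply: smooth_mul => //; last exact: smooth_cst.
apply: smooth_sum => // i _; apply: smooth_mul => //.
by apply: msmooth_mulmx => //; apply: msmooth_mulmx.
Qed.

Let dv p q (A : 'rV[R]_m.+1 -> 'M[R]_(p, q)) u v : msmooth U A -> U u -> derivable A u v.
Proof. exact: msmooth_derivable. Qed.

Let r2 : r ^+ 2 != 0. Proof. by rewrite expf_neq0 // gt_eqF. Qed.

Lemma s_boundary u : U u -> u 0 ord0 = 0 -> s u = 0.
Proof. by move=> Uu u0; rewrite sE // dotrC bE // mulr0. Qed.

(** On the boundary the position vector is orthogonal to the normal of the
    hypersurface, that is, tangent to it. *)
Lemma radial_jac u : U u -> u 0 ord0 = 0 -> V u *m J u = X u.
Proof.
move=> Uu u0; apply: subr0_eq.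
apply: (hyperplane_complement (Jfree Uu) (v := E0 u)) => //.
- exact: E1.
- exact: EJ.
- by rewrite mulmxBl -mulmxA -/(gram_mx X u) mulmxKV ?Gu // subrr.
- rewrite mulmxBl -mulmxA.
  have -> : J u *m (E0 u)^T = 0.
    by rewrite -[LHS]trmxK trmx_mul trmxK EJ // trmx0.
  rewrite mulmx0 sub0r; apply/matrixP => i j.
  by rewrite mxE !ord1 dotrE dotrC bE // oppr0 mxE.
Qed.

Lemma dot_tangent_X u (Y : 'rV[R]_m.+1) : U u -> u 0 ord0 = 0 -> Y 0 ord0 = 0 ->
  dotr (Y *m J u) (X u) = 0.
Proof.
move=> Uu u0 Y0; have d := dv (v := Y) sX Uu.
have [dT ET] := derive_trmx d; have [dM EM] := derivable_mulmx d dT.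
have H v : U v -> v 0 ord0 = 0 -> X v *m (X v)^T - (r ^+ 2)%:M = 0.
  move=> Uv v0; apply/matrixP => i j.
  by rewrite mxE !ord1 dotrE bX // !mxE /= mulr1n subrr.
have := derive_boundary0 oU Uu u0 Y0 _ H.
have dc : derivable (fun _ : 'rV[R]_m.+1 => (r ^+ 2)%:M : 'M[R]_1) u Y.
  exact: (derivable_cst ((r ^+ 2)%:M : 'M[R]_1) u Y).
have [dB EB] := derive_subf dM dc.
move=> /(_ dB); rewrite EB derive_cst subr0 EM ET (derive_jac oU sX _ Uu) => /matrixP/(_ 0 0).
rewrite mxE [RHS]mxE !dotrE [dotr (X u) _]dotrC => ?; rewrite /J; lra.
Qed.

Lemma dot_tangent_E u (Y : 'rV[R]_m.+1) : U u -> u 0 ord0 = 0 -> Y 0 ord0 = 0 ->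
  dotr (Y *m jac E0 u) (X u) = 0.
Proof.
move=> Uu u0 Y0; have d := dv (v := Y) sX Uu; have dE := dv (v := Y) sE0 Uu.
have [dT ET] := derive_trmx d; have [dM EM] := derivable_mulmx dE dT.
have H v : U v -> v 0 ord0 = 0 -> E0 v *m (X v)^T = 0.
  by move=> Uv v0; apply/matrixP => i j; rewrite !ord1 dotrE bE // mxE.
have := derive_boundary0 oU Uu u0 Y0 dM H.
rewrite EM ET (derive_jac oU sX _ Uu) (derive_jac oU sE0 _ Uu).
rewrite trmx_mul mulmxA EJ // mul0mx addr0 => /matrixP/(_ 0 0).
by rewrite dotrE mxE.
Qed.

Lemma X_jac_delta u i : U u -> u 0 ord0 = 0 -> i != ord0 -> (X u *m (J u)^T) 0 i = 0.
Proof.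
move=> Uu u0 i0; rewrite mulmx_trE row_id dotrC rowE.
by apply: dot_tangent_X => //; rewrite mxE eqxx /= eq_sym (negbTE i0).
Qed.

(** Otherwise the position vector would be orthogonal to all tangent vectors and
    to the normal. *)
Lemma X_jac_delta0 u : U u -> u 0 ord0 = 0 -> (X u *m (J u)^T) 0 ord0 != 0.
Proof.
move=> Uu u0; apply/eqP => H.
have : X u = 0.
  apply: (hyperplane_complement (Jfree Uu) (v := E0 u)) => //.
  - exact: E1.
  - exact: EJ.
  - apply/rowP => i; rewrite [RHS]mxE.
    by have [->|i0] := eqVneq i ord0; [exact: H | exact: X_jac_delta].
  - by apply/matrixP => i j; rewrite !ord1 dotrE dotrC bE // mxE.
move=> X0; have := bX Uu u0; rewrite X0.
have /eqP -> : dotr (0 : 'rV[R]_m.+2) 0 == 0 by rewrite dotr_eq0.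
by move/esym/eqP; rewrite (negbTE r2).
Qed.

Lemma radial_G u : U u -> V u *m G u = X u *m (J u)^T.
Proof. by move=> Uu; rewrite /V /radial mulmxKV // Gu. Qed.

(** Along the boundary the derivatives of the normal are orthogonal to the
    position vector, as the normal itself is. So the shape operator preserves
    the tangent space of the boundary, and by symmetry its orthogonal
    complement, the radial line. *)
Lemma radial_eigen u : U u -> u 0 ord0 = 0 -> V u *m B u = lam u *: V u.
Proof.
move=> Uu u0; pose tau := (X u *m (J u)^T) 0 ord0.
have tau0 : tau != 0 := X_jac_delta0 Uu u0.
pose mu := (V u *m B u *m G u) 0 ord0.
have E : V u *m B u = (mu / tau) *: V u.
  have fr : row_free (G u) by rewrite row_free_unit Gu.
  apply: (row_free_inj fr); apply/rowP => i.
  rewrite -scalemxAl radial_G // [RHS]mxE.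
  have [->|i0] := eqVneq i ord0; first by rewrite -/mu -/tau divfK.
  rewrite X_jac_delta // mulr0 -mulmxA Bsym // mulmxA radial_G //.
  rewrite -mulmxA -trmx_mul wein // s_boundary // scale0r sub0r.
  rewrite mulmx_trE row_id dotrC linearN linearZ /= dotrNl dotrZl rowE.
  by rewrite dot_tangent_E ?mulr0 ?oppr0 // mxE eqxx /= eq_sym (negbTE i0).
have -> : lam u = mu / tau; last exact: E.
rewrite /lam /radial_eigenvalue -/(V u) E -scalemxAl dotrZl -/(J u) radial_jac // bX //.
by rewrite mulfK.
Qed.

Definition shifted (u : 'rV[R]_m.+1) : 'M[R]_m.+1 := B u + (- lam u)%:M.
Let T := shifted.

Lemma radial_shifted u : U u -> u 0 ord0 = 0 -> V u *m T u = 0.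
Proof.
move=> Uu u0; rewrite /T /shifted mulmxDr radial_eigen // mul_mx_scalar.
by rewrite scaleNr subrr.
Qed.

Lemma shifted_tangent u i : U u -> u 0 ord0 = 0 -> (T u) i ord0 = 0.
Proof.
move=> Uu u0; pose tau := (X u *m (J u)^T) 0 ord0.
have tau0 : tau != 0 := X_jac_delta0 Uu u0.
have Vd : V u *m G u = tau *: delta_mx 0 ord0.
  rewrite radial_G //; apply/rowP => j; rewrite !mxE eqxx /=.
  have [->|j0] := eqVneq j ord0; first by rewrite mulr1 /tau mxE.
  by rewrite mulr0; have := X_jac_delta Uu u0 j0; rewrite mxE.
have Tsym : T u *m G u = G u *m (T u)^T.
  rewrite /T /shifted linearD /= tr_scalar_mx mulmxDl mulmxDr Bsym //.
  by rewrite mul_scalar_mx mul_mx_scalar.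
have H : T u *m G u *m (V u)^T = 0.
  by rewrite Tsym -mulmxA -trmx_mul radial_shifted // trmx0 mulmx0.
have GV : G u *m (V u)^T = tau *: (delta_mx 0 ord0)^T.
  by rewrite -[G u]gram_mx_tr -trmx_mul -/(G u) Vd linearZ.
move: H; rewrite -mulmxA GV -scalemxAr => /eqP; rewrite scaler_eq0 (negbTE tau0) /=.
move/eqP/matrixP/(_ i 0); rewrite trmx_delta -colE !mxE.
by [].
Qed.

Section AtPoint.
Variable u : 'rV[R]_m.+1.
Hypothesis Uu : U u.
Hypothesis u0 : u 0 ord0 = 0.

Let kp := c / 2 * r ^+ 2 / rho u.

Lemma derive_radial_jac (Y : 'rV[R]_m.+1) : Y 0 ord0 = 0 ->
  V u *m 'D_Y J u = Y *m J u - Y *m L u *m J u.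
Proof.
move=> Y0.
have [dM EM] := derivable_mulmx (dv (v := Y) sV Uu) (dv (v := Y) sJ Uu).
have [dB EB] := derive_subf dM (dv (v := Y) sX Uu).
have H v : U v -> v 0 ord0 = 0 -> V v *m J v - X v = 0.
  by move=> Uv v0; rewrite radial_jac // subrr.
have := derive_boundary0 oU Uu u0 Y0 dB H.
rewrite EB EM (derive_jac oU sV _ Uu) (derive_jac oU sX _ Uu) => /eqP.
by rewrite subr_eq0 => /eqP <-; rewrite [X in X - _]addrC addrK.
Qed.

Lemma derive_radial_eigen (Y : 'rV[R]_m.+1) : Y 0 ord0 = 0 ->
  V u *m 'D_Y B u = 'D_Y lam u *: V u + lam u *: (Y *m L u) - Y *m L u *m B u.
Proof.
move=> Y0.
have [dM EM] := derivable_mulmx (dv (v := Y) sV Uu) (dv (v := Y) sB Uu).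
have [dS ES] := derive_scalemx (smooth_derivable oU (v := Y) slam Uu) (dv (v := Y) sV Uu).
have [dB EB] := derive_subf dM dS.
have H v : U v -> v 0 ord0 = 0 -> V v *m B v - lam v *: V v = 0.
  by move=> Uv v0; rewrite radial_eigen // subrr.
have := derive_boundary0 oU Uu u0 Y0 dB H.
rewrite EB EM ES (derive_jac oU sV _ Uu) => /eqP.
by rewrite subr_eq0 => /eqP <-; rewrite [X in X - _]addrC addrK.
Qed.

Lemma derive_wein (Z : 'rV[R]_m.+1) :
  'D_Z B u *m J u + B u *m 'D_Z J u =
  'D_Z s u *: J u - 'D_Z rho u *: jac E0 u - rho u *: 'D_Z (jac E0) u.
Proof.
have sJE : msmooth U (jac E0) := msmooth_jac oU sE0.
have [dM EM] := derivable_mulmx (dv (v := Z) sB Uu) (dv (v := Z) sJ Uu).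
have [d1 ED1] := derive_scalemx (smooth_derivable oU (v := Z) ss Uu) (dv (v := Z) sJ Uu).
have [d2 ED2] := derive_scalemx (smooth_derivable oU (v := Z) srho Uu) (dv (v := Z) sJE Uu).
rewrite -EM.
have -> : 'D_Z (fun y => B y *m J y) u = 'D_Z (fun y => s y *: J y - rho y *: jac E0 y) u.
  by apply: near_eq_derive; apply: filterS (open_nbhs_nbhs (conj oU Uu)) => y; exact: wein.
rewrite (derive_subf d1 d2).2 ED1 ED2 s_boundary // scale0r addr0.
by rewrite opprD addrA.
Qed.

Lemma tangent_wein (Y : 'rV[R]_m.+1) : Y *m jac E0 u = - (rho u)^-1 *: (Y *m B u *m J u).
Proof.
rewrite -mulmxA wein // s_boundary // scale0r sub0r mulmxN -scalemxAr scaleNr scalerN opprK.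
by rewrite scalerA mulVf ?scale1r // rho0.
Qed.

Lemma derive_rho (Z : 'rV[R]_m.+1) : 'D_Z rho u = c / 2 * dotr (Z *m J u) (X u).
Proof.
have d := dv (v := Z) sX Uu.
have dX j : derivable (fun v => X v 0 j) u Z := (derivable_mxP X u Z).1 d 0 j.
have dXX j : derivable (fun v => X v 0 j * X v 0 j) u Z := derivable_mul (dX j) (dX j).
have [dS ES] := derive_sumf (index_enum 'I_m.+2) dXX.
have dc : derivable (fun _ : 'rV[R]_m.+1 => 1 : R) u Z by exact: (derivable_cst (1 : R) u Z).
have -> : 'D_Z rho u = 'D_Z (fun v => 1 + c / 4 * \sum_j X v 0 j * X v 0 j) u.
  by apply: near_eq_derive; apply: filterS (open_nbhs_nbhs (conj oU Uu)) => y; exact: rhoE.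
rewrite (derive_add dc (derivable_scale (a := c / 4) dS)) derive_cst add0r.
rewrite (derive_scale _ dS) ES.
have -> : \sum_j 'D_Z (fun v => X v 0 j * X v 0 j) u = 2 * dotr (Z *m J u) (X u).
  rewrite /dotr mulr_sumr; apply: eq_bigr => j _; rewrite (derive_mul (dX j) (dX j)).
  by rewrite -(derive_mxE 0 j d) (derive_jac oU sX _ Uu); ring.
by field.
Qed.

Lemma derive_s_radial : 'D_(V u) s u = - (lam u * kp).
Proof.
pose Z := V u.
have d := dv (v := Z) sX Uu; have dE := dv (v := Z) sE0 Uu.
have dX j : derivable (fun v => X v 0 j) u Z := (derivable_mxP X u Z).1 d 0 j.
have dE' j : derivable (fun v => E0 v 0 j) u Z := (derivable_mxP E0 u Z).1 dE 0 j.
have dXX j : derivable (fun v => X v 0 j * E0 v 0 j) u Z := derivable_mul (dX j) (dE' j).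
have [dS ES] := derive_sumf (index_enum 'I_m.+2) dXX.
have -> : 'D_Z s u = 'D_Z (fun v => c / 2 * \sum_j X v 0 j * E0 v 0 j) u.
  by apply: near_eq_derive; apply: filterS (open_nbhs_nbhs (conj oU Uu)) => y; exact: sE.
rewrite (derive_scale _ dS) ES.
have -> : \sum_j 'D_Z (fun v => X v 0 j * E0 v 0 j) u =
    dotr (Z *m J u) (E0 u) + dotr (X u) (Z *m jac E0 u).
  rewrite /dotr -big_split; apply: eq_bigr => j _; rewrite (derive_mul (dX j) (dE' j)) /=.
  by rewrite -(derive_mxE 0 j d) -(derive_mxE 0 j dE) (derive_jac oU sX _ Uu) (derive_jac oU sE0 _ Uu).
rewrite radial_jac // [dotr (X u) (E0 u)]dotrC bE // add0r tangent_wein radial_eigen //.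
rewrite -scalemxAl radial_jac // scalerA dotrZr bX // /kp.
by field; rewrite rho0.
Qed.

Lemma derive_s_tangent (Y : 'rV[R]_m.+1) : Y 0 ord0 = 0 -> 'D_Y s u = 0.
Proof.
move=> Y0; apply: (derive_boundary0 oU Uu u0 Y0) => [|v]; last exact: s_boundary.
exact: (smooth_derivable oU).
Qed.

(** The Codazzi equation for the radial direction and a vector [Y] tangent to
    the boundary, [L] being the derivative of the radial coefficients. In the
    factor [kp - 1], the [-1] is due to the derivative of the position vector
    along [Y], which is [Y], and [kp] to the radial derivative of the conformal
    factor. *)
Lemma codazzi_boundary (Y : 'rV[R]_m.+1) : Y 0 ord0 = 0 -> (Y *m B u) 0 ord0 = 0 ->
  Y *m 'D_(V u) B u = (kp - 1) *: (Y *m T u) + Y *m T u *m L u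
     - Y *m L u *m T u + 'D_Y lam u *: V u.
Proof.
move=> Y0 YB0; apply: (row_free_inj (Jfree Uu)); rewrite -/(J u).
have W1 : Y *m ('D_(V u) B u *m J u + B u *m 'D_(V u) J u) =
    - (lam u * kp) *: (Y *m J u) + kp *: (Y *m B u *m J u) - rho u *: (Y *m 'D_(V u) (jac E0) u).
  rewrite derive_wein derive_s_radial derive_rho radial_jac // bX //.
  rewrite !mulmxBr -!scalemxAr tangent_wein scalerA; congr (_ + _ - _).
  by rewrite mulrN scaleNr opprK.
have W2 : V u *m ('D_Y B u *m J u + B u *m 'D_Y J u) =
    - rho u *: (V u *m 'D_Y (jac E0) u).
  rewrite derive_wein derive_s_tangent // derive_rho dot_tangent_X // mulr0 !scale0r.
  by rewrite subr0 sub0r mulmxN -scalemxAr scaleNr.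
have HE : Y *m 'D_(V u) (jac E0) u = V u *m 'D_Y (jac E0) u := hess_sym oU sE0 Y (V u) Uu.
have HJ : Y *m B u *m 'D_(V u) J u = V u *m 'D_(Y *m B u) J u.
  exact: (hess_sym oU sX (Y *m B u) (V u) Uu).
rewrite HE in W1.
apply: (codazzi_algebra W1 W2).
- by rewrite HJ derive_radial_jac.
- exact: derive_radial_jac.
- exact: derive_radial_eigen.
- exact: radial_eigen.
Qed.

(** The rows of [T] are tangent to the boundary, so the Codazzi equation applies
    to them; the derivative of the eigenvalue disappears because [T] kills the
    radial direction. *)
Lemma trace_boundary : \tr (T u *m 'D_(V u) B u) = (kp - 1) * \tr (T u *m T u).
Proof.
pose dl : 'cV[R]_m.+1 := \col_i 'D_(delta_mx 0 i) lam u.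
have dlE (Y : 'rV[R]_m.+1) : 'D_Y lam u *: V u = Y *m dl *m V u.
  rewrite derive_sum_partial; last exact: (smooth_differentiable oU slam Uu).
  have -> : Y *m dl = (\sum_i Y 0 i * partial i lam u)%:M.
    by apply/matrixP => i j; rewrite !ord1 !mxE mulr1n; apply: eq_bigr => k _; rewrite mxE.
  by rewrite mul_scalar_mx.
rewrite (codazzi_rows (L := L u) (dl := dl) (V := V u) (a := kp - 1)).
  by rewrite radial_shifted // mul0mx mxtrace0 addr0.
move=> i; rewrite codazzi_boundary ?dlE //; first by rewrite mxE shifted_tangent.
have -> : B u = T u + (lam u)%:M by rewrite /T /shifted -addrA -raddfD addNr raddf0 addr0.
have tr0 : row i (T u) 0 ord0 = 0 by rewrite mxE shifted_tangent.
rewrite mulmxDr mul_mx_scalar [LHS]mxE [X in _ + X]mxE tr0 mulr0 addr0 mxE.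
by rewrite big1 // => j _; rewrite shifted_tangent // mulr0.
Qed.

End AtPoint.
End BoundaryDerivative.

(** * The umbilicity tensor at a boundary maximum *)

Section ChartBoundary.
Context {R : realType} (c r : R) (m : nat).
Hypothesis hc : c \in [:: -1; 0; 1].
Hypothesis r0 : 0 < r.
Hypothesis rlt2 : c != 0 -> r < 2.
Variables (U : set 'rV[R]_m.+1) (X N : 'rV[R]_m.+1 -> 'rV[R]_m.+2).
Hypothesis oU : open U.
Hypothesis sX : smooth U X.
Hypothesis sN : smooth U N.
Hypothesis domX : X @` U `<=` space_dom c m.+2.
Hypothesis immX : forall u, U u -> row_free ('J X u).
Local Notation g := (space_metric c m.+2).
Hypothesis unitN : forall u, U u -> inner g (X u) (N u) (N u) = 1.
Hypothesis normN : forall u i, U u -> inner g (X u) (N u) (partial i X u) = 0.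
Hypothesis bX : forall u, U u -> u 0 ord0 = 0 -> dotr (X u) (X u) = r ^+ 2.
Hypothesis bN : forall u, U u -> u 0 ord0 = 0 -> dotr (N u) (X u) = 0.
Hypothesis inX : forall u, U u -> 0 <= u 0 ord0 -> dotr (X u) (X u) <= r ^+ 2.

Let sX' : msmooth U X := smooth_msmooth oU sX.
Let phi2 u := endo_norm2 (induced_metric g X u)
  (umbilicity (weingarten g X (cov_deriv g X N) u)).
Let B := shape_mx c X N.
Let V := radial X.

(** The squared distance to the origin is at most [r ^+ 2] on the half-space,
    with equality on its boundary: it does not increase inwards. *)
Lemma radial_outward u : U u -> u 0 ord0 = 0 -> V u 0 ord0 <= 0.
Proof.
move=> Uu u0.
pose tau := (X u *m (jac X u)^T) 0 ord0.
have tau0 : tau <= 0.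
  pose e0 : 'rV[R]_m.+1 := delta_mx 0 ord0.
  have d := msmooth_derivable oU (v := e0) sX' Uu.
  have dX j : derivable (fun v => X v 0 j) u e0 := (derivable_mxP X u e0).1 d 0 j.
  have dXX j : derivable (fun v => X v 0 j * X v 0 j) u e0 := derivable_mul (dX j) (dX j).
  have [dS ES] := derive_sumf (index_enum 'I_m.+2) dXX.
  have : 'D_e0 (fun v => \sum_j X v 0 j * X v 0 j) u <= 0.
    apply: (derive_half_space_le oU Uu u0 _ dS); first by rewrite mxE !eqxx.
    by move=> v Uv v0; rewrite -/(dotr (X v) (X v)) -/(dotr (X u) (X u)) (bX Uu u0) inX.
  rewrite ES.
  have -> : \sum_j 'D_e0 (fun v => X v 0 j * X v 0 j) u = 2 * tau.
    rewrite /tau mulmx_trE row_id /dotr mulr_sumr; apply: eq_bigr => j _.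
    rewrite (derive_mul (dX j) (dX j)) rowE -/e0 -(derive_mxE 0 j d) (derive_jac oU sX' _ Uu).
    by ring.
  by lra.
have Vd : V u = tau *: (delta_mx 0 ord0 *m invmx (gram_mx X u)).
  rewrite scalemxAl; congr (_ *m _); apply/rowP => i; rewrite [RHS]mxE [delta_mx _ _ _ _]mxE eqxx /=.
  have [->|i0] := eqVneq i ord0; first by rewrite mulr1.
  by rewrite mulr0; exact: (X_jac_delta oU sX' bX Uu u0 i0).
have Gu : gram_mx X u \in unitmx by apply: gram_unit; exact: (jac_free oU sX immX Uu).
rewrite Vd mxE -rowE mxE; apply: mulr_le0_ge0 => //.
have -> : invmx (gram_mx X u) = (invmx (gram_mx X u) *m jac X u) *m (invmx (gram_mx X u) *m jac X u)^T.
  rewrite trmx_mul trmx_inv gram_mx_tr mulmxA -(mulmxA (invmx _)) -/(gram_mx X u).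
  by rewrite mulVmx // mul1mx.
by rewrite mulmx_trE dotr_ge0.
Qed.

(** The sphere bounding the ball is strictly convex: the difference of both
    sides is a positive multiple of its principal curvature. *)
Lemma boundary_factor_lt1 : c / 2 * r ^+ 2 / (1 + c / 4 * r ^+ 2) < 1.
Proof.
have r2 : 0 < r ^+ 2 by rewrite exprn_gt0.
have H : c != 0 -> r ^+ 2 < 4.
  move=> /rlt2 h2; rewrite (_ : 4 = 2 ^+ 2) ?ltr_pXn2r ?nnegrE ?ltW //; ring.
move: hc H; rewrite !inE => /or3P[] /eqP E; rewrite E.
- rewrite oppr_eq0 oner_eq0 => /(_ isT) h.
  by rewrite ltr_pdivrMr; lra.
- by move=> _; rewrite !mul0r ltr01.
- rewrite oner_eq0 => /(_ isT) h.
  by rewrite ltr_pdivrMr; lra.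
Qed.

(** The derivative of the squared norm in the outward radial direction is
    nonnegative at such a maximum. The mean curvature being constant, it is
    twice the trace of [trace_boundary], a negative multiple of [\tr (T *m T)].
    So this trace is at most 0; and it bounds the squared norm, which is the
    least trace of the square of [B] minus a scalar. *)
Lemma boundary_max_phi2 u h : U u -> u 0 ord0 = 0 ->
  (forall v, U v -> 0 <= v 0 ord0 -> \tr (B v) = h) ->
  (forall v, U v -> 0 <= v 0 ord0 -> phi2 v <= phi2 u) -> phi2 u = 0.
Proof.
move=> Uu u0 trB maxu.
have sB : msmooth U B := msmooth_shape_mx hc oU sX sN domX immX.
have sphi : smooth U phi2 := smooth_phi2 hc oU sX sN domX immX normN.
have E := phi2E hc oU sX sN domX immX normN.
have trBu : \tr (B u) = h by apply: trB => //; rewrite u0.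
have D0 : 0 <= 'D_(V u) phi2 u.
  have df := smooth_differentiable oU sphi Uu.
  have : 'D_(- V u) phi2 u <= 0.
    apply: (derive_half_space_le oU Uu u0 _ _ maxu); last exact: diff_derivable.
    by rewrite mxE oppr_ge0 radial_outward.
  by rewrite !deriveE // linearN oppr_le0.
have st := smooth_mxtrace oU sB.
have dtr : 'D_(V u) (fun v => \tr (B v)) u = 0.
  apply: (derive_half_space_cst oU _ Uu u0); first exact: (smooth_differentiable oU st Uu).
  by move=> v Uv v0; exact: (etrans (trB v Uv v0) (esym trBu)).
have dB := msmooth_derivable oU (v := V u) sB Uu.
have [dBB EBB] := derivable_mulmx dB dB.
have [dtBB EtBB] := derive_mxtrace dBB.
have dt := smooth_derivable oU (v := V u) st Uu.
have dtt := derivable_mul dt dt.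
have D1 : 'D_(V u) phi2 u = 2 * \tr (B u *m 'D_(V u) B u).
  have -> : 'D_(V u) phi2 u = 'D_(V u) (fun v => \tr (B v *m B v)
       + (- m.+1%:R^-1) * (\tr (B v) * \tr (B v))) u.
    apply: near_eq_derive; apply: filterS (open_nbhs_nbhs (conj oU Uu)) => v Uv.
    by rewrite /phi2 E // expr2 mulNr [_^-1 * _]mulrC.
  rewrite (derive_add dtBB (derivable_scale (a := - m.+1%:R^-1) dtt)) (derive_scale _ dtt).
  rewrite (derive_mul dt dt) dtr mul0r mulr0 addr0 mulr0 addr0 EtBB EBB mxtraceD.
  by rewrite [\tr ('D_ _ _ _ *m _)]mxtrace_mulC; ring.
have EJ v : U v -> unit_normal c X N v *m (jac X v)^T = 0.
  move=> Uv; rewrite /unit_normal -scalemxAl (normal_jac hc oU sX domX normN Uv).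
  by rewrite scaler0.
have E1 v : U v -> unit_normal c X N v != 0.
  move=> Uv; apply/eqP => C; have := unit_normal_unit hc domX unitN Uv.
  rewrite C mul0mx => /matrixP/(_ 0 0)/eqP.
  by rewrite !mxE /= eq_sym oner_eq0.
have rho0 v : U v -> conf_at c X v != 0 by exact: conf_at_neq0.
have sE v : U v -> conf_shift c X N v = c / 2 * dotr (X v) (unit_normal c X N v).
  by move=> Uv; rewrite /conf_shift /unit_normal dotrZr; field; exact: rho0.
have bE v : U v -> v 0 ord0 = 0 -> dotr (unit_normal c X N v) (X v) = 0.
  by move=> Uv v0; rewrite /unit_normal dotrZl bN // mulr0.
have := trace_boundary oU sX' (msmooth_unit_normal hc oU sX sN domX) sB (smooth_conf_at c oU sX)
  (smooth_conf_shift hc oU sX sN domX) (fun v Uv => jac_free oU sX immX Uv) EJ E1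
  (fun v _ => erefl) rho0 sE (fun v Uv => weingarten_eq hc oU sX sN domX immX unitN normN Uv)
  (fun v Uv => shape_mx_selfadj hc oU sX sN domX immX normN Uv) r0 bX bE Uu u0.
rewrite -/B -/V {1}/shifted /conf_at /conf bX // mulmxDl mxtraceD mul_scalar_mx mxtraceZ.
rewrite -(derive_mxtrace dB).2 dtr mulr0 addr0 => D2.
have T0 : \tr (shifted r X B u *m shifted r X B u) <= 0.
  rewrite leNgt; apply/negP => Tpos.
  have : 'D_(V u) phi2 u < 0; last by rewrite ltNge D0.
  rewrite D1 D2 pmulr_rlt0 // nmulr_rlt0 // subr_lt0.
  exact: boundary_factor_lt1.
apply/eqP; rewrite eq_le (endo_norm2_ge0 hc oU sX domX immX) // andbT.
apply: le_trans T0; rewrite /phi2 E // /shifted mxtrace_sq_shift -/B.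
set la := radial_eigenvalue _ _ _ _; set t := \tr (B u); set n : R := m.+1%:R.
have n0 : 0 < n by rewrite ltr0n.
rewrite -subr_ge0.
rewrite (_ : _ - _ = n * (la - t / n) ^+ 2); last by field; rewrite gt_eqF.
by rewrite mulr_ge0 ?sqr_ge0 // ltW.
Qed.

End ChartBoundary.

(** * Changes of charts *)

Section Transition.
Context {R : realType}.

Lemma mulmx_bound p q (A : 'M[R]_(p, q)) :
  exists2 C : R, 0 < C & forall x : 'rV[R]_p, `|x *m A| <= C * `|x|.
Proof.
have S0 : 0 <= \sum_i \sum_j `|A i j|.
  by apply: sumr_ge0 => i _; apply: sumr_ge0.
exists (1 + \sum_i \sum_j `|A i j|); first by rewrite ltr_pwDl.
move=> x; apply: normr_rV_le; first by rewrite mulr_ge0 // addr_ge0.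
move=> j; rewrite mxE; apply: le_trans (ler_norm_sum _ _ _) _.
rewrite mulrDl mul1r mulr_suml; apply: ler_wpDl => //.
apply: ler_sum => i _; rewrite normrM mulrC; apply: ler_pM => //.
  by rewrite (bigD1 j) //= lerDl sumr_ge0.
exact: normr_mxE_le.
Qed.

Lemma jac_expand n p (U : set 'rV[R]_n) (X : 'rV[R]_n -> 'rV[R]_p) u : open U -> U u ->
  msmooth U X -> forall e : R, 0 < e -> exists2 d : R, 0 < d &
  forall h, `|h| < d -> `|X (u + h) - X u - h *m jac X u| <= e * `|h|.
Proof.
move=> oU Uu sX e e0.
have H : nbhs (0 : 'rV[R]_n) [set h : 'rV[R]_n | forall a, `|X (u + h) 0 a - X u 0 a -
     \sum_i h 0 i * partial i (fun v => X v 0 a) u| <= e * `|h|].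
  apply: (@filter_forall _ _ _ (nbhs (0 : 'rV[R]_n)) _) => a.
  exact: (C1_expand oU Uu (sX 0 a 1) e0).
have [d d0 Hd] := nearE_ball H; exists d => // h hd.
apply: normr_rV_le => [|a]; first by rewrite mulr_ge0 // ltW.
have := Hd h hd a; rewrite add0r !mxE.
by under [X in _ -> `|_ - X| <= _]eq_bigr do rewrite mxE.
Qed.

(** The chain rule for a transition map known to be continuous only. Its
    displacements [w] are recovered to first order from those of [X2], since
    [jac X2 u2] has the right inverse [P]. The condition [0 < t] makes the
    lemma applicable at boundary points of the half-space. *)
Lemma transition_derivative n p q (U1 U2 : set 'rV[R]_n)
    (X1 X2 : 'rV[R]_n -> 'rV[R]_p) (Y1 Y2 : 'rV[R]_n -> 'rV[R]_q)
    (u1 u2 : 'rV[R]_n) (P : 'M[R]_(p, n)) i :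
  open U1 -> open U2 -> U1 u1 -> U2 u2 ->
  msmooth U1 X1 -> msmooth U2 X2 -> msmooth U1 Y1 -> msmooth U2 Y2 ->
  X1 u1 = X2 u2 -> Y1 u1 = Y2 u2 ->
  jac X2 u2 *m P = 1%:M ->
  (forall e : R, 0 < e -> exists2 d : R, 0 < d & forall t, 0 < t < d ->
    exists w, [/\ `|w| < e, X1 (u1 + t *: delta_mx 0 i) = X2 (u2 + w) &
                  Y1 (u1 + t *: delta_mx 0 i) = Y2 (u2 + w)]) ->
  row i (jac Y1 u1) = row i (jac X1 u1) *m P *m jac Y2 u2.
Proof.
move=> oU1 oU2 Uu1 Uu2 sX1 sX2 sY1 sY2 EX EY JP Htr.
set v := row i (jac X1 u1); set y := row i (jac Y1 u1); set K := jac Y2 u2.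
have [Cp Cp0 HCp] := mulmx_bound P; have [Ck Ck0 HCk] := mulmx_bound K.
pose C1 := 2 * `|v *m P| + 1.
have C10 : 0 < C1 by rewrite ltr_wpDl // mulr_ge0.
pose M := 1 + C1 + Ck * (Cp * (C1 + 1)).
have M0 : 0 < M.
  by do ![apply: addr_gt0 => // | apply: mulr_gt0 => //].
have key (e : R) : 0 < e -> Cp * e <= 1 / 2 -> `|y - v *m P *m K| <= e * M.
  move=> e0 he.
  have [d1 d10 H1] := jac_expand oU1 Uu1 sX1 e0.
  have [d2 d20 H2] := jac_expand oU2 Uu2 sX2 e0.
  have [d3 d30 H3] := jac_expand oU1 Uu1 sY1 e0.
  have [d4 d40 H4] := jac_expand oU2 Uu2 sY2 e0.
  have m24 : 0 < Num.min d2 d4 by rewrite lt_min d20.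
  have [d5 d50 H5] := Htr _ m24.
  have m135 : 0 < Num.min d5 (Num.min d1 d3) by rewrite !lt_min d50 d10.
  pose t := Num.min d5 (Num.min d1 d3) / 2.
  have t0 : 0 < t by rewrite divr_gt0.
  have tm : t < Num.min d5 (Num.min d1 d3) by rewrite /t; lra.
  have /and3P[t5 t1 t3] : [&& t < d5, t < d1 & t < d3] by rewrite -!lt_min.
  have [|w [wd EXw EYw]] := H5 t; first by rewrite t0.
  have /andP[w2 w4] : (`|w| < d2) && (`|w| < d4) by rewrite -lt_min.
  pose h : 'rV[R]_n := t *: delta_mx 0 i.
  have hn : `|h| <= t.
    apply: normr_rV_le; first exact: ltW.
    move=> j; rewrite !mxE eqxx /=; case: eqP => _.
      by rewrite mulr1 gtr0_norm.
    by rewrite mulr0 normr0 ltW.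
  have hJ q' (Z : 'rV[R]_n -> 'rV[R]_q') : h *m jac Z u1 = t *: row i (jac Z u1).
    by rewrite /h -scalemxAl -rowE.
  have := H1 h (le_lt_trans hn t1); rewrite hJ -/v => E1.
  have := H3 h (le_lt_trans hn t3); rewrite hJ -/y => E3.
  have := H2 w w2; have := H4 w w4; rewrite -EXw -EYw -/h -/K -EX -EY => E4 E2.
  have {}E1 : `|X1 (u1 + h) - X1 u1 - t *: v| <= e * t.
    by apply: le_trans E1 _; rewrite ler_pM2l.
  have {}E3 : `|Y1 (u1 + h) - Y1 u1 - t *: y| <= e * t.
    by apply: le_trans E3 _; rewrite ler_pM2l.
  set a := X1 (u1 + h) - X1 u1 in E1 E2.
  set b := Y1 (u1 + h) - Y1 u1 in E3 E4.
  set W := `|w| in E2 E4.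
  have W0 : 0 <= W by exact: normr_ge0.
  (* To first order the displacement [w] is the displacement of [X2], that is
     [t *: v], times the right inverse [P] of [jac X2 u2]. *)
  have Ew : `|w - t *: (v *m P)| <= Cp * (e * W + e * t).
    have -> : w - t *: (v *m P) = ((a - t *: v) - (a - w *m jac X2 u2)) *m P.
      have -> : (a - t *: v) - (a - w *m jac X2 u2) = w *m jac X2 u2 - t *: v.
        by rewrite opprB addrC addrA subrK.
      by rewrite mulmxBl -mulmxA JP mulmx1 -scalemxAl.
    apply: le_trans (HCp _) _; rewrite ler_pM2l //.
    by apply: le_trans (ler_normB _ _) _; rewrite addrC lerD.
  have HW : W <= C1 * t.
    have : W <= `|w - t *: (v *m P)| + t * `|v *m P|.
      rewrite /W -{1}[w](subrK (t *: (v *m P))); apply: le_trans (ler_normD _ _) _.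
      by rewrite normrZ gtr0_norm.
    have : Cp * (e * W + e * t) <= 1 / 2 * (W + t).
      by rewrite -mulrDr mulrA ler_wpM2r // addr_ge0 // ltW.
    move=> h1 h2; rewrite /C1; nra.
  have {}Ew : `|w - t *: (v *m P)| <= Cp * (C1 + 1) * e * t.
    apply: le_trans Ew _.
    rewrite (_ : Cp * (C1 + 1) * e * t = Cp * (e * (C1 * t) + e * t)); last ring.
    by rewrite ler_pM2l // lerD2r ler_pM2l.
  have E : `|t *: (y - v *m P *m K)| <= e * t + e * (C1 * t) + Ck * (Cp * (C1 + 1) * e * t).
    have -> : t *: (y - v *m P *m K) = (b - w *m K) - (b - t *: y) + (w - t *: (v *m P)) *m K.
      have -> : (b - w *m K) - (b - t *: y) = t *: y - w *m K.
        by rewrite opprB addrC addrA subrK.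
      by rewrite mulmxBl -scalemxAl scalerBr addrA subrK.
    apply: le_trans (ler_normD _ _) _; apply: lerD; last first.
      by apply: le_trans (HCk _) _; rewrite ler_pM2l.
    apply: le_trans (ler_normB _ _) _; rewrite addrC; apply: lerD => //.
    by apply: le_trans E4 _; rewrite ler_pM2l.
  move: E; rewrite normrZ gtr0_norm // => E.
  rewrite -(ler_pM2l t0); apply: le_trans E _.
  by rewrite /M le_eqVlt; apply/orP; left; apply/eqP; ring.
apply/eqP; rewrite -subr_eq0 -normr_le0; apply/ler_addgt0Pl => e e0; rewrite addr0.
pose e' := Num.min (e / M) (1 / (2 * Cp)).
have e'0 : 0 < e' by rewrite lt_min !divr_gt0 // mulr_gt0.
have e'1 : e' <= e / M by rewrite ge_min lexx.
have e'2 : e' <= 1 / (2 * Cp) by rewrite ge_min lexx orbT.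
apply: le_trans (key e' e'0 _) _.
  by move: e'2; rewrite ler_pdivlMr ?mulr_gt0 // => H; lra.
by rewrite -ler_pdivlMr.
Qed.

Lemma shape_mx_similar (n p : nat) (T : 'M[R]_n) (J K : 'M[R]_(n, p)) (s : R) :
  row_free (T *m J) -> row_free J ->
  let B (J K : 'M[R]_(n, p)) := s%:M - K *m J^T *m invmx (J *m J^T) in
  T \in unitmx /\ B (T *m J) (T *m K) = T *m B J K *m invmx T.
Proof.
move=> fTJ fJ B.
have uT : T \in unitmx.
  rewrite -row_free_unit /row_free eqn_leq rank_leq_row /=.
  by rewrite -{1}(eqP fTJ) mxrankM_maxl.
split=> //.
have G2 : J *m J^T \in unitmx by exact: gram_unit.
have G1 : T *m J *m (T *m J)^T \in unitmx by exact: gram_unit.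
apply: (can_inj (mulmxK G1)).
have E : T *m J *m (T *m J)^T = T *m (J *m J^T) *m T^T by rewrite trmx_mul !mulmxA.
have -> : T *m B J K *m invmx T *m (T *m J *m (T *m J)^T) =
    T *m (B J K *m (J *m J^T)) *m T^T.
  by rewrite E -(mulmxA T (J *m J^T)) (mulmxA _ T) mulmxKV // !mulmxA.
have -> : B J K *m (J *m J^T) = s *: (J *m J^T) - K *m J^T.
  by rewrite /B mulmxBl mulmxKV // mul_scalar_mx.
rewrite {1}/B mulmxBl mulmxKV // mul_scalar_mx E mulmxBr mulmxBl -scalemxAr -scalemxAl.
by rewrite trmx_mul !mulmxA.
Qed.

End Transition.

(** * The unit ball of the sphere is smaller than a hemisphere *)

Section RadiusBound.
Context {R : realType}.

Lemma Rintegral_ge_variation (F h : R -> R) :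
  (forall t, derivable F t 1) -> continuous (fun t => 'D_1 F t) -> continuous h ->
  (forall t, 'D_1 F t <= h t) ->
  F 1 - F 0 <= \int[lebesgue_measure]_(t in `[0, 1]) h t.
Proof.
move=> dF cF' ch Fh.
have cF t : {for t, continuous F}.
  by apply: differentiable_continuous; exact/derivable1_diffP.
have int_cont (k : R -> R) : continuous k ->
    (@lebesgue_measure R).-integrable `[0, 1] (EFin \o k).
  move=> ck; apply: continuous_compact_integrable; first exact: segment_compact.
  exact: continuous_subspaceT.
have -> : F 1 - F 0 = \int[lebesgue_measure]_(t in `[0, 1]) 'D_1 F t.
  rewrite /Rintegral (@continuous_FTC2 _ (fun t => 'D_1 F t) F) //.
  - exact: continuous_subspaceT.
  - split; first by move=> t _; exact: dF.
    + exact: (cvg_at_right_filter (cF 0)).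
    + exact: (cvg_at_left_filter (cF 1)).
  - by move=> t _; rewrite derive1E.
apply: le_Rintegral => //.
- exact: int_cont.
- exact: int_cont.
Qed.

Lemma cont_mul (f k : R -> R) : continuous f -> continuous k ->
  continuous (fun t => f t * k t).
Proof. by move=> cf ck t; exact: (@continuousM _ _ f k t (cf t) (ck t)). Qed.

Lemma cont_add (f k : R -> R) : continuous f -> continuous k ->
  continuous (fun t => f t + k t).
Proof. by move=> cf ck t; apply: continuousD; [exact: cf | exact: ck]. Qed.

Lemma dotr_cauchy p (v w : 'rV[R]_p) : dotr v w ^+ 2 <= dotr v v * dotr w w.
Proof.
have [w0|w0] := eqVneq w 0.
  rewrite w0 -[0]/(0 : 'rV[R]_p) -(scale0r w) !dotrZr mul0r expr0n /=.
  by rewrite mul0r mulr0.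
have wpos : 0 < dotr w w by rewrite lt_neqAle dotr_ge0 eq_sym dotr_eq0 w0.
have := dotr_ge0 (dotr w w *: v - dotr v w *: w).
rewrite !(dotrDl, dotrDr, dotrNl, dotrNr, dotrZl, dotrZr) (dotrC w v).
rewrite (_ : _ + _ = dotr w w * (dotr v v * dotr w w - dotr v w ^+ 2)); last ring.
by rewrite pmulr_rge0 // subr_ge0.
Qed.

(** The left-hand side is the derivative along [v] of [(y 0 i - 2) / rho]. Seen
    on the unit sphere through stereographic projection, this function is up to
    a constant the difference of two coordinates, so that its gradient has
    length at most the square root of 2, hence at most [3 / 2]. *)
Lemma sphere_height_bound p (i : 'I_p) (y v : 'rV[R]_p) (rho : R) :
  rho = conf 1 y ->
  v 0 i / rho - (y 0 i - 2) * dotr y v / 2 / rho ^+ 2 <=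
  3 / 2 * Num.sqrt (rho ^- 2 * dotr v v).
Proof.
move=> rhoE.
have rho0 : 0 < rho.
  by rewrite rhoE /conf; have := dotr_ge0 y; lra.
pose e : 'rV[R]_p := delta_mx 0 i.
pose w := e - ((y 0 i - 2) / (2 * rho)) *: y.
have de (z : 'rV[R]_p) : dotr z e = z 0 i.
  rewrite /dotr (bigD1 i) //= /e mxE !eqxx mulr1 big1 ?addr0 // => j /negbTE ji.
  by rewrite mxE ji andbF mulr0.
have ee : e 0 i = 1 by rewrite /e mxE !eqxx.
have yy : dotr y y = 4 * (rho - 1) by rewrite rhoE /conf; field.
have vw : v 0 i / rho - (y 0 i - 2) * dotr y v / 2 / rho ^+ 2 = dotr v w / rho.
  rewrite /w dotrDr dotrNr dotrZr de (dotrC v y); field; lra.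
have ww : dotr w w <= 2.
  have -> : dotr w w = 2 - (1 + (y 0 i - 2) / rho) ^+ 2.
    rewrite /w !(dotrDl, dotrDr, dotrNl, dotrNr, dotrZl, dotrZr) !de (dotrC e y) de ee yy.
    by field; lra.
  by have := sqr_ge0 (1 + (y 0 i - 2) / rho); lra.
rewrite vw.
have A0 : 0 <= 3 / 2 * Num.sqrt (rho ^- 2 * dotr v v).
  by rewrite mulr_ge0 ?sqrtr_ge0 //; lra.
have [d0|d0] := leP (dotr v w / rho) 0; first exact: le_trans A0.
rewrite -(@ler_pXn2r _ 2) ?nnegrE ?(ltW d0) //.
rewrite [leRHS]exprMn sqr_sqrtr; last first.
  by rewrite mulr_ge0 ?dotr_ge0 // invr_ge0 sqr_ge0.
rewrite [leLHS]expr_div_n [leLHS]mulrC [leRHS]mulrCA ler_pM2l ?invr_gt0 ?exprn_gt0 //.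
apply: le_trans (dotr_cauchy v w) _.
have := dotr_ge0 v; nra.
Qed.

Lemma derive_row p (a : R -> 'rV[R]_p) t j : derivable a t 1 ->
  derivable (fun t => a t 0 j) t 1 /\ 'D_1 (fun t => a t 0 j) t = ('D_1 a t) 0 j.
Proof.
move=> da; split; first exact: ((derivable_mxP a t 1).1 da 0 j).
by rewrite derive_mxE.
Qed.

(** The function of [sphere_height_bound] grows by 2 along the curve, with speed
    at most [3 / 2]. The length is in fact at least [pi / 2]; any bound above 1
    serves the purpose. *)
Lemma sphere_curve_length p (i : 'I_p) (a : R -> 'rV[R]_p) :
  (forall t, derivable a t 1) -> continuous (derive1 a) ->
  a 0 = 0 -> a 1 = 2 *: delta_mx 0 i ->
  4 / 3 <= curve_length (space_metric 1 p) a.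
Proof.
move=> da ca' a0 a1.
pose a' := derive1 a.
have a'E t : 'D_1 a t = a' t by rewrite /a' derive1E.
have dai j t := (derive_row j (da t)).1.
have Dai j t : 'D_1 (fun t => a t 0 j) t = a' t 0 j.
  by rewrite (derive_row j (da t)).2 a'E.
pose rho t := conf 1 (a t).
have rho0 t : 0 < rho t.
  by rewrite /rho /conf; have := dotr_ge0 (a t); lra.
have rhon0 t : rho t != 0 by rewrite gt_eqF.
have dq t : derivable (fun t => \sum_j a t 0 j * a t 0 j) t 1 /\
    'D_1 (fun t => \sum_j a t 0 j * a t 0 j) t = 2 * dotr (a t) (a' t).
  have [d E] := derive_sumf (index_enum 'I_p) (fun j => derivable_mul (dai j t) (dai j t)).
  split=> //; rewrite E /dotr mulr_sumr; apply: eq_bigr => j _.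
  by rewrite (derive_mul (dai j t) (dai j t)) Dai; ring.
have drho t : derivable rho t 1 /\ 'D_1 rho t = dotr (a t) (a' t) / 2.
  have [d E] := dq t.
  have d1 : derivable (fun _ : R => 1 : R) t 1 by exact: (derivable_cst (1 : R) t 1).
  have d4 := derivable_scale (a := 1 / 4) d.
  split; first exact: (derivable_add d1 d4).
  rewrite -[rho]/(fun t => 1 + 1 / 4 * \sum_j a t 0 j * a t 0 j).
  by rewrite (derive_add d1 d4) derive_cst (derive_scale _ d) E add0r; field.
pose F t := (a t 0 i - 2) * (rho t)^-1.
have dF t : derivable F t 1 /\
    'D_1 F t = a' t 0 i / rho t - (a t 0 i - 2) * dotr (a t) (a' t) / 2 / rho t ^+ 2.
  have [dr Er] := drho t.
  have d2 : derivable (fun _ : R => - 2 : R) t 1 by exact: (derivable_cst (- 2 : R) t 1).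
  have dV : derivable (fun t => (rho t)^-1) t 1 by exact: (derivableV (rhon0 t) dr).
  have EV : 'D_1 (fun t => (rho t)^-1) t = - (rho t) ^- 2 * (dotr (a t) (a' t) / 2).
    by rewrite (deriveV (rhon0 t) dr) Er.
  have dn := derivable_add (dai i t) d2.
  split; first exact: (derivable_mul dn dV).
  rewrite (derive_mul dn dV) (derive_add (dai i t) d2) derive_cst Dai EV addr0.
  by congr (_ + _); rewrite -[a t 0 i - 2]/(a t 0 i + - 2); field.
have cai j : continuous (fun t => a t 0 j).
  by move=> t; apply: differentiable_continuous; exact/derivable1_diffP.
have ca'i j : continuous (fun t => a' t 0 j).
  move=> t; apply: (@continuous_comp _ _ _ a' (fun M : 'rV[R]_p => M 0 j) t (ca' t)).
  exact: coord_continuous.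
have cdot (u v : R -> 'rV[R]_p) : (forall j, continuous (fun t => u t 0 j)) ->
    (forall j, continuous (fun t => v t 0 j)) -> continuous (fun t => dotr (u t) (v t)).
  move=> cu cv t; apply: continuous_sumR => j _.
  by apply: continuousM; [exact: cu | exact: cv].
have crho : continuous rho.
  move=> t; apply: differentiable_continuous; apply/derivable1_diffP.
  exact: (drho t).1.
have crV : continuous (fun t => (rho t)^-1).
  by move=> t; apply: continuousV => //; exact: crho.
have crV2 : continuous (fun t => (rho t) ^- 2).
  have -> : (fun t => (rho t) ^- 2) = (fun t => (rho t)^-1 * (rho t)^-1).
    by apply/funext => s; rewrite -invfM expr2.
  exact: (cont_mul crV crV).
rewrite /curve_length.
have -> : (fun t => Num.sqrt (inner (space_metric 1 p) (a t) (derive1 a t) (derive1 a t)))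
  = (fun t => Num.sqrt ((rho t) ^- 2 * dotr (a' t) (a' t))).
  by apply/funext => t; rewrite innerE.
have csp : continuous (fun t => Num.sqrt ((rho t) ^- 2 * dotr (a' t) (a' t))).
  move=> t; apply: (@continuous_comp _ _ _ (fun t => (rho t) ^- 2 * dotr (a' t) (a' t)) Num.sqrt).
    exact: (cont_mul crV2 (cdot _ _ ca'i ca'i)).
  exact: sqrt_continuous.
pose G t := 2 / 3 * F t.
have dG t : derivable G t 1 := derivable_scale (a := 2 / 3) (dF t).1.
have DG t : 'D_1 G t = 2 / 3 * (a' t 0 i / rho t - (a t 0 i - 2) * dotr (a t) (a' t) / 2 / rho t ^+ 2).
  by rewrite /G (derive_scale _ (dF t).1) (dF t).2.
have cG : continuous (fun t => 'D_1 G t).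
  have -> : (fun t => 'D_1 G t) = (fun t => 2 / 3 * (a' t 0 i * (rho t)^-1 +
     (- (1 / 2)) * ((a t 0 i + - 2) * dotr (a t) (a' t) * (rho t) ^- 2))).
    by apply/funext => t; rewrite DG; field.
  have cc (k : R) : continuous (fun _ : R => k) by move=> t; exact: cst_continuous.
  have ca2 := cont_add (cai i) (cc (- 2)).
  have c1 := cont_mul (cont_mul ca2 (cdot _ _ cai ca'i)) crV2.
  exact: (cont_mul (cc _) (cont_add (cont_mul (ca'i i) crV) (cont_mul (cc _) c1))).
have key := Rintegral_ge_variation dG cG csp.
apply: le_trans (key _); last first.
  move=> t; rewrite DG.
  have := sphere_height_bound i (a' t) (erefl (rho t)); lra.
have r0 : rho 0 = 1.
  rewrite /rho a0 /conf.
  by rewrite (_ : dotr _ _ = 0) ?mulr0 ?addr0 //; apply/eqP; rewrite dotr_eq0.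
have r1 : rho 1 = 2.
  rewrite /rho a1 /conf dotrZl dotrZr.
  have -> : dotr (delta_mx 0 i) (delta_mx 0 i) = 1 :> R.
    rewrite /dotr (bigD1 i) //= mxE !eqxx mulr1 big1 ?addr0 // => j /negbTE ji.
    by rewrite mxE ji andbF mulr0.
  by field.
rewrite /G /F r0 r1 a0 a1 !mxE !eqxx /= mulr1; lra.
Qed.

(** Points of norm 2 represent the equator, at distance greater than 1 from the
    center. *)
Lemma unit_ball_radius_lt2 p (r : R) : unit_ball_radius 1 p.+1 r -> r < 2.
Proof.
move=> [r0 _ E]; rewrite ltNge; apply/negP => r2.
pose x : 'rV[R]_p.+1 := 2 *: delta_mx 0 ord0.
have dd : dotr (delta_mx 0 ord0) (delta_mx 0 ord0 : 'rV[R]_p.+1) = 1.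
  rewrite /dotr (bigD1 ord0) //= mxE !eqxx mulr1 big1 ?addr0 // => j /negbTE ji.
  by rewrite mxE ji andbF mulr0.
have nx : enorm x <= r.
  rewrite -(@ler_pXn2r _ 2) ?nnegrE ?enorm_ge0 ?(ltW r0) //.
  by rewrite enorm2 /x dotrZl dotrZr dd; nra.
have : [set x : 'rV[R]_p.+1 | enorm x <= r] x by [].
rewrite E => -[_]; rewrite leNgt => /negP; apply.
apply: (@lt_le_trans _ _ (4 / 3)); first by lra.
apply: lb_le_inf; last first.
  move=> l [a [[da ca'] a0 a1 _ ->]].
  exact: (sphere_curve_length da ca' a0 a1).
exists (curve_length (space_metric 1 p.+1) (fun t : R => t *: x)).
exists (fun t : R => t *: x).
have D (t : R) : is_derive t 1 (fun t : R => t *: x) x.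
  have d : derivable (id : R -> R) t 1 by exact: derivable_id.
  have dc : derivable (fun _ : R => x) t 1 by exact: (derivable_cst x t 1).
  have [d1 E1] := derive_scalemx d dc.
  by apply: DeriveDef => //; rewrite E1 derive_cst derive_id scaler0 addr0 scale1r.
split=> //.
- split=> [t|]; first by have [] := D t.
  rewrite (_ : derive1 _ = cst x); first exact: cst_continuous.
  by apply/funext => t; rewrite derive1E; have [_ ->] := D t.
- exact: scale0r.
- exact: scale1r.
- by move=> y _ /= /eqP; rewrite -addr_eq0 (_ : 1 + 1 = 2) // pnatr_eq0.
Qed.

End RadiusBound.

(** * The umbilicity tensor as a function on the hypersurface *)

Section Global.
Context {R : realType} (c : R) (m : nat) (r : R) (S : topologicalType)
  (F N : S -> 'rV[R]_m.+2).
Hypothesis hc : c \in [:: -1; 0; 1].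

Local Notation g := (space_metric c m.+2).
Local Notation chart := (chart c F N).
Local Notation dom := (@dom R c m S F N).
Local Notation par := (@par R c m S F N).
Local Notation ext := (@ext R c m S F N).
Local Notation nor := (@nor R c m S F N).
Local Notation phi2 := (@chart_phi2 R c m S F N).
Local Notation bd := (@boundary R c m S F N).
Local Notation half := (@half_space R m).

Lemma ext_parE (k : chart) u : dom k u -> half u -> F (par k u) = ext k u.
Proof. exact: ext_par. Qed.

Lemma nor_parE (k : chart) u : dom k u -> half u -> N (par k u) = nor k u.
Proof. exact: nor_par. Qed.

Lemma par_near (k : chart) u (O : set S) : dom k u -> half u -> nbhs (par k u) O ->
  exists2 e : R, 0 < e & forall h, `|h| < e ->
    dom k (u + h) /\ (half (u + h) -> O (par k (u + h))).
Proof.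
move=> du hu nO.
have nd : nbhs u (dom k) by apply: open_nbhs_nbhs; split=> //; exact: dom_open.
have H : within (dom k `&` half) (nbhs u) (par k @^-1` O).
  rewrite nbhs_subspace_in; last by split.
  exact: (@par_continuous _ _ _ _ _ _ k u O nO).
have [e e0 He] := nearE_ball (filterI nd H).
exists e => // h he; have [d1 d2] := He h he; split=> // hh.
by apply: d2; split.
Qed.

Lemma half_add (u h : 'rV[R]_m.+1) (t : R) : half u -> half (u + h) -> 0 <= t <= 1 ->
  half (u + t *: h).
Proof.
rewrite /half_space /= !mxE => u0 uh /andP[t0 t1].
by have := ler_wpM2l t0 uh; nra.
Qed.

Lemma chart_connected (k : chart) u h :
  (forall t : R, 0 <= t <= 1 -> dom k (u + t *: h)) -> half u -> half (u + h) ->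
  connected_component [set: S] (par k u) (par k (u + h)).
Proof.
move=> Hd hu huh.
(* Clamping to the unit interval makes the path continuous on the whole line. *)
pose cl (t : R) : R := if t <= 0 then 0 else if 1 <= t then 1 else t.
have cl01 t : 0 <= cl t <= 1.
  rewrite /cl; have [t0|t0] := leP t 0; first by rewrite lexx ler01.
  by have [t1|t1] := leP 1 t; [rewrite ler01 lexx | rewrite !ltW].
pose f t := par k (u + cl t *: h).
have lip t s : `|cl t - cl s| <= `|t - s|.
  have := ler_norm (t - s); have := ler_norm (s - t); rewrite distrC ler_norml /cl.
  by have [t0|t0] := leP t 0; have [s0|s0] := leP s 0;
    have [t1|t1] := leP 1 t; have [s1|s1] := leP 1 s; lra.
have ccl : continuous cl.
  move=> t; apply/cvgrPdist_lt => e e0; apply/nbhs_ballP; exists e => // s.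
  by move=> ts; apply: le_lt_trans (lip t s) ts.
have cf : continuous f.
  move=> t O nO.
  have [e e0 He] := par_near (Hd _ (cl01 t)) (half_add hu huh (cl01 t)) nO.
  have h1 : 0 < `|h| + 1 by rewrite ltr_wpDl.
  have e1 : 0 < e / (`|h| + 1) by rewrite divr_gt0.
  have := ccl t; move=> /cvgrPdist_lt/(_ _ e1); apply: filterS => s hs.
  have E : u + cl s *: h = u + cl t *: h + (cl s - cl t) *: h.
    by rewrite -addrA -scalerDl [cl t + _]addrC subrK.
  rewrite /preimage /= /f E; apply: (He _ _).2; last by rewrite -E; exact: half_add.
  rewrite normrZ distrC; apply: (@le_lt_trans _ _ (`|cl t - cl s| * (`|h| + 1))).
    by rewrite ler_wpM2l // lerDl.
  by rewrite -ltr_pdivlMr.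
exists (f @` `[0, 1]); last first.
  exists 1; first by rewrite /= in_itv /= ler01 lexx.
  by rewrite /f (_ : cl 1 = 1) ?scale1r // /cl lexx leNgt ltr01.
split=> //.
- exists 0; first by rewrite /= in_itv /= lexx ler01.
  by rewrite /f (_ : cl 0 = 0) ?scale0r ?addr0 // /cl lexx.
- apply: connected_continuous_connected; first exact: segment_connected.
  exact: continuous_subspaceT.
Qed.

Lemma par_image_nbhs (k : chart) u (W : set 'rV[R]_m.+1) : dom k u -> half u -> nbhs u W ->
  nbhs (par k u) (par k @` (W `&` half)).
Proof.
move=> du hu nW.
have nd : nbhs u (dom k) by apply: open_nbhs_nbhs; split=> //; exact: dom_open.
have nI : nbhs u (W `&` dom k) by exact: filterI.
have oI : open (W `&` dom k)° by exact: open_interior.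
have sI : (W `&` dom k)° `<=` dom k by move=> x /interior_subset [].
have oP := @par_open R c m S F N k _ oI sI.
apply: (filterS _ (open_nbhs_nbhs (conj oP _))); last by exists u.
by move=> _ [x [/interior_subset[Wx _] hx] <-]; exists x.
Qed.

(** Supplies the displacements that [transition_derivative] asks for. *)
Lemma chart_trans (k1 k2 : chart) u1 u2 i :
  dom k1 u1 -> half u1 -> dom k2 u2 -> half u2 -> par k1 u1 = par k2 u2 ->
  forall e : R, 0 < e -> exists2 d : R, 0 < d & forall t, 0 < t < d ->
    exists w, [/\ `|w| < e, ext k1 (u1 + t *: delta_mx 0 i) = ext k2 (u2 + w) &
                  nor k1 (u1 + t *: delta_mx 0 i) = nor k2 (u2 + w)].
Proof.
move=> d1 h1 d2 h2 E e e0.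
have nW : nbhs u2 [set v | `|v - u2| < e /\ dom k2 v].
  have nd : nbhs u2 (dom k2) by apply: open_nbhs_nbhs; split=> //; exact: dom_open.
  apply: filterI nd.
  by apply: (ball_near e0) => h he /=; rewrite addrC addKr.
have := par_image_nbhs d2 h2 nW; rewrite -E => nO.
have [d d0 Hd] := par_near d1 h1 nO.
exists d => // t /andP[t0 td].
have nt : `|t *: (delta_mx 0 i : 'rV[R]_m.+1)| < d.
  apply: normr_rV_lt => // j; rewrite !mxE eqxx /=; case: eqP => _.
    by rewrite mulr1 gtr0_norm.
  by rewrite mulr0 normr0.
have hh : half (u1 + t *: delta_mx 0 i).
  rewrite /half_space /= !mxE; move: h1; rewrite /half_space /= => h1.
  by rewrite addr_ge0 // mulr_ge0 ?ler0n // ltW.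
have [dd /(_ hh) [v [[vu dv] hv] pv]] := Hd _ nt.
exists (v - u2); rewrite [u2 + _]addrC subrK; split=> //.
- by rewrite -(ext_parE dd hh) -(ext_parE dv hv) pv.
- by rewrite -(nor_parE dd hh) -(nor_parE dv hv) pv.
Qed.

(** By [transition_derivative] a change of chart multiplies the matrices of
    derivatives of [ext] and of [nor] on the left by the same invertible matrix,
    so the two shape operators are similar. *)
Lemma chart_phi2_indep (k1 k2 : chart) u1 u2 :
  dom k1 u1 -> half u1 -> dom k2 u2 -> half u2 -> par k1 u1 = par k2 u2 ->
  phi2 k1 u1 = phi2 k2 u2.
Proof.
move=> d1 h1 d2 h2 E.
have oU1 := @dom_open _ _ _ _ _ _ k1; have oU2 := @dom_open _ _ _ _ _ _ k2.
have sX1 := smooth_msmooth oU1 (@ext_smooth _ _ _ _ _ _ k1).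
have sX2 := smooth_msmooth oU2 (@ext_smooth _ _ _ _ _ _ k2).
have sN1 := smooth_msmooth oU1 (@nor_smooth _ _ _ _ _ _ k1).
have sN2 := smooth_msmooth oU2 (@nor_smooth _ _ _ _ _ _ k2).
have EX : ext k1 u1 = ext k2 u2 by rewrite -(ext_parE d1 h1) -(ext_parE d2 h2) E.
have EN : nor k1 u1 = nor k2 u2 by rewrite -(nor_parE d1 h1) -(nor_parE d2 h2) E.
have f1 := jac_free oU1 (@ext_smooth _ _ _ _ _ _ k1) (@ext_immersion _ _ _ _ _ _ k1) d1.
have f2 := jac_free oU2 (@ext_smooth _ _ _ _ _ _ k2) (@ext_immersion _ _ _ _ _ _ k2) d2.
set J1 := jac (ext k1) u1 in f1; set J2 := jac (ext k2) u2 in f2.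
pose P := J2^T *m invmx (J2 *m J2^T).
have JP : J2 *m P = 1%:M by rewrite /P mulmxA mulmxV // gram_unit.
have T1 : J1 = J1 *m P *m J2.
  apply/row_matrixP => i; rewrite 2!row_mul.
  apply: (transition_derivative oU1 oU2 d1 d2 sX1 sX2 sX1 sX2 EX EX JP) => e e0.
  have [d d0 Hd] := chart_trans i d1 h1 d2 h2 E e0; exists d => // t /Hd[w [w1 w2 w3]].
  by exists w.
have T2 : jac (nor k1) u1 = J1 *m P *m jac (nor k2) u2.
  apply/row_matrixP => i; rewrite 2!row_mul.
  apply: (transition_derivative oU1 oU2 d1 d2 sX1 sX2 sN1 sN2 EX EN JP) => e e0.
  exact: (chart_trans i d1 h1 d2 h2 E e0).
have {T1 T2} [T [T1 T2]] : exists T, J1 = T *m J2 /\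
    jac (nor k1) u1 = T *m jac (nor k2) u2 by exists (J1 *m P).
rewrite T1 in f1.
have [uT /= EB] := shape_mx_similar (jac (nor k2) u2) (conf_shift c (ext k2) (nor k2) u2) f1 f2.
have {}EB : shape_mx c (ext k1) (nor k1) u1 = T *m shape_mx c (ext k2) (nor k2) u2 *m invmx T.
  rewrite -[RHS]EB -T1 -T2.
  by rewrite /shape_mx /conf_shift /conf_at EX EN.
rewrite /chart_phi2 /chart_metric /chart_weingarten.
rewrite (phi2E hc oU1 (@ext_smooth _ _ _ _ _ _ k1) (@nor_smooth _ _ _ _ _ _ k1)
  (@ext_dom _ _ _ _ _ _ k1) (@ext_immersion _ _ _ _ _ _ k1) (@nor_normal _ _ _ _ _ _ k1) d1).
rewrite (phi2E hc oU2 (@ext_smooth _ _ _ _ _ _ k2) (@nor_smooth _ _ _ _ _ _ k2)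
  (@ext_dom _ _ _ _ _ _ k2) (@ext_immersion _ _ _ _ _ _ k2) (@nor_normal _ _ _ _ _ _ k2) d2).
rewrite EB; set B := shape_mx c (ext k2) _ _.
have -> : \tr (T *m B *m invmx T) = \tr B by rewrite mxtrace_mulC mulmxA mulVmx // mul1mx.
congr (_ - _).
have -> : T *m B *m invmx T *m (T *m B *m invmx T) = T *m (B *m B) *m invmx T.
  by rewrite !mulmxA mulmxKV.
by rewrite [LHS]mxtrace_mulC (mulmxA (invmx T)) mulVmx // mul1mx.
Qed.

End Global.

(** * Vanishing of the umbilicity tensor on the boundary *)

Section Vanishing.
Context {R : realType} (c : R) (m : nat) (r : R) (S : topologicalType)
  (F N : S -> 'rV[R]_m.+2).
Hypothesis hc : c \in [:: -1; 0; 1].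
Hypothesis hr : unit_ball_radius c m.+2 r.
Hypothesis hfree : free_boundary c F N r.
Hypothesis hcmc : constant_mean_curvature c F N.
Hypothesis hphi : phi2_subharmonic c F N.

Local Notation g := (space_metric c m.+2).
Local Notation chart := (chart c F N).
Local Notation dom := (@dom R c m S F N).
Local Notation par := (@par R c m S F N).
Local Notation ext := (@ext R c m S F N).
Local Notation nor := (@nor R c m S F N).
Local Notation phi2 := (@chart_phi2 R c m S F N).
Local Notation bd := (@boundary R c m S F N).
Local Notation half := (@half_space R m).
Local Notation chartB k := (shape_mx c (ext k) (nor k)).

Let r0 : 0 < r. Proof. by case: hr. Qed.

Lemma radius_lt2 : c != 0 -> r < 2.
Proof.
move: hc; rewrite !inE => /or3P[] /eqP E; rewrite E.
- by move=> _; case: hr => _ + _; rewrite E; apply.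
- by rewrite eqxx.
- by move=> _; move: hr; rewrite E; exact: unit_ball_radius_lt2.
Qed.

Lemma half0 (u : 'rV[R]_m.+1) : u 0 ord0 = 0 -> half u.
Proof. by move=> u0; rewrite /half_space /= u0. Qed.

Lemma boundary_par (k : chart) u : dom k u -> u 0 ord0 = 0 -> bd (par k u).
Proof. by move=> du u0; exists k, u. Qed.

Lemma boundary_norm (k : chart) u : dom k u -> u 0 ord0 = 0 ->
  dotr (ext k u) (ext k u) = r ^+ 2.
Proof.
move=> du u0; case: hfree => _ _ _ H _.
by rewrite -enorm2 -(ext_parE du (half0 u0)) H //; exact: boundary_par.
Qed.

Lemma inside_norm (k : chart) u : dom k u -> 0 <= u 0 ord0 ->
  dotr (ext k u) (ext k u) <= r ^+ 2.
Proof.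
move=> du u0; case: hfree => _ _ H1 H2 _.
rewrite -enorm2 -(ext_parE du u0) ler_pXn2r ?nnegrE ?enorm_ge0 ?(ltW r0) //.
have [b|b] := pselect (bd (par k u)); first by rewrite H2.
by apply: ltW; exact: H1.
Qed.

Lemma boundary_normal (k : chart) u : dom k u -> u 0 ord0 = 0 ->
  dotr (nor k u) (ext k u) = 0.
Proof.
move=> du u0; case: hfree => _ _ _ _ H.
have := H _ (boundary_par du u0); rewrite innerE (ext_parE du (half0 u0)) (nor_parE du (half0 u0)).
have dX : space_dom c m.+2 (ext k u) by apply: (@ext_dom R c m S F N k); exists u.
move/eqP; rewrite mulf_eq0 invr_eq0 expf_eq0 /= gt_eqF ?(conf_gt0 hc dX) //=.
by move/eqP.
Qed.

Lemma trace_shape_mx : exists h : R, forall (k : chart) u, dom k u -> half u -> \tr (chartB k u) = h.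
Proof.
have [h Hh] := hcmc; exists h => k u du hu.
rewrite -(Hh k u du hu) /chart_weingarten -mxtrace_tr.
rewrite (weingartenE hc (@dom_open _ _ _ _ _ _ k) (@ext_smooth _ _ _ _ _ _ k) (@nor_smooth _ _ _ _ _ _ k)
  (@ext_dom _ _ _ _ _ _ k) (@ext_immersion _ _ _ _ _ _ k) (@nor_normal _ _ _ _ _ _ k) du).
by [].
Qed.

Lemma smooth_chart_phi2 (k : chart) : smooth (dom k) (phi2 k).
Proof.
exact: (smooth_phi2 hc (@dom_open _ _ _ _ _ _ k) (@ext_smooth _ _ _ _ _ _ k) (@nor_smooth _ _ _ _ _ _ k)
  (@ext_dom _ _ _ _ _ _ k) (@ext_immersion _ _ _ _ _ _ k) (@nor_normal _ _ _ _ _ _ k)).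
Qed.

Lemma chart_phi2_ge0 (k : chart) u : dom k u -> 0 <= phi2 k u.
Proof.
exact: (endo_norm2_ge0 hc (@dom_open _ _ _ _ _ _ k) (@ext_smooth _ _ _ _ _ _ k)
  (@ext_dom _ _ _ _ _ _ k) (@ext_immersion _ _ _ _ _ _ k)).
Qed.

Lemma smooth_sub p (V : normedModType R) (U W : set 'rV[R]_p) (f : 'rV[R]_p -> V) :
  W `<=` U -> smooth U f -> smooth W f.
Proof. by move=> WU sf k; exact: dupto_sub WU (sf k). Qed.

Lemma boundary_local_max (k : chart) u (W : set 'rV[R]_m.+1) : open W -> W `<=` dom k ->
  W u -> u 0 ord0 = 0 ->
  (forall v, W v -> half v -> phi2 k v <= phi2 k u) -> phi2 k u = 0.
Proof.
move=> oW WU Wu u0 H; have [h Hh] := trace_shape_mx.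
apply: (@boundary_max_phi2 R c r m hc r0 radius_lt2 W (ext k) (nor k) oW
  (smooth_sub WU (@ext_smooth _ _ _ _ _ _ k))
  (smooth_sub WU (@nor_smooth _ _ _ _ _ _ k)) _ _ _ _ _ _ _ u h) => //.
- by move=> _ [v /WU dv <-]; apply: (@ext_dom R c m S F N k); exists v.
- by move=> v /WU; exact: ext_immersion.
- by move=> v /WU; exact: nor_unit.
- by move=> v i /WU; exact: nor_normal.
- by move=> v /WU; exact: boundary_norm.
- by move=> v /WU; exact: boundary_normal.
- by move=> v /WU; exact: inside_norm.
- by move=> v /WU dv v0; exact: Hh.
Qed.

Lemma interior_local_max (k : chart) u (W : set 'rV[R]_m.+1) : open W -> W `<=` dom k ->
  W `<=` half -> W u -> (forall v, W v -> phi2 k v <= phi2 k u) ->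
  nbhs u [set v | phi2 k v = phi2 k u].
Proof.
move=> oW WU Wh Wu H.
apply: (subharmonic_strong_maximum hc (@dom_open _ _ _ _ _ _ k) (@ext_smooth _ _ _ _ _ _ k)
  (@ext_dom _ _ _ _ _ _ k) (@ext_immersion _ _ _ _ _ _ k) oW WU Wu (smooth_chart_phi2 k)) => //.
by move=> v Wv; apply: (hphi (WU _ Wv)); exact: Wh.
Qed.

Lemma global_phi2 : exists f : S -> R,
  (forall (k : chart) u, dom k u -> half u -> f (par k u) = phi2 k u) /\ continuous f.
Proof.
case: hfree => [[_ _ cov] _ _ _ _].
have [f Hf] : {f : S -> R & forall p, exists k u,
    [/\ dom k u, half u, par k u = p & f p = phi2 k u]}.
  apply: (@choice S R (fun p y => exists k u,
    [/\ dom k u, half u, par k u = p & y = phi2 k u])) => p.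
  have [k [u [du hu kp]]] := cov p.
  by exists (phi2 k u), k, u.
have fE (k : chart) u : dom k u -> half u -> f (par k u) = phi2 k u.
  move=> du hu; have [k' [u' [du' hu' E ->]]] := Hf (par k u).
  exact: (chart_phi2_indep hc du' hu' du hu E).
exists f; split=> // p O nO.
have [k [u [du hu kp fp]]] := Hf p.
have cu : {for u, continuous (phi2 k)}.
  exact: (smooth_continuous (smooth_chart_phi2 k) du).
rewrite fp in nO.
have nd : nbhs u (dom k) by apply: open_nbhs_nbhs; split=> //; exact: dom_open.
have nW : nbhs u (dom k `&` phi2 k @^-1` O) by apply: filterI nd _; exact: cu.
have := par_image_nbhs du hu nW; rewrite kp; apply: filterS.
by move=> _ [v [[dv Ov] hv] <-]; rewrite /preimage /= fE.
Qed.

(** Otherwise the squared norm has a positive maximum on a component that meets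
    the boundary. The set of maximum points is closed; it contains no boundary
    point, by [boundary_local_max], and so it is open, by [interior_local_max].
    It is then the whole component, which has boundary points. *)
Lemma phi2_boundary_eq0 (k : chart) u : dom k u -> u 0 ord0 = 0 -> phi2 k u = 0.
Proof.
move=> du u0; have [f [fE cf]] := global_phi2.
apply: contrapT => phi_neq0.
have hu := half0 u0.
case: (hfree) => [[_ cS cov] _ _ _ _].
pose p0 := par k u.
pose K := connected_component [set: S] p0.
have K0 : K p0 by exact: connected_component_refl.
have clK : closed K by apply: component_closed; exact: closedT.
have cK : compact K by apply: subclosed_compact clK cS _.
have [q /set_mem Kq qmax] := compact_EVT_max (ex_intro _ p0 K0) cK (continuous_subspaceT cf).
pose M := f q.
have M0 : 0 < M.
  apply: lt_le_trans (qmax p0 (mem_set K0)).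
  by rewrite /p0 fE // lt_neqAle chart_phi2_ge0 // andbT eq_sym; apply/eqP.
(* Components are open, since in a chart the points of a small ball are joined
   to its center by segments. *)
have Kloc (l : chart) v : dom l v -> half v -> K (par l v) ->
    exists2 e : R, 0 < e & forall w, `|w - v| < e -> dom l w /\ (half w -> K (par l w)).
  move=> dv hv Kv.
  have nd : nbhs v (dom l) by apply: open_nbhs_nbhs; split=> //; exact: dom_open.
  have [e e0 He] := nearE_ball nd.
  exists e => // w wv; have Hd (t : R) : 0 <= t <= 1 -> dom l (v + t *: (w - v)).
    move=> /andP[t0 t1]; apply: He; rewrite normrZ ger0_norm //.
    by apply: le_lt_trans wv; rewrite ler_piMl.
  have wE : v + (w - v) = w by rewrite addrC subrK.
  split; first by have := Hd 1; rewrite scale1r wE ler01 lexx; exact.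
  move=> hw; apply: connected_component_trans Kv _; rewrite -{1}wE.
  by apply: chart_connected => //; rewrite wE.
have openball (v : 'rV[R]_m.+1) (e : R) : open [set w : 'rV[R]_m.+1 | `|w - v| < e].
  rewrite (_ : mkset _ = (fun w : 'rV[R]_m.+1 => `|w - v|) @^-1` [set t | t < e]) //.
  by apply: open_comp; [move=> ? _; exact: norm_sub_continuous | exact: open_lt].
have not_boundary (l : chart) v : dom l v -> half v -> K (par l v) -> f (par l v) = M ->
    v 0 ord0 != 0.
  move=> dv hv Kv fv; apply/eqP => v0.
  have [e e0 He] := Kloc l v dv hv Kv.
  have : phi2 l v = 0.
    apply: (boundary_local_max (openball v e) _ _ v0).
    - by move=> w /He[].
    - by rewrite /= subrr normr0.
    - move=> w we hw; have [dw /(_ hw) Kw] := He w we.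
      by rewrite -!fE // fv; exact: qmax (mem_set Kw).
  by rewrite -fE // fv => E; rewrite E ltxx in M0.
have Zopen p : K p -> f p = M -> nbhs p [set p | f p = M].
  move=> Kp fp; have [l [v [dv hv lp]]] := cov p.
  rewrite -lp in Kp fp *.
  have [e e0 He] := Kloc l v dv hv Kp.
  have v0 : 0 < v 0 ord0.
    by rewrite lt_neqAle eq_sym (not_boundary l v dv hv Kp fp) /=; exact: hv.
  pose d := Num.min e (v 0 ord0).
  have d0 : 0 < d by rewrite lt_min e0.
  have sub w : `|w - v| < d -> [/\ dom l w, half w & K (par l w)].
    rewrite lt_min => /andP[we wv].
    have hw : half w.
      have := normr_mxE_le (w - v) ord0; rewrite !mxE /half_space /= => h1.
      have := le_lt_trans h1 wv; rewrite ltr_norml => /andP[h2 _]; lra.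
    by have [dw Kw] := He w we; split=> //; exact: Kw.
  have nM : nbhs v [set w | phi2 l w = phi2 l v].
    apply: (interior_local_max (openball v d)).
    - by move=> w /sub[].
    - by move=> w /sub[].
    - by rewrite /= subrr normr0.
    - move=> w /sub[dw hw Kw].
      by rewrite -!fE // fp; exact: qmax (mem_set Kw).
  have nd : nbhs v (dom l) by apply: open_nbhs_nbhs; split=> //; exact: dom_open.
  have nI : nbhs v (dom l `&` [set w | phi2 l w = phi2 l v]) by exact: filterI.
  apply: (filterS _ (par_image_nbhs dv hv nI)).
  move=> _ [w [[dw Ew] hw] <-].
  exact: (etrans (fE _ _ dw hw) (etrans Ew (etrans (esym (fE _ _ dv hv)) fp))).
have KZ : K `&` [set p | f p = M] = K.
  apply: component_connected.
  - by exists q.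
  - exists [set p | f p = M]°; first exact: open_interior.
    apply/seteqP; split=> p [Kp fp]; split=> //; first exact: Zopen.
    exact: interior_subset fp.
  - exists (f @^-1` [set M]) => //.
    by apply: closed_comp; [move=> ? _; exact: cf | exact: closed_eq].
have fp0 : f p0 = M by move: K0; rewrite -{1}KZ => -[].
by have := not_boundary k u du hu K0 fp0; rewrite u0 eqxx.
Qed.

End Vanishing.

(** * The boundary as a hypersurface of the sphere *)

Section Bdry.
Context {R : realType} (m : nat).

Lemma ord_bdry_cases (j : 'I_m.+1) : j = ord0 \/ exists a : 'I_m, j = rshift 1 a.
Proof.
case: (unliftP ord0 j) => [a ->|->]; [right; exists a | by left].
by apply: val_inj; rewrite /= /bump /= add1n.
Qed.

Lemma bdry_ord0 (w : 'rV[R]_m) : bdry w 0 ord0 = 0.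
Proof.
have -> : ord0 = (lshift m (ord0 : 'I_1) : 'I_(1 + m)) :> 'I_m.+1 by apply: val_inj.
by apply: (etrans (@row_mxEl R 1 1 m 0 w 0 ord0)); rewrite mxE.
Qed.

Lemma bdry_rshift (w : 'rV[R]_m) j : bdry w 0 (rshift 1 j : 'I_m.+1) = w 0 j.
Proof. exact: (@row_mxEr R 1 1 m 0 w 0 j). Qed.

Lemma bdry_delta (w : 'rV[R]_m) (i : 'I_m) (h : R) :
  bdry (h *: delta_mx 0 i + w) = h *: delta_mx 0 (rshift 1 i : 'I_m.+1) + bdry w.
Proof.
apply/rowP => j; have [->|[a ->]] := ord_bdry_cases j.
  rewrite bdry_ord0 [RHS]mxE bdry_ord0 addr0 [RHS]mxE [delta_mx _ _ _ _]mxE eqxx /=.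
  by rewrite mulr0.
rewrite bdry_rshift [LHS]mxE [RHS]mxE bdry_rshift; congr (_ + _).
rewrite [LHS]mxE [RHS]mxE; congr (_ * _); rewrite !mxE eqxx /=; congr (_%:R).
Qed.

Lemma derive_bdry (V : normedModType R) (f : 'rV[R]_m.+1 -> V) w i :
  partial i (f \o bdry) w = partial (rshift 1 i) f (bdry w) /\
  (derivable f (bdry w) (delta_mx 0 (rshift 1 i : 'I_m.+1)) ->
    derivable (f \o bdry) w (delta_mx 0 i)).
Proof.
have E : (fun h : R => h^-1 *: (((f \o bdry) \o shift w) (h *: delta_mx 0 i) - (f \o bdry) w))
   = (fun h => h^-1 *: ((f \o shift (bdry w)) (h *: delta_mx 0 (rshift 1 i : 'I_m.+1)) - f (bdry w))).
  by apply/funext => h /=; rewrite bdry_delta.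
by rewrite /partial /derive /derivable E.
Qed.

Lemma bdry_norm (h : 'rV[R]_m) (w : 'rV[R]_m) : `|bdry (w + h) - bdry w| <= `|h|.
Proof.
apply: normr_rV_le => // j.
have -> : (bdry (w + h) - bdry w) 0 j = bdry (w + h) 0 j - bdry w 0 j.
  by rewrite [LHS]mxE; congr (_ + _); rewrite [LHS]mxE.
have [->|[a ->]] := ord_bdry_cases j.
  by rewrite !bdry_ord0 subrr normr0.
by rewrite !bdry_rshift mxE addrAC subrr add0r; exact: normr_mxE_le.
Qed.

Lemma bdry_continuous (V : normedModType R) (f : 'rV[R]_m.+1 -> V) w :
  {for bdry w, continuous f} -> {for w, continuous (f \o bdry)}.
Proof.
move=> cf O nO; have [e e0 He] := nearE_ball (cf O nO).
apply: (ball_near e0) => h he; have := He (bdry (w + h) - bdry w).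
rewrite [bdry w + _]addrC subrK; apply.
by apply: le_lt_trans he; exact: bdry_norm.
Qed.

Lemma open_bdry (U : set 'rV[R]_m.+1) : open U -> open [set w | U (bdry w)].
Proof.
move=> oU; rewrite openE => w Uw.
have [e e0 He] := nearE_ball (open_nbhs_nbhs (conj oU Uw)).
apply: (ball_near e0) => h he; have := He (bdry (w + h) - bdry w).
rewrite [bdry w + _]addrC subrK; apply.
by apply: le_lt_trans he; exact: bdry_norm.
Qed.

Lemma smooth_bdry (V : normedModType R) (U : set 'rV[R]_m.+1) (f : 'rV[R]_m.+1 -> V) :
  open U -> smooth U f -> smooth [set w | U (bdry w)] (f \o bdry).
Proof.
move=> oU sf k; have := sf k; elim: k f {sf} => [|k IH] f /= [cf df].
  by split=> // w Uw; apply: bdry_continuous; exact: cf.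
split=> [w Uw|i]; first by apply: bdry_continuous; exact: cf.
have [d1 d2] := df (rshift 1 i); split.
  by move=> w Uw; apply: (derive_bdry f w i).2; exact: d1.
apply: dupto_ext (IH _ d2); first exact: open_bdry.
by move=> w Uw; rewrite /= (derive_bdry f w i).1.
Qed.

End Bdry.

Section Final.
Context {R : realType} (c : R) (m : nat) (r : R) (S : topologicalType)
  (F N : S -> 'rV[R]_m.+2).
Hypothesis hc : c \in [:: -1; 0; 1].
Hypothesis hr : unit_ball_radius c m.+2 r.
Hypothesis hfree : free_boundary c F N r.
Hypothesis hcmc : constant_mean_curvature c F N.
Hypothesis hphi : phi2_subharmonic c F N.

Local Notation g := (space_metric c m.+2).
Local Notation chart := (chart c F N).
Local Notation dom := (@dom R c m S F N).
Local Notation par := (@par R c m S F N).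
Local Notation ext := (@ext R c m S F N).
Local Notation nor := (@nor R c m S F N).
Local Notation phi2 := (@chart_phi2 R c m S F N).
Local Notation bd := (@boundary R c m S F N).
Local Notation half := (@half_space R m).
Local Notation chartB k := (shape_mx c (ext k) (nor k)).
Local Notation bdom k := [set w | dom k (bdry w)].

Lemma bdom_open (k : chart) : open (bdom k).
Proof. by apply: open_bdry; exact: dom_open. Qed.

Lemma half_bdry (w : 'rV[R]_m) : half (bdry w).
Proof. by apply: half0; rewrite bdry_ord0. Qed.

Lemma normal_bdry (k : chart) w : dom k (bdry w) -> (N \o par k \o bdry) w = (nor k \o bdry) w.
Proof. by move=> dw; exact: nor_parE dw (half_bdry w). Qed.

Lemma inner_subl (x u v w : 'rV[R]_m.+2) (a : R) :
  inner g x (u - a *: v) w = inner g x u w - a * inner g x v w.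
Proof. by rewrite !innerE dotrDl dotrNl dotrZl; ring. Qed.

Lemma umbilical_shape (k : chart) h w : (forall u, dom k u -> half u -> \tr (chartB k u) = h) ->
  dom k (bdry w) -> chartB k (bdry w) = (h / m.+1%:R)%:M.
Proof.
move=> Hh dw.
have := phi2_boundary_eq0 hc hr hfree hcmc hphi dw (bdry_ord0 w).
have := phi2_eq0 hc (@dom_open _ _ _ _ _ _ k) (@ext_smooth _ _ _ _ _ _ k) (@nor_smooth _ _ _ _ _ _ k)
  (@ext_dom _ _ _ _ _ _ k) (@ext_immersion _ _ _ _ _ _ k) (@nor_normal _ _ _ _ _ _ k) dw.
by rewrite (Hh _ dw (half_bdry w)) => H1 H2; apply: H1.
Qed.

Lemma bdry_metric_unit (k : chart) w : dom k (bdry w) ->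
  induced_metric g (ext k \o bdry) w \in unitmx.
Proof.
move=> dw.
have oU := @dom_open _ _ _ _ _ _ k.
have sX := smooth_msmooth oU (@ext_smooth _ _ _ _ _ _ k).
have fJ := jac_free oU (@ext_smooth _ _ _ _ _ _ k) (@ext_immersion _ _ _ _ _ _ k) dw.
have rho0 := conf_at_neq0 hc (@ext_dom _ _ _ _ _ _ k) dw.
pose J : 'M[R]_(1 + m, m.+2) := jac (ext k) (bdry w).
have fD : row_free (dsubmx J).
  apply: inj_row_free => v vJ.
  have : row_mx (0 : 'rV_1) v *m J = 0.
    by rewrite -(vsubmxK J) mul_row_col mul0mx add0r vJ.
  move/eqP; rewrite (mulmx_free_eq0 _ fJ) => /eqP H.
  by rewrite -(row_mxKr (0 : 'rV_1) v) H linear0.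
have -> : induced_metric g (ext k \o bdry) w =
    (conf_at c (ext k) (bdry w)) ^- 2 *: (dsubmx J *m (dsubmx J)^T).
  apply/matrixP => i j; rewrite !mxE innerE -/(conf_at c (ext k) (bdry w)); congr (_ * _).
  rewrite !(derive_bdry (ext k) w _).1 -!(row_jac oU sX _ dw).
  by rewrite /dotr; apply: eq_bigr => a _; rewrite !mxE.
by rewrite unitmxZ ?gram_unit // unitfE invr_eq0 expf_neq0.
Qed.

(** The component removed by the connection of the sphere is radial, so it does
    not contribute to products with vectors tangent to the boundary: the second
    fundamental form of the boundary relative to [N] is the restriction of that
    of the hypersurface. *)
Lemma bdry_weingarten_umbilical (k : chart) h w :
  (forall u, dom k u -> half u -> \tr (chartB k u) = h) -> dom k (bdry w) ->
  bdry_weingarten c F N N k w = (h / m.+1%:R)%:M.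
Proof.
move=> Hh dw.
have oU := @dom_open _ _ _ _ _ _ k.
have sX := smooth_msmooth oU (@ext_smooth _ _ _ _ _ _ k).
have hB := umbilical_shape Hh dw.
rewrite /bdry_weingarten /weingarten.
set Gb := induced_metric _ _ _.
have -> : \matrix_(l, j) - inner g ((ext k \o bdry) w)
    (sphere_cov_deriv g (ext k \o bdry) (N \o par k \o bdry) j w)
    (partial l (ext k \o bdry) w) = (h / m.+1%:R) *: Gb; last first.
  by rewrite -scalemxAr mulVmx ?scalemx1 // bdry_metric_unit.
apply/matrixP => l j; rewrite [LHS]mxE [RHS]mxE [Gb l j]mxE.
rewrite /sphere_cov_deriv inner_subl.
have -> : inner g ((ext k \o bdry) w) ((ext k \o bdry) w) (partial l (ext k \o bdry) w) = 0.
  rewrite innerE (derive_bdry (ext k) w l).1 dotrC -(row_jac oU sX _ dw) rowE.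
  rewrite (dot_tangent_X oU sX (fun u => @boundary_norm _ _ _ _ _ _ _ hfree k u) dw) ?mulr0 //.
    exact: bdry_ord0.
  by rewrite mxE eqxx.
rewrite mulr0 subr0.
have -> : cov_deriv g (ext k \o bdry) (N \o par k \o bdry) j w =
    cov_deriv g (ext k) (nor k) (rshift 1 j) (bdry w).
  rewrite /cov_deriv (derive_bdry (ext k) w j).1 (normal_bdry dw).
  rewrite (partial_ext j (@bdom_open k) dw (g := nor k \o bdry)); last exact: normal_bdry.
  by rewrite (derive_bdry (nor k) w j).1.
rewrite (derive_bdry (ext k) w l).1.
rewrite (inner_cov hc oU (@ext_smooth _ _ _ _ _ _ k) (@nor_smooth _ _ _ _ _ _ k)
  (@ext_dom _ _ _ _ _ _ k) (@nor_normal _ _ _ _ _ _ k) _ _ dw).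
have E : jac (nor k) (bdry w) *m (jac (ext k) (bdry w))^T =
    conf_shift c (ext k) (nor k) (bdry w) *: gram_mx (ext k) (bdry w)
    - (h / m.+1%:R) *: gram_mx (ext k) (bdry w).
  have uG := gram_mx_unit oU (@ext_smooth _ _ _ _ _ _ k) (@ext_immersion _ _ _ _ _ _ k) dw.
  rewrite -[(h / m.+1%:R) *: _]mul_scalar_mx -hB /shape_mx mulmxBl mulmxKV // mul_scalar_mx.
  by rewrite opprB addrC subrK.
rewrite E (derive_bdry (ext k) w j).1 innerE -/(conf_at c (ext k) (bdry w)).
set G := gram_mx _ _; set s := conf_shift _ _ _ _; set q := h / _.
have -> : (s *: G - q *: G) (rshift 1 j) (rshift 1 l) - s * G (rshift 1 j) (rshift 1 l) =
    - (q * G (rshift 1 j) (rshift 1 l)).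
  by rewrite !mxE; ring.
have -> : G (rshift 1 j) (rshift 1 l) =
    dotr (partial (rshift 1 l) (ext k) (bdry w)) (partial (rshift 1 j) (ext k) (bdry w)).
  rewrite dotrC -(row_jac oU sX (rshift 1 j) dw) -(row_jac oU sX (rshift 1 l) dw).
  exact: mulmx_trE.
by rewrite mulrN opprK mulrCA.
Qed.

Lemma boundary_umbilical p : bd p ->
  umbilical_cmc_in_sphere c F N (connected_component bd p).
Proof.
move=> bp; have [h Hh] := trace_shape_mx hc hcmc.
have subC : connected_component bd p `<=` bd := @connected_component_sub _ _ _.
exists N; split.
- split.
  + move=> k; have sd : bdry_dom c F N (connected_component bd p) k `<=` bdom k by move=> w [].
    apply: (smooth_sub sd) => i.
    apply: (dupto_ext (@bdom_open k) (f := nor k \o bdry)).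
      by move=> w dw; rewrite normal_bdry.
    exact: (smooth_bdry (@dom_open _ _ _ _ _ _ k) (@nor_smooth _ _ _ _ _ _ k)).
  + move=> q /subC [k [u [du u0 <-]]].
    by rewrite (ext_parE du (half0 u0)) (nor_parE du (half0 u0)); exact: nor_unit.
  + by move=> q /subC; case: hfree => _ _ _ _; exact.
  + move=> k w i [dw _]; rewrite (derive_bdry (ext k) w i).1.
    by rewrite (nor_parE dw (half_bdry w)); exact: nor_normal.
- by move=> k w [dw _]; exists (h / m.+1%:R); apply: bdry_weingarten_umbilical => // u; exact: Hh.
- exists (h / m.+1%:R *+ m) => k w [dw _].
  rewrite (bdry_weingarten_umbilical (h := h)) ?mxtrace_scalar //.
  by move=> u; exact: Hh.
Qed.

End Final.

(* The hypersurface has dimension n = m.+1, in the space form of dimension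
   n + 1 = m.+2. *)
Theorem corollary3p3 (R : realType) (c : R) (m : nat) (r : R)
    (S : topologicalType) (F N : S -> 'rV[R]_m.+2)
    (hc : c \in [:: -1; 0; 1])
    (hr : unit_ball_radius c m.+2 r)
    (hfree : free_boundary c F N r)
    (hcmc : constant_mean_curvature c F N)
    (hphi : phi2_subharmonic c F N) :
  forall p : S, boundary c F N p ->
    umbilical_cmc_in_sphere c F N (connected_component (boundary c F N) p).
Proof. exact: (boundary_umbilical hc hr hfree hcmc hphi). Qed.
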